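(* Let $\Omega\subset\mathbb{R}^{2}$ be a domain, $\vec F\in C^{1}(\Omega)$ a planar vector field, $H\in C^{0}(\Omega)$, and let $u:\Omega\to\mathbb{R}$ be a $C^{1}$ smooth function with $\nabla u+\vec F\neq0$ everywhere in $\Omega$ (i.e. $\Omega$ is nonsingular) such that, with $N\equiv\frac{\nabla u+\vec F}{|\nabla u+\vec F|}$, $$\int_{\Omega}N\cdot\nabla\varphi+\int_{\Omega}H\varphi=0\qquad\text{for all }\varphi\in C_{0}^{\infty}(\Omega).$$ Let $D\equiv|\nabla u+\vec F|$. Then for any point $p_{0}\in\Omega$ there exist a neighborhood $\Omega'\subset\Omega$ of $p_0$ and real functions $s,t\in C^{1}(\Omega')$ such that $\{t=\text{constant}\}$ and $\{s=\text{constant}\}$ are characteristic curves and seed curves, respectively. Moreover, there are positive functions $f,g\in C^{0}(\Omega')$ such that $$\nabla s=fN^{\perp},\qquad \nabla t=gDN .$$ Also $Nf$ and $N^{\perp}g$ exist and are continuous in $\Omega'$; in fact $f$ and $g$ satisfy $$Nf+fH=0,\qquad N^{\perp}g+\frac{(\operatorname{rot}\vec F)\,g}{D}=0 .$$ For a perhaps smaller neighborhood $\Omega''\subset\Omega'$ of $p_{0}$, the map $\Psi:(x,y)\in\Omega''\to(s,t)\in\Psi(\Omega'')$ is a $C^{1}$ diffeomorphism such that $$\Psi^{*}\Big(\frac{ds^{2}}{f^{2}}+\frac{dt^{2}}{g^{2}D^{2}}\Big)=dx^{2}+dy^{2}.$$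
   Context: $N^{\perp}$ is the rotation of $N$ by $-\pi/2$: if locally $N=(\cos\theta,\sin\theta)$ then $N^{\perp}=(\sin\theta,-\cos\theta)$. Seed curves are the integral curves of $N$; characteristic curves are the integral curves of $N^{\perp}$. For a continuous function $f$, $(Nf)(x,y)$ denotes the derivative, if it exists, of $f$ with respect to arc length $\tau$ at $(x,y)$ along the seed curve $\Lambda$ through $(x,y)$ with $d\Lambda/d\tau=N$; similarly $(N^{\perp}g)(x,y)$ is the derivative of $g$ with respect to arc length $\sigma$ at $(x,y)$ along the characteristic curve $\Gamma$ through $(x,y)$ with $d\Gamma/d\sigma=N^{\perp}$. For $\vec F=(F_{1},F_{2})$, $\operatorname{rot}\vec F:=(F_{2})_{x}-(F_{1})_{y}$. In the last formula $f,g,D$ are regarded as functions of $(s,t)$ via $\Psi$. *)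

(* Defs.v *)
From HB Require Import structures.
From mathcomp Require Import all_boot all_order all_algebra.
From mathcomp Require Import all_classical all_reals all_analysis.

Set Implicit Arguments.
Unset Strict Implicit.
Unset Printing Implicit Defensive.

Import Order.TTheory GRing.Theory Num.Theory.
Import numFieldNormedType.Exports.

Local Open Scope classical_set_scope.
Local Open Scope ring_scope.

(* The plane is R * R. Its library norm is the sup norm, so the Euclidean
   inner product and norm are defined separately. *)

Definition dotp (R : realType) (v w : R * R) : R := v.1 * w.1 + v.2 * w.2.

Definition enorm (R : realType) (v : R * R) : R := Num.sqrt (dotp v v).

(* Rotation by -pi/2: (cos a, sin a) is sent to (sin a, - cos a). *)
Definition perp (R : realType) (v : R * R) : R * R := (v.2, - v.1).

Definition pdx (R : realType) (h : R * R -> R) (p : R * R) : R :=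
  'D_((1 : R), (0 : R)) h p.

Definition pdy (R : realType) (h : R * R -> R) (p : R * R) : R :=
  'D_((0 : R), (1 : R)) h p.

Definition grad (R : realType) (h : R * R -> R) (p : R * R) : R * R :=
  (pdx h p, pdy h p).

Definition rot2 (R : realType) (F : R * R -> R * R) (p : R * R) : R :=
  pdx (fun q => (F q).2) p - pdy (fun q => (F q).1) p.

Definition C0on (R : realType) (A : set (R * R)) (h : R * R -> R) : Prop :=
  {within A, continuous h}.

(* For open A: all partial derivatives of order at most n exist on A and are
   continuous there. *)
Fixpoint Cnon (R : realType) (n : nat) (A : set (R * R)) (h : R * R -> R)
    : Prop :=
  match n with
  | 0 => C0on A h
  | m.+1 => [/\ C0on A h,
      forall p, A p -> derivable h p ((1 : R), (0 : R))
                    /\ derivable h p ((0 : R), (1 : R)),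
      Cnon m A (pdx h)
    & Cnon m A (pdy h)]
  end.

Definition C1on (R : realType) (A : set (R * R)) (h : R * R -> R) : Prop :=
  Cnon 1 A h.

Definition C1map_on (R : realType) (A : set (R * R)) (G : R * R -> R * R)
    : Prop :=
  C1on A (fun p => (G p).1) /\ C1on A (fun p => (G p).2).

(* C_0^oo(A), each function being extended by zero outside A. *)
Definition test_function (R : realType) (A : set (R * R)) (phi : R * R -> R)
    : Prop :=
  [/\ forall n, Cnon n setT phi,
      compact (closure [set p | phi p != 0])
    & closure [set p | phi p != 0] `<=` A].

Definition plane_domain (R : realType) (A : set (R * R)) : Prop :=
  [/\ open A, connected A & A !=set0].

Definition vfield (R : realType) (u : R * R -> R) (F : R * R -> R * R)
    (p : R * R) : R * R := grad u p + F p.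

Definition vlength (R : realType) (u : R * R -> R) (F : R * R -> R * R)
    (p : R * R) : R := enorm (vfield u F p).

Definition vnormal (R : realType) (u : R * R -> R) (F : R * R -> R * R)
    (p : R * R) : R * R := (vlength u F p)^-1 *: vfield u F p.

(* gam restricted to the open interval I is an integral curve of V inside A.
   For a unit field V the parameter is arc length. *)
Definition integral_curve (R : realType) (V : R * R -> R * R)
    (A : set (R * R)) (I : set R) (gam : R -> R * R) : Prop :=
  [/\ open I, is_interval I, I !=set0
    & forall x, I x -> A (gam x) /\ is_derive x (1 : R) gam (V (gam x))].

Definition is_integral_curve_in (R : realType) (V : R * R -> R * R)
    (A C : set (R * R)) : Prop :=
  exists I gam, integral_curve V A I gam /\ C = gam @` I.

(* (V h)(p) exists and equals l, where (V h)(p) is the derivative of h along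
   the integral curve of V through p. As V need only be continuous, such a
   curve is required to exist and every such curve must give the value l. *)
Definition is_curve_derive (R : realType) (V : R * R -> R * R)
    (A : set (R * R)) (h : R * R -> R) (p : R * R) (l : R) : Prop :=
  (exists I gam, [/\ integral_curve V A I gam, I 0 & gam 0 = p]) /\
  (forall I gam, integral_curve V A I gam -> I 0 -> gam 0 = p ->
     is_derive (0 : R) (1 : R) (h \o gam) l).

Definition C1_diffeo (R : realType) (A B : set (R * R))
    (Psi Phi : R * R -> R * R) : Prop :=
  [/\ open A, open B & B = Psi @` A] /\
  [/\ C1map_on A Psi, C1map_on B Phi & forall p, A p -> Phi (Psi p) = p].

(* A metric sends a base point and two tangent vectors to a scalar. *)

Definition euclidean_metric (R : realType) (p v w : R * R) : R := dotp v w.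

(* The metric a ds^2 + b dt^2 in the coordinates q = (s, t). *)
Definition diag_metric (R : realType) (a b : R * R -> R) (q v w : R * R) : R :=
  a q * (v.1 * w.1) + b q * (v.2 * w.2).

Definition pullback (R : realType) (Psi : R * R -> R * R)
    (G : R * R -> R * R -> R * R -> R) (p v w : R * R) : R :=
  G (Psi p) ('d Psi p v) ('d Psi p w).

(* Main.v *)
(* The unit field N and the field V = D N^perp, a rotation of grad u + F, are
   continuous, and both have a continuous weak divergence: H for N by
   hypothesis, rot F for V since grad u is curl free.

   Let (a,b) be such a field with divergence h. Its flux through the boundary of
   a rectangle is the integral of h over the rectangle (for N, test the weak
   equation against products of bumps), so that there is a function W with
   W_y = a and W_x = Q - b, where Q(x,y) is the integral of h(x,.) from y0 to y.
   When a is nonzero, the merely continuous equation y' = b/a of the integral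
   curves reads w' = q(x,w) in the coordinates (x, W), where q_w = h/a is
   continuous. Its flow is therefore C^1, and the inverse of the flow yields S
   with grad S = f (-b,a), f > 0, and f' = - f h along the integral curves.

   For N this gives -s and f, and for V it gives t and g. As grad s and grad t
   are orthogonal, (s,t) is a local C^1 diffeomorphism, and its level curves,
   reparametrized by arc length, are the characteristic and seed curves. *)
Require Import Defs.
From HB Require Import structures.
From mathcomp Require Import all_boot all_order all_algebra.
From mathcomp Require Import all_classical all_reals all_analysis.
From mathcomp Require Import ring lra.

Set Implicit Arguments.
Unset Strict Implicit.
Unset Printing Implicit Defensive.

Import Order.TTheory GRing.Theory Num.Theory.
Import numFieldNormedType.Exports.
Local Open Scope classical_set_scope.
Local Open Scope ring_scope.

(** * Primitives and oriented integrals *)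

(** The obstacle is regularity. [N] is merely continuous, so the classical uniqueness theorem for
    its integral curves does not apply, and [u] is only C^1, so that not even the curl of its
    gradient has a pointwise meaning. All divergence identities are therefore handled as integrals
    of continuous functions over rectangles. Uniqueness of integral curves is neither proved nor
    used: the gradient of [S] is continuous and orthogonal to the field, so [S] is constant along
    every integral curve, and the derivatives of [f] and [g] can be computed along all of them at
    once. The parameter is treated in the same way: an arc length parametrized characteristic curve
    runs along D N^perp at speed factor 1/D, and this factor, called [lam] below, is the source of
    the denominator D in the equation for [g]. Functions given on Omega are composed with the
    retraction onto a small closed square; they become total and jointly continuous on the plane,
    while derivatives and flux identities are claimed only inside the square. *)

Definition between (R : realType) (a b x : R) := (a <= x <= b) || (b <= x <= a).

Lemma between_sym (R : realType) (a b x : R) : between a b x = between b a x.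
Proof. by rewrite /between orbC. Qed.

Lemma between_dist (R : realType) (a b x : R) : between a b x ->
  `|x - a| <= `|b - a|.
Proof.
case/orP=> /andP[h1 h2].
  by rewrite !ger0_norm ?subr_ge0 ?(le_trans h1 h2)// lerD2r.
by rewrite !ler0_norm ?subr_le0 ?(le_trans h1 h2)// !opprB lerD2l lerN2.
Qed.

Lemma between_ball (R : realType) (c r a b x : R) :
  `|a - c| < r -> `|b - c| < r -> between a b x -> `|x - c| < r.
Proof.
by rewrite /between !ltr_norml => /andP[? ?] /andP[? ?] /orP[]/andP[? ?];
  apply/andP; split; lra.
Qed.

Lemma continuous_atP (R : realType) (f : R -> R) (x : R) :
  {for x, continuous f} <->
  forall e, 0 < e -> exists2 d, 0 < d &
    forall y, `|y - x| < d -> `|f y - f x| < e.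
Proof.
split=> [/cvgrPdist_lt h e e0|h].
  have [d /= d0 hd] := h e e0.
  by exists d => // y yx; rewrite distrC; apply: hd; rewrite /= distrC.
apply/cvgrPdist_lt => e e0; have [d d0 hd] := h e e0.
by exists d => //= y /= yx; rewrite distrC; apply: hd; rewrite distrC.
Qed.

Lemma continuous2_atP (R : realType) (h : R * R -> R) (p : R * R) :
  {for p, continuous h} <->
  forall e, 0 < e -> exists2 d, 0 < d &
    forall q, `|q.1 - p.1| < d -> `|q.2 - p.2| < d -> `|h q - h p| < e.
Proof.
split=> [/cvgrPdist_lt H e e0|H].
  have [[A B] /= [/nbhs_ballP [d1 /= d10 h1] /nbhs_ballP[d2 /= d20 h2]] hd] := H e e0.
  exists (Num.min d1 d2); first by rewrite lt_min d10 d20.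
  move=> q; rewrite !lt_min => /andP[q1 _] /andP[_ q2]; rewrite distrC.
  apply: (hd q); split; [apply: h1|apply: h2]; by rewrite /ball /= distrC.
apply/cvgrPdist_lt => e e0; have [d d0 hd] := H e e0.
exists (ball p.1 d, ball p.2 d).
  by split; apply: nbhsx_ballx.
move=> q /= [q1 q2]; rewrite distrC; apply: hd; rewrite distrC.
  exact: q1.
exact: q2.
Qed.

(** The difference quotient is cleared, so that estimates need no separate treatment of [y = x]. *)
Lemma is_derive1P (R : realType) (f : R -> R) (x l : R) :
  is_derive x (1 : R) f l <->
  forall e, 0 < e -> exists2 d, 0 < d &
    forall y, `|y - x| < d -> `|f y - f x - l * (y - x)| <= e * `|y - x|.
Proof.
split=> [D e e0|H].
  have [+ +] := D; rewrite /derivable /derive => cf lf.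
  have /cvgrPdist_le h : h^-1 *: (f (h *: (1:R) + x) - f x) @[h --> 0^'] --> l.
    by rewrite -lf.
  have [d /= d0 hd] := h e e0; exists d => // y yx.
  have [->|yx0] := eqVneq y x; first by rewrite !subrr mulr0 subrr normr0 mulr0.
  have yx1 : y - x != 0 by rewrite subr_eq0.
  have := hd (y - x); rewrite /= sub0r normrN => /(_ yx yx1).
  rewrite /GRing.scale /= mulr1 subrK distrC => hh.
  rewrite -(ler_pM2r (_ : 0 < `|y - x|^-1)); last by rewrite invr_gt0 normr_gt0.
  rewrite -mulrA mulfV ?normr_eq0// mulr1 -normfV -normrM mulrBl.
  by rewrite -[l * _ * _]mulrA mulfV// mulr1 mulrC.
have cv : h^-1 *: (f (h *: (1:R) + x) - f x) @[h --> 0^'] --> l.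
  apply/cvgrPdist_le => e e0; have [d d0 hd] := H e e0.
  exists d => //= h; rewrite /= sub0r normrN => hd1 h0.
  have := hd (h + x); rewrite addrK => /(_ hd1).
  rewrite /GRing.scale /= mulr1 => hh; rewrite distrC.
  rewrite -(ler_pM2r (_ : 0 < `|h|)) ?normr_gt0//.
  by rewrite -normrM mulrBl mulrC mulrA mulfV // mul1r.
split; first by apply/cvg_ex; exists l.
exact: (cvg_lim (@norm_hausdorff _ _) cv).
Qed.

Lemma is_derive1_continuous (R : realType) (f : R -> R) (x l : R) :
  is_derive x (1 : R) f l -> {for x, continuous f}.
Proof.
by case=> d _; apply: differentiable_continuous; exact/derivable1_diffP.
Qed.

Lemma is_derive1_local (R : realType) (f g : R -> R) (x l r : R) : 0 < r ->
  (forall y, `|y - x| < r -> f y = g y) ->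
  is_derive x (1 : R) f l -> is_derive x (1 : R) g l.
Proof.
move=> r0 fg /is_derive1P D; apply/is_derive1P => e e0.
have [d d0 hd] := D e e0; exists (Num.min d r); first by rewrite lt_min d0.
move=> y; rewrite lt_min => /andP[yd yr]; rewrite -!fg ?hd//.
by rewrite subrr normr0.
Qed.

(** No order is imposed on [a] and [b]: the segment may be run in either direction, as oriented
    integrals require. *)
Lemma mean_value (R : realType) (f df : R -> R) (a b : R) :
  (forall x, between a b x -> is_derive x (1 : R) f (df x)) ->
  exists2 c, between a b c & f b - f a = df c * (b - a).
Proof.
wlog ab : a b / a <= b => [hw|] D.
  case: (leP a b) => [/hw|/ltW /hw]; first exact.
  case=> [x|c cab e]; first by rewrite between_sym; exact: D.
  by exists c; [rewrite between_sym|rewrite -opprB e -mulrN opprB].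
have [] := @MVT_segment _ f df a b ab.
- move=> x; rewrite in_itv /= => /andP[? ?]; apply: D.
  by apply/orP; left; apply/andP; split; exact: ltW.
- apply: continuous_in_subspaceT => x; rewrite inE /= in_itv /= => xab.
  by apply: (@is_derive1_continuous _ _ _ (df x)); apply: D; rewrite /between xab.
- by move=> c; rewrite in_itv /= => cab e; exists c => //; rewrite /between cab.
Qed.

Lemma mean_value_le (R : realType) (f df : R -> R) (a b M : R) :
  (forall x, between a b x -> is_derive x (1 : R) f (df x)) ->
  (forall x, between a b x -> `|df x| <= M) ->
  `|f b - f a| <= M * `|b - a|.
Proof.
move=> D B; have [c cab ->] := mean_value D.
by rewrite normrM ler_wpM2r// B.
Qed.

Lemma is_derive_sub (R : realType) (f g : R -> R) (x df dg : R) :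
  is_derive x (1 : R) f df -> is_derive x (1 : R) g dg ->
  is_derive x (1 : R) (fun z => f z - g z) (df - dg).
Proof. by move=> *; apply: is_deriveB. Qed.

Lemma eq_derive_increment (R : realType) (f g d : R -> R) (a b : R) :
  (forall x, between a b x -> is_derive x (1 : R) f (d x)) ->
  (forall x, between a b x -> is_derive x (1 : R) g (d x)) ->
  f b - f a = g b - g a.
Proof.
move=> Df Dg; apply/eqP; rewrite -subr_eq0 -normr_le0.
have -> : f b - f a - (g b - g a) = (f b - g b) - (f a - g a) by ring.
rewrite -[X in _ <= X](mul0r `|b - a|).
apply: (@mean_value_le _ (fun z => f z - g z) (fun=> 0)) => [x xab|x _].
  by rewrite -(subrr (d x)); apply: is_derive_sub; [exact: Df|exact: Dg].
by rewrite normr0.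
Qed.

Lemma primitive_itv (R : realType) (f : R -> R) (a b : R) : continuous f ->
  exists P : R -> R, forall x, a < x < b -> is_derive x (1 : R) P (f x).
Proof.
move=> cf; case: (ltP a b) => ab; last first.
  by exists (fun=> 0) => x /andP[ax xb]; have := lt_trans ax xb; rewrite ltNge ab.
exists (fun x => \int[@lebesgue_measure R]_(t in `[a, x]) f t).
move=> x /andP[ax xb].
have fi : (@lebesgue_measure R).-integrable `[a, b] (EFin \o f).
  apply: continuous_compact_integrable; first exact: segment_compact.
  exact: continuous_subspaceT.
have [D e] := continuous_FTC1_closed xb fi ax (cf x).
by split; [exact: D|rewrite -derive1E].
Qed.

(** Primitives on the intervals []-n, n[] have equal derivatives on overlaps; normalized at 0 they
    agree there and glue to one primitive on the line. *)
Lemma primitive_exists (R : realType) (f : R -> R) : continuous f ->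
  exists P : R -> R, forall x : R, is_derive x (1 : R) P (f x).
Proof.
move=> cf.
pose G (n : nat) := projT1 (cid (primitive_itv (- n%:R) n%:R cf)).
have GP n (x : R) : - n%:R < x < n%:R -> is_derive x (1 : R) (G n) (f x).
  by rewrite /G; case: cid => P /= /(_ x).
(* This integer exceeds [|x| + 1], so the unit ball around [x] lies where [G (N x)] is a
   primitive. *)
pose N (x : R) := (Num.trunc `|x|).+2.
have NP x y : `|y - x| < 1 -> - (N x)%:R < y < (N x)%:R.
  move=> yx; rewrite -ltr_norml /N -natr1.
  rewrite -[y](subrK x) (le_lt_trans (ler_normD _ _))// addrC ltrD//.
  exact: Num.Theory.truncnS_gt.
pose P x := G (N x) x - G (N x) 0.
have PE n x : - n%:R < x < n%:R -> P x = G n x - G n 0.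
  move=> xn; apply: eq_derive_increment => [z zx|]; last first.
    move=> z zx; apply: GP; have : `|x| < n%:R by rewrite ltr_norml.
    by rewrite -ltr_norml; apply: le_lt_trans; rewrite -[z]subr0 -[x]subr0 between_dist.
  apply: GP; rewrite -ltr_norml.
  have := NP x x; rewrite subrr normr0 ltr01 => /(_ isT); rewrite -ltr_norml.
  by apply: le_lt_trans; rewrite -[z]subr0 -[x]subr0 between_dist.
exists P => x.
have D : is_derive x (1 : R) (fun z => G (N x) z - G (N x) 0) (f x).
  rewrite -[f x]subr0; apply: is_derive_sub.
  by apply: GP; apply: NP; rewrite subrr normr0.
apply: (is_derive1_local ltr01 _ D) => z zx; rewrite (PE (N x))//.
exact: NP.
Qed.

(* An unspecified function unless f has an antiderivative. *)
Definition primitive (R : realType) (f : R -> R) : R -> R :=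
  get [set P | forall x, is_derive x (1 : R) P (f x)].

(** Encoded as an increment of a primitive, so that additivity holds for endpoints in any order and
    without integrability conditions. *)
Definition oint (R : realType) (f : R -> R) (a b : R) : R :=
  primitive f b - primitive f a.

Lemma primitiveP (R : realType) (f : R -> R) x : continuous f ->
  is_derive x (1 : R) (primitive f) (f x).
Proof.
move=> cf; have [P hP] := primitive_exists cf.
by move: x; apply: (@getPex _ [set P | forall x, is_derive x (1 : R) P (f x)]);
  exists P.
Qed.

Lemma oint_derive (R : realType) (f : R -> R) a x : continuous f ->
  is_derive x (1 : R) (oint f a) (f x).
Proof.
move=> cf; rewrite -[f x]subr0; apply: is_derive_sub; exact: primitiveP.
Qed.

Lemma oint_eq (R : realType) (f P : R -> R) a b : continuous f ->
  (forall x, between a b x -> is_derive x (1 : R) P (f x)) ->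
  oint f a b = P b - P a.
Proof.
by move=> cf D; apply: (@eq_derive_increment _ _ _ f) => // x _; exact: primitiveP.
Qed.

Lemma oint_congr (R : realType) (f g : R -> R) a b : continuous f -> continuous g ->
  (forall x, between a b x -> f x = g x) -> oint f a b = oint g a b.
Proof.
by move=> cf cg fg; apply: oint_eq => // x /fg ->; exact: primitiveP.
Qed.

Lemma ointxx (R : realType) (f : R -> R) a : oint f a a = 0.
Proof. exact: subrr. Qed.

Lemma ointC (R : realType) (f : R -> R) a b : oint f a b = - oint f b a.
Proof. by rewrite /oint opprB. Qed.

Lemma oint_chasles (R : realType) (f : R -> R) a b c :
  oint f a b + oint f b c = oint f a c.
Proof. by rewrite /oint addrC subrKA. Qed.

Lemma oint_le (R : realType) (f : R -> R) a b M : continuous f ->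
  (forall x, between a b x -> `|f x| <= M) -> `|oint f a b| <= M * `|b - a|.
Proof. by move=> cf; apply: mean_value_le => x _; exact: primitiveP. Qed.

Lemma ointD (R : realType) (f g : R -> R) a b : continuous f -> continuous g ->
  oint (fun x => f x + g x) a b = oint f a b + oint g a b.
Proof.
move=> cf cg; have -> : oint f a b + oint g a b =
    (primitive f b + primitive g b) - (primitive f a + primitive g a).
  by rewrite /oint; ring.
apply: (@oint_eq _ _ (fun x => primitive f x + primitive g x)).
  by move=> x; apply: continuousD; [exact: cf|exact: cg].
by move=> x _; apply: is_deriveD; exact: primitiveP.
Qed.

Lemma ointZ (R : realType) (f : R -> R) k a b : continuous f ->
  oint (fun x => k * f x) a b = k * oint f a b.
Proof.
move=> cf; rewrite /oint mulrBr.
apply: (@oint_eq _ _ (fun x => k * primitive f x)).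
  by move=> x; apply: continuousM; [exact: cst_continuous|exact: cf].
by move=> x _; apply: (@is_deriveZ _ _ _ (primitive f)); exact: primitiveP.
Qed.

Lemma ointN (R : realType) (f : R -> R) a b : continuous f ->
  oint (fun x => - f x) a b = - oint f a b.
Proof.
move=> cf; rewrite -mulN1r -ointZ//; congr (oint _ _ _).
by apply/funext => x; rewrite mulN1r.
Qed.

Lemma ointB (R : realType) (f g : R -> R) a b : continuous f -> continuous g ->
  oint (fun x => f x - g x) a b = oint f a b - oint g a b.
Proof.
move=> cf cg; rewrite -ointN// -ointD// => x.
by apply: continuousN; exact: cg.
Qed.

(** * Jointly continuous functions of two variables *)

(** Curried, so that the sections are functions of one variable to which [oint] applies. *)
Definition cont2 (R : realType) (h : R -> R -> R) := forall x y e : R, 0 < e ->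
  exists2 d, 0 < d &
    forall x' y', `|x' - x| < d -> `|y' - y| < d -> `|h x' y' - h x y| < e.

Lemma cont2P (R : realType) (h : R -> R -> R) :
  cont2 h <-> continuous (fun p : R * R => h p.1 p.2).
Proof.
split=> [H [x y]|H x y e e0].
  apply/continuous2_atP => e e0; have [d d0 hd] := H x y e e0.
  by exists d => // -[x' y'] /=; apply: hd.
have /continuous2_atP /(_ e e0) [d d0 hd] := H (x, y).
by exists d => // x' y' ? ?; apply: (hd (x', y')).
Qed.

Lemma continuous_comp2 (R : realType) (T : topologicalType) (h : R -> R -> R)
  (f g : T -> R) : cont2 h -> continuous f -> continuous g ->
  continuous (fun x => h (f x) (g x)).
Proof.
move=> /cont2P ch cf cg x.
apply: (@continuous_comp _ _ _ (fun z => (f z, g z)) (fun p : R * R => h p.1 p.2)).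
  have cfg : (fun z => (f z, g z)) @ x --> (f x, g x) by exact: cvg_pair (cf x) (cg x).
  exact: cfg.
exact: ch.
Qed.

Lemma cont2_comp (R : realType) (h u v : R -> R -> R) : cont2 h -> cont2 u ->
  cont2 v -> cont2 (fun x y => h (u x y) (v x y)).
Proof.
move=> ch /cont2P cu /cont2P cv; apply/cont2P.
exact: (continuous_comp2 ch cu cv).
Qed.

Lemma cont2_fst (R : realType) (f : R -> R) : continuous f ->
  cont2 (fun x _ => f x).
Proof.
move=> cf; apply/cont2P => p.
by apply: (@continuous_comp _ _ _ fst f); [exact: cvg_fst|exact: cf].
Qed.

Lemma cont2_snd (R : realType) (f : R -> R) : continuous f ->
  cont2 (fun _ y => f y).
Proof.
move=> cf; apply/cont2P => p.
by apply: (@continuous_comp _ _ _ snd f); [exact: cvg_snd|exact: cf].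
Qed.

Lemma cont2_proj1 (R : realType) : @cont2 R (fun x _ => x).
Proof. by apply: cont2_fst => x; exact: cvg_id. Qed.

Lemma cont2_proj2 (R : realType) : @cont2 R (fun _ y => y).
Proof. by apply: cont2_snd => x; exact: cvg_id. Qed.

Lemma cont2_swap (R : realType) (h : R -> R -> R) : cont2 h ->
  cont2 (fun x y => h y x).
Proof.
by move=> ch x y e /(ch y x)[d d0 hd]; exists d => // x' y' ? ?; apply: hd.
Qed.

Lemma cont2_section (R : realType) (h : R -> R -> R) x : cont2 h ->
  continuous (h x).
Proof.
by move=> ch; apply: (continuous_comp2 ch) => y; [exact: cst_continuous|].
Qed.

Lemma cont2_sectionr (R : realType) (h : R -> R -> R) y : cont2 h ->
  continuous (h^~ y).
Proof.
by move=> ch; apply: (continuous_comp2 ch) => x; [|exact: cst_continuous].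
Qed.

Lemma cont2_sub (R : realType) (f g : R -> R -> R) : cont2 f -> cont2 g ->
  cont2 (fun x y => f x y - g x y).
Proof.
move=> /cont2P cf /cont2P cg; apply/cont2P => p.
by apply: continuousB; [exact: cf|exact: cg].
Qed.

Lemma cont2_opp (R : realType) (f : R -> R -> R) : cont2 f ->
  cont2 (fun x y => - f x y).
Proof.
by move=> /cont2P cf; apply/cont2P => p; apply: cvgN; exact: cf.
Qed.

Lemma cont2_add (R : realType) (f g : R -> R -> R) : cont2 f -> cont2 g ->
  cont2 (fun x y => f x y + g x y).
Proof.
move=> /cont2P cf /cont2P cg; apply/cont2P => p.
by apply: continuousD; [exact: cf|exact: cg].
Qed.

Lemma cont2_mul (R : realType) (f g : R -> R -> R) : cont2 f -> cont2 g ->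
  cont2 (fun x y => f x y * g x y).
Proof.
move=> /cont2P cf /cont2P cg; apply/cont2P => p.
by apply: continuousM; [exact: cf|exact: cg].
Qed.

Lemma cont2_inv (R : realType) (f : R -> R -> R) : cont2 f ->
  (forall x y, f x y != 0) -> cont2 (fun x y => (f x y)^-1).
Proof.
move=> /cont2P cf f0; apply/cont2P => p.
by apply: continuousV; [exact: f0|exact: cf].
Qed.

(** Tube lemma: radii range over the right neighbourhoods of 0, and the covering form of compactness
    of [[a, b]] turns the local radii into a single one. *)
Lemma cont2_tube (R : realType) (h : R -> R -> R) (x a b e : R) :
  cont2 h -> 0 < e -> exists2 d, 0 < d &
    forall x' y, `|x' - x| < d -> a <= y <= b -> `|h x' y - h x y| < e.
Proof.
move=> ch e0.
have /compact_near_coveringP K := @segment_compact R a b.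
have [] := K _ ((0 : R)^'+) (fun d y => forall x', `|x' - x| < d ->
  `|h x' y - h x y| < e) _.
  move=> y _; have [d d0 hd] := ch x y (e / 2) (divr_gt0 e0 (ltr0Sn _ 1)).
  exists (ball y d, [set z | 0 < z < d]); first split => /=.
  - exact: nbhsx_ballx.
  - exists d => //= z; rewrite /= sub0r normrN => zd z0.
    by rewrite z0 (le_lt_trans (ler_norm z) zd).
  - move=> [y' d'] /= [yy' /andP[d'0 d'd]] x' xx'.
    have E : h x' y' - h x y' = (h x' y' - h x y) - (h x y' - h x y) by ring.
    rewrite E (le_lt_trans (ler_normB _ _))// (splitr e) ltrD// hd//.
    + exact: lt_trans d'd.
    + by rewrite distrC.
    + by rewrite subrr normr0.
    + by rewrite distrC.
move=> d /= d0 hd; exists (d / 2); first by rewrite divr_gt0.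
move=> x' y xd yab; apply: (hd (d / 2)) => //=.
- by rewrite sub0r normrN gtr0_norm ?divr_gt0// ltr_pdivrMr// mulr_natr mulr2n ltrDl.
- by rewrite divr_gt0.
Qed.

(** The increment splits into an integral between [y] and [y'], small because [h] is bounded near
    [(x, y)], and an integral over the fixed segment, small because [h x'] is uniformly close to
    [h x] there. *)
Lemma cont2_oint (R : realType) (h : R -> R -> R) (y0 : R) :
  cont2 h -> cont2 (fun x y => oint (h x) y0 y).
Proof.
move=> ch x y e e0.
pose K := `|y - y0| + 1.
have K0 : 0 < K by rewrite /K ltr_wpDl.
have [d1 d10 h1] := @cont2_tube _ _ x (Num.min y0 y) (Num.max y0 y) (e / 2 / K)
  ch (divr_gt0 (divr_gt0 e0 (ltr0Sn _ 1)) K0).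
have [d2 d20 h2] := ch x y 1 ltr01.
pose M := `|h x y| + 1.
have M0 : 0 < M by rewrite /M ltr_wpDl.
exists (Num.min d1 (Num.min d2 (e / 2 / M))).
  by rewrite !lt_min d10 d20 !divr_gt0.
move=> x' y'; rewrite !lt_min => /and3P[x1 x2 _] /and3P[_ y2 y3].
have E : oint (h x') y0 y' - oint (h x) y0 y =
   oint (h x') y y' + oint (fun z => h x' z - h x z) y0 y.
  by rewrite ointB; [|exact: cont2_section..]; rewrite -(oint_chasles _ y0 y y'); ring.
rewrite E (le_lt_trans (ler_normD _ _))// (splitr e); apply: ltr_leD.
  apply: (@le_lt_trans _ _ (M * `|y' - y|)).
    apply: oint_le; first exact: cont2_section.
    move=> z zy; have zd : `|z - y| < d2 by apply: le_lt_trans y2; rewrite between_dist.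
    have := h2 x' z x2 zd; rewrite /M => hh.
    by rewrite -[h x' z](subrK (h x y)) (le_trans (ler_normD _ _))// addrC lerD// ltW.
  by rewrite mulrC -ltr_pdivlMr.
have -> : e / 2 = e / 2 / K * K by rewrite divfK// gt_eqF.
apply: (@le_trans _ _ (e / 2 / K * `|y - y0|)); last first.
  by rewrite ler_wpM2l ?lerDl// !divr_ge0// ltW.
apply: oint_le.
  by move=> w; apply: continuousB; exact: cont2_section.
move=> z zy; apply: ltW; apply: h1 => //.
by rewrite ge_min le_max; case/orP: zy => /andP[-> ->]; rewrite ?orbT.
Qed.

(** * Differentiation and inversion with continuous partial derivatives *)

(** One mean value theorem along each axis. Both endpoints are free, and this uniformity is what
    local inversion needs. *)
Lemma strict_derivative2 (R : realType) (h hx hy : R -> R -> R) (x0 y0 r : R) :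
  0 < r ->
  (forall x y, `|x - x0| < r -> `|y - y0| < r ->
     is_derive x (1 : R) (h^~ y) (hx x y) /\ is_derive y (1 : R) (h x) (hy x y)) ->
  (forall e, 0 < e -> exists2 d, 0 < d & forall x y, `|x - x0| < d ->
     `|y - y0| < d -> `|hx x y - hx x0 y0| < e /\ `|hy x y - hy x0 y0| < e) ->
  forall e, 0 < e -> exists2 d, 0 < d & forall x y x' y',
    `|x - x0| < d -> `|y - y0| < d -> `|x' - x0| < d -> `|y' - y0| < d ->
    `|h x' y' - h x y - hx x0 y0 * (x' - x) - hy x0 y0 * (y' - y)|
      <= e * (`|x' - x| + `|y' - y|).
Proof.
move=> r0 D C e e0; have [d d0 hd] := C e e0.
exists (Num.min d r); first by rewrite lt_min d0.
move=> x y x' y'; rewrite !lt_min => /andP[xd xr] /andP[yd yr] /andP[xd' xr'] /andP[yd' yr'].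
have [c1 c1b e1] : exists2 c, between x x' c & h x' y' - h x y' = hx c y' * (x' - x).
  apply: (@mean_value _ (h^~ y') (hx^~ y')) => z zb.
  by have [] := D z y' (between_ball xr xr' zb) yr'.
have [c2 c2b e2] : exists2 c, between y y' c & h x y' - h x y = hy x c * (y' - y).
  apply: (@mean_value _ (h x) (hy x)) => z zb.
  by have [] := D x z xr (between_ball yr yr' zb).
have -> : h x' y' - h x y - hx x0 y0 * (x' - x) - hy x0 y0 * (y' - y) =
   (hx c1 y' - hx x0 y0) * (x' - x) + (hy x c2 - hy x0 y0) * (y' - y).
  have -> : h x' y' - h x y = (h x' y' - h x y') + (h x y' - h x y) by ring.
  by rewrite e1 e2; ring.
rewrite (le_trans (ler_normD _ _))// !normrM mulrDr.
have [h1 _] := hd c1 y' (between_ball xd xd' c1b) yd'.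
have [_ h2] := hd x c2 xd (between_ball yd yd' c2b).
by rewrite lerD// ler_wpM2r// ltW.
Qed.

Lemma chain_rule2 (R : realType) (h hx hy : R -> R -> R) (X Y : R -> R)
    (t X' Y' r : R) : 0 < r ->
  (forall x y, `|x - X t| < r -> `|y - Y t| < r ->
     is_derive x (1 : R) (h^~ y) (hx x y) /\ is_derive y (1 : R) (h x) (hy x y)) ->
  (forall e, 0 < e -> exists2 d, 0 < d & forall x y, `|x - X t| < d ->
     `|y - Y t| < d -> `|hx x y - hx (X t) (Y t)| < e /\
                       `|hy x y - hy (X t) (Y t)| < e) ->
  is_derive t (1 : R) X X' -> is_derive t (1 : R) Y Y' ->
  is_derive t (1 : R) (fun z => h (X z) (Y z)) (hx (X t) (Y t) * X' + hy (X t) (Y t) * Y').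
Proof.
move=> r0 D C DX DY.
have S := strict_derivative2 r0 D C.
have /continuous_atP cX := is_derive1_continuous DX.
have /continuous_atP cY := is_derive1_continuous DY.
move/is_derive1P in DX; move/is_derive1P in DY.
set a := hx _ _ in S *; set b := hy _ _ in S *.
apply/is_derive1P => e e0.
(* The total weight of the errors: [|X'| + 1] and [|Y'| + 1] are Lipschitz bounds for [X] and [Y] at
   [t], while [|a|] and [|b|] multiply their linearization errors. *)
pose K := `|X'| + `|Y'| + 2 + `|a| + `|b|.
have K0 : 0 < K by rewrite /K; have := normr_ge0 X'; have := normr_ge0 Y';
  have := normr_ge0 a; have := normr_ge0 b; lra.
have eK0 : 0 < e / 2 / K by rewrite !divr_gt0.
have [d d0 hd] := S _ eK0.
have [d1 d10 h1] := cX d d0.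
have [d2 d20 h2] := cY d d0.
(* The bound 1 yields the Lipschitz estimates [bX] and [bY], the other one the small error. *)
have m0 : 0 < Num.min 1 (e / 2 / K) by rewrite lt_min ltr01.
have [d3 d30 h3] := DX _ m0.
have [d4 d40 h4] := DY _ m0.
exists (Num.min (Num.min d1 d2) (Num.min d3 d4)); first by rewrite !lt_min d10 d20 d30.
move=> z; rewrite !lt_min => /andP[/andP[z1 z2] /andP[z3 z4]].
have := hd (X t) (Y t) (X z) (Y z); rewrite !subrr !normr0.
move=> /(_ d0 d0 (h1 z z1) (h2 z z2)) {hd h1 h2} hd.
have {}h3 := h3 z z3; have {}h4 := h4 z z4.
set u := `|z - t| in h3 h4 *; have u0 : 0 <= u by exact: normr_ge0.
have k1 : Num.min 1 (e / 2 / K) * u <= u by rewrite ler_piMl// ge_min lexx.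
have k2 : Num.min 1 (e / 2 / K) * u <= e / 2 / K * u.
  by rewrite ler_wpM2r// ge_min lexx orbT.
have bX : `|X z - X t| <= (`|X'| + 1) * u.
  have -> : X z - X t = X z - X t - X' * (z - t) + X' * (z - t) by ring.
  rewrite (le_trans (ler_normD _ _))// normrM -/u mulrDl mul1r addrC lerD2l.
  exact: le_trans h3 k1.
have bY : `|Y z - Y t| <= (`|Y'| + 1) * u.
  have -> : Y z - Y t = Y z - Y t - Y' * (z - t) + Y' * (z - t) by ring.
  rewrite (le_trans (ler_normD _ _))// normrM -/u mulrDl mul1r addrC lerD2l.
  exact: le_trans h4 k1.
have -> : h (X z) (Y z) - h (X t) (Y t) - (a * X' + b * Y') * (z - t) =
  (h (X z) (Y z) - h (X t) (Y t) - a * (X z - X t) - b * (Y z - Y t)) +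
  (a * (X z - X t - X' * (z - t)) + b * (Y z - Y t - Y' * (z - t))) by ring.
have q1 : `|h (X z) (Y z) - h (X t) (Y t) - a * (X z - X t) - b * (Y z - Y t)|
    <= e / 2 / K * ((`|X'| + `|Y'| + 2) * u).
  apply: (le_trans hd); rewrite ler_wpM2l//; first exact: ltW.
  by move: bX bY; lra.
have q2 : `|a * (X z - X t - X' * (z - t)) + b * (Y z - Y t - Y' * (z - t))|
    <= e / 2 / K * ((`|a| + `|b|) * u).
  rewrite (le_trans (ler_normD _ _))// !normrM.
  have -> : e / 2 / K * ((`|a| + `|b|) * u) =
    `|a| * (e / 2 / K * u) + `|b| * (e / 2 / K * u) by ring.
  by rewrite lerD// ler_wpM2l//; [exact: le_trans h3 k2|exact: le_trans h4 k2].
rewrite (le_trans (ler_normD _ _))// (le_trans (lerD q1 q2))//.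
have -> : e / 2 / K * ((`|X'| + `|Y'| + 2) * u) + e / 2 / K * ((`|a| + `|b|) * u)
  = e / 2 * u * (K^-1 * K) by rewrite /K; ring.
rewrite mulVf ?gt_eqF// mulr1 ler_wpM2r// ler_pdivrMr// ler_peMr ?ltW//.
by rewrite ltr1n.
Qed.

Lemma is_derive1_comp_at (R : realType) (f g : R -> R) (x df dg : R) :
  is_derive (g x) (1 : R) f df -> is_derive x (1 : R) g dg ->
  is_derive x (1 : R) (f \o g) (df * dg).
Proof.
move=> Df Dg; have ? : differentiable g x by exact/derivable1_diffP.
have ? : differentiable f (g x) by exact/derivable1_diffP.
split; first exact/derivable1_diffP/differentiable_comp.
by rewrite -derive1E derive1_comp// !derive1E !derive_val.
Qed.

(** A slope of at least [m] everywhere gives injectivity, surjectivity by the intermediate value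
    theorem, and an inverse that is Lipschitz with constant [m^-1] in its second variable, whence
    its joint continuity. It serves to change coordinates, to invert a flow and to change time. *)
Lemma increasing_inverse (R : realType) (G : R -> R -> R) (m : R) :
  0 < m -> cont2 G ->
  (forall x y y', y <= y' -> m * (y' - y) <= G x y' - G x y) ->
  exists J : R -> R -> R, [/\ cont2 J,
    forall x y, J x (G x y) = y, forall x w, G x (J x w) = w &
    forall x y l : R, is_derive y (1 : R) (G x) l ->
      is_derive (G x y) (1 : R) (J x) l^-1].
Proof.
move=> m0 cG mG.
have cGx x : continuous (G x) by exact: cont2_section.
have mG' x y y' : m * `|y' - y| <= `|G x y' - G x y|.
  case: (leP y y') => [|/ltW] yy'.
    by rewrite ger0_norm ?subr_ge0// (le_trans (mG x _ _ yy'))// ler_norm.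
  by rewrite distrC (distrC (G _ _)) ger0_norm ?subr_ge0//
    (le_trans (mG x _ _ yy'))// ler_norm.
have inj x y y' : G x y = G x y' -> y = y'.
  move=> e; apply/esym/eqP; rewrite -subr_eq0 -normr_le0 -(ler_pM2l m0) mulr0.
  by rewrite (le_trans (mG' x _ _))// e subrr normr0.
have surj x w : exists y, G x y = w.
  (* Over a length [r] the function [G x] moves by at least [|w - G x 0|], so [w] lies between its
     values at [- r] and [r]. *)
  pose r := `|w - G x 0| / m.
  have r0 : 0 <= r by rewrite divr_ge0// ltW.
  have rE : m * r = `|w - G x 0| by rewrite /r mulrC divfK// gt_eqF.
  have [|||c _ cw] := @IVT R (G x) (- r) r w; last by exists c.
  - by rewrite ge0_cp.
  - exact: continuous_subspaceT.
  - have h1 : m * (0 - - r) <= G x 0 - G x (- r) by apply: mG; rewrite oppr_le0.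
    have h2 : m * (r - 0) <= G x r - G x 0 by apply: mG.
    move: h1 h2; rewrite sub0r opprK subr0 rE => h1 h2.
    have := ler_norm (w - G x 0); have := ler_norm (- (w - G x 0)).
    rewrite normrN => h3 h4; rewrite ge_min le_max.
    by apply/andP; split; apply/orP; [left|right]; lra.
pose J x w := projT1 (cid (surj x w)).
have GJ x w : G x (J x w) = w by rewrite /J; case: cid.
have JG x y : J x (G x y) = y by apply: (inj x); rewrite GJ.
have cJ : cont2 J.
  move=> x w e e0.
  have em : 0 < m * e / 2 by rewrite divr_gt0// mulr_gt0.
  have [d d0 hd] := cG x (J x w) _ em.
  exists (Num.min d (m * e / 2)); first by rewrite lt_min d0.
  move=> x' w'; rewrite !lt_min => /andP[xd _] /andP[_ wd].
  rewrite -(ltr_pM2l m0) (le_lt_trans (mG' x' _ _))// GJ.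
  have := hd x' (J x w) xd; rewrite subrr normr0 => /(_ d0); rewrite GJ => hw.
  have -> : w' - G x' (J x w) = (w' - w) - (G x' (J x w) - w) by ring.
  by rewrite (le_lt_trans (ler_normB _ _))// [X in _ < X]splitr ltrD.
exists J; split=> // x y l D.
have D' := D; apply: is_derive_inverse D' _.
- by exists 1 => //= z _; exact: JG.
- by exists 1 => //= z _; exact: cGx.
(* With [l = 0] a small increment would have slope at most [m / 2]. *)
- apply/negP => /eqP l0; move/is_derive1P: D; rewrite l0.
  have m2 : 0 < m / 2 by rewrite divr_gt0.
  move=> /(_ _ m2)[d d0 /(_ (y + d / 2))]; rewrite addrAC subrr add0r.
  have d2 : 0 < d / 2 by rewrite divr_gt0.
  rewrite gtr0_norm// mul0r subr0 ltr_pdivrMr// mulr_natr mulr2n ltrDl => /(_ d0).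
  have := mG' x y (y + d / 2); rewrite addrAC subrr add0r gtr0_norm// => h1 h2.
  have := le_trans h1 h2; rewrite ler_pM2r// ler_pdivlMr// mulr_natr mulr2n.
  by rewrite gerDl leNgt m0.
Qed.

(** * Flows of scalar differential equations *)

(** The remaining steps after [n] add up to [v n], so [u n - v n] increases, [u n + v n] decreases,
    and the supremum of the former lies between the two. *)
Lemma geometric_limit (R : realType) (u : nat -> R) (B : R) :
  (forall n, `|u n.+1 - u n| <= B / 2 ^+ n) ->
  exists l, forall n, `|u n - l| <= 2 * B / 2 ^+ n.
Proof.
move=> hu.
have B0 : 0 <= B by have := hu 0; rewrite expr0 divr1; exact: le_trans.
pose v n := 2 * B / 2 ^+ n.
have vS n : v n = B / 2 ^+ n + v n.+1.
  by rewrite /v exprS; field; rewrite expf_neq0.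
have lo n k : u n - v n <= u (n + k)%N - v (n + k)%N.
  elim: k => [|k IH]; first by rewrite addn0.
  apply: (le_trans IH); rewrite addnS vS; have := hu (n + k)%N.
  by rewrite ler_norml => /andP[? ?]; lra.
have hi n k : u (n + k)%N + v (n + k)%N <= u n + v n.
  elim: k => [|k IH]; first by rewrite addn0.
  apply: le_trans IH; rewrite addnS (vS (n + k)%N); have := hu (n + k)%N.
  by rewrite ler_norml => /andP[? ?]; lra.
have v0 n : 0 <= v n by rewrite /v divr_ge0// ?mulr_ge0// exprn_ge0.
have lohi n k : u n - v n <= u k + v k.
  have := lo n k; have := hi k n; rewrite addnC; have := v0 (n + k)%N; lra.
pose A := range (fun n => u n - v n).
have supA : has_sup A.
  split; first by exists (u 0 - v 0); exists 0%N.
  by exists (u 0 + v 0) => _ [n _ <-].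
exists (sup A) => n; rewrite ler_distlC -/(v n); apply/andP; split.
  by apply: ub_le_sup; [exact: supA.2|exists n].
by apply: ge_sup; [exact: supA.1|move=> _ [k _ <-]].
Qed.

Definition clamp (R : realType) (a b x : R) : R := Num.max a (Num.min b x).

Lemma clamp_itv (R : realType) (a b x : R) : a <= b -> a <= clamp a b x <= b.
Proof.
by move=> ab; rewrite /clamp le_max lexx /= ge_max ab ge_min lexx.
Qed.

Lemma clamp_id (R : realType) (a b x : R) : a <= x <= b -> clamp a b x = x.
Proof. by case/andP=> ax xb; rewrite /clamp (min_idPr xb) (max_idPr ax). Qed.

Lemma clamp_continuous (R : realType) (a b : R) : continuous (clamp a b).
Proof.
move=> x; apply: (@continuous_max _ _ (fun=> a) (Num.min b)); first exact: cst_continuous.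
by apply: (@continuous_min _ _ (fun=> b) id); [exact: cst_continuous|].
Qed.

Lemma clamp_near (R : realType) (c r x : R) : `|x - c| < r ->
  clamp (c - r) (c + r) x = x.
Proof.
by rewrite ltr_distl => /andP[? ?]; rewrite clamp_id// !ltW.
Qed.

Lemma between_clamp (R : realType) (c r x z : R) : 0 <= r ->
  between c (clamp (c - r) (c + r) x) z -> c - r <= z <= c + r.
Proof.
move=> r0; have : c - r <= clamp (c - r) (c + r) x <= c + r by apply: clamp_itv; lra.
by move=> /andP[? ?] /orP[]/andP[? ?]; apply/andP; split; lra.
Qed.

Lemma clamp_dist (R : realType) (c r x : R) : 0 <= r ->
  `|clamp (c - r) (c + r) x - c| <= r.
Proof.
move=> r0; rewrite ler_distl; apply: clamp_itv; lra.
Qed.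

(* Clamping x to [x0 - r, x0 + r] keeps every Picard iterate defined and
   continuous on the whole line. *)
Lemma picard (R : realType) (q : R -> R -> R) (x0 r L c : R) :
  cont2 q -> 0 < r -> 0 <= L -> r * L <= 4^-1 ->
  (forall x w w', `|q x w' - q x w| <= L * `|w' - w|) ->
  exists2 phi : R -> R, continuous phi &
    forall x, phi x = c + oint (fun z => q z (phi z)) x0 (clamp (x0 - r) (x0 + r) x).
Proof.
move=> cq r0 L0 rL Lq.
pose cl := clamp (x0 - r) (x0 + r).
have cqf (f : R -> R) : continuous f -> continuous (fun z => q z (f z)).
  by move=> cf; apply: (continuous_comp2 cq) => // x; exact: cvg_id.
pose T (f : R -> R) x := c + oint (fun z => q z (f z)) x0 (cl x).
have cT (f : R -> R) : continuous f -> continuous (T f).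
  move=> cf x; apply: cvgD; first exact: cvg_cst.
  apply: (@continuous_comp _ _ _ cl (oint (fun z => q z (f z)) x0)).
    exact: clamp_continuous.
  apply: is_derive1_continuous; apply: oint_derive; exact: cqf.
(* The hypothesis [r * L <= 4^-1] is weakened to the factor 1/2, the ratio used in
   [geometric_limit]. *)
have contr (f g : R -> R) K : continuous f -> continuous g ->
    (forall x : R, `|f x - g x| <= K) ->
    forall x, `|T f x - T g x| <= K / 2.
  move=> cf cg fg x; have K0 : 0 <= K by apply: le_trans (fg 0).
  have -> : T f x - T g x = oint (fun z => q z (f z) - q z (g z)) x0 (cl x).
    by rewrite ointB; [rewrite /T; ring|exact: cqf..].
  apply: (@le_trans _ _ (L * K * `|cl x - x0|)).
    apply: oint_le => [z|z _]; first by apply: continuousB; exact: cqf.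
    by rewrite (le_trans (Lq _ _ _))// ler_wpM2l.
  rewrite (@le_trans _ _ (L * K * r))//.
    by rewrite ler_wpM2l ?mulr_ge0//; exact/clamp_dist/ltW.
  have -> : L * K * r = r * L * K by ring.
  by rewrite mulrC ler_wpM2l// (le_trans rL)// lef_pV2 ?posrE// ler_nat.
pose u n := iter n T (fun=> c).
have cu n : continuous (u n) by elim: n => [|n IH]; [exact: cst_continuous|exact: cT].
(* Iterates depend on [x] only through [cl x], so a maximum over the compact interval bounds the
   first step on the whole line. *)
have [B hB] : exists B, forall x, `|u 1%N x - u 0%N x| <= B.
  have ab : x0 - r <= x0 + r by lra.
  have [z _ hz] := @EVT_max R (fun x => `|u 1%N x - u 0%N x|) _ _ ab (continuous_subspaceT
    (fun x => @continuous_comp _ _ _ _ _ x (continuousB (cu 1%N x) (cu 0%N x))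
       (@norm_continuous _ _ _))).
  exists (`|u 1%N z - u 0%N z|) => x.
  have -> : u 1%N x - u 0%N x = u 1%N (cl x) - u 0%N (cl x).
    rewrite /u /= /T; congr (_ + oint _ _ _ - _); rewrite [in RHS]/cl clamp_id//.
    exact: clamp_itv.
  by apply: hz; rewrite in_itv /=; exact: clamp_itv.
have step n x : `|u n.+1 x - u n x| <= B / 2 ^+ n.
  elim: n x => [|n IH] x; first by rewrite expr0 divr1.
  have -> : B / 2 ^+ n.+1 = B / 2 ^+ n / 2 by rewrite exprS invfM mulrCA mulrC.
  exact: (contr (u n.+1) (u n) _ (cu _) (cu _) IH).
pose phi x := projT1 (cid (geometric_limit (fun n => step n x))).
have phiP x n : `|u n x - phi x| <= 2 * B / 2 ^+ n.
  by rewrite /phi; case: cid => l /= /(_ n).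
have B0 : 0 <= B by apply: le_trans (hB 0).
have small e : 0 < e -> exists n, 2 * B / 2 ^+ n < e.
  move=> e0; pose n := (Num.trunc (2 * B / e)).+1.
  exists n; have h : 2 * B / e < n%:R by exact: truncnS_gt.
  rewrite ltr_pdivrMr ?exprn_gt0// [e * _]mulrC -ltr_pdivrMr//.
  by rewrite (lt_trans h)// -natrX ltr_nat ltn_expl.
have cphi : continuous phi.
  move=> x; apply/continuous_atP => e e0.
  have e3 : 0 < e / 3 by rewrite divr_gt0.
  have [n hn] := small _ e3.
  have /continuous_atP /(_ _ e3)[d d0 hd] := cu n x.
  exists d => // y yx.
  have -> : phi y - phi x = (u n y - u n x) - (u n y - phi y) + (u n x - phi x) by ring.
  have -> : e = e / 3 + e / 3 + e / 3 by field.
  rewrite (le_lt_trans (ler_normD _ _))// ltrD//; last exact: le_lt_trans hn.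
  rewrite (le_lt_trans (ler_normB _ _))// ltrD//; last exact: le_lt_trans hn.
  exact: hd.
exists phi => // x.
(* Both [phi] and [T phi] are uniformly close to [u n.+1], which is [T (u n)]. *)
suff : forall e, 0 < e -> `|phi x - T phi x| <= e.
  move=> H; apply/eqP; rewrite -subr_eq0 -normr_le0; apply/ler_addgt0Pl => e /H.
  by rewrite addr0.
move=> e e0; have [n hn] := small (e / 2) (divr_gt0 e0 (ltr0Sn _ 1)).
have -> : phi x - T phi x = (u n.+1 x - T phi x) - (u n.+1 x - phi x) by ring.
rewrite (le_trans (ler_normB _ _))// (splitr e) lerD//.
  rewrite (le_trans (contr _ _ _ (cu n) cphi (phiP^~ n) x))//.
  by rewrite (le_trans _ (ltW hn))// ler_pdivrMr// ler_peMr ?ler1n// divr_ge0 ?mulr_ge0 ?exprn_ge0.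
rewrite (le_trans (phiP _ _))// (le_trans _ (ltW hn))//.
by rewrite ler_wpM2l ?mulr_ge0// lef_pV2 ?posrE ?exprn_gt0// ler_weXn2l ?ler1n.
Qed.

Lemma is_derive1_eq (R : realType) (f : R -> R) (x a b : R) :
  is_derive x (1 : R) f a -> a = b -> is_derive x (1 : R) f b.
Proof. by move=> D <-. Qed.

Lemma is_derive1_mul (R : realType) (f g : R -> R) (x df dg : R) :
  is_derive x (1 : R) f df -> is_derive x (1 : R) g dg ->
  is_derive x (1 : R) (fun z => f z * g z) (df * g x + f x * dg).
Proof.
move=> Df Dg; apply: (is_derive1_eq (is_deriveM Df Dg)).
by rewrite /GRing.scale /=; ring.
Qed.

Lemma is_derive_expR_comp (R : realType) (g : R -> R) (x dg : R) :
  is_derive x (1 : R) g dg ->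
  is_derive x (1 : R) (fun z => expR (g z)) (expR (g x) * dg).
Proof.
move=> Dg; apply: (@is_derive1_comp_at R expR g _ _ _ (is_derive_expR _) Dg).
Qed.

Lemma expR_clamped_bounds (R : realType) (t : R) : `|t| <= 4^-1 ->
  expR (- 4^-1) <= expR t <= expR 4^-1.
Proof. by rewrite ler_norml !ler_expR. Qed.

(* E x c is the exponential of the integral of k along the trajectory of c. *)
Lemma ode_flow (R : realType) (q k : R -> R -> R) (x0 r L : R) :
  cont2 q -> cont2 k -> 0 < r -> 0 <= L -> r * L <= 4^-1 ->
  (forall x w, is_derive w (1 : R) (q x) (k x w)) ->
  (forall x w, `|k x w| <= L) ->
  exists phi E : R -> R -> R, [/\ cont2 phi, cont2 E, (forall x c, 0 < E x c),
    (forall x c c', c <= c' -> 2^-1 * (c' - c) <= phi x c' - phi x c) &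
    [/\ (forall x c, is_derive c (1 : R) (phi x) (E x c)),
     (forall x c, `|x - x0| < r -> is_derive x (1 : R) (phi^~ c) (q x (phi x c))) &
     (forall x c, `|x - x0| < r -> is_derive x (1 : R) (E^~ c) (E x c * k x (phi x c)))]].
Proof.
move=> cq ck r0 L0 rL Dq kL.
have r0' := ltW r0.
have Lq x w w' : `|q x w' - q x w| <= L * `|w' - w|.
  exact: (@mean_value_le _ (q x) (k x)).
pose cl := clamp (x0 - r) (x0 + r).
have cqf (f : R -> R) : continuous f -> continuous (fun z => q z (f z)).
  by move=> cf; apply: (continuous_comp2 cq) => // x; exact: cvg_id.
pose phi x c := sval (cid2 (@picard _ q x0 r L c cq r0 L0 rL Lq)) x.
have cphi1 c : continuous (phi^~ c).
  by rewrite /phi; case: cid2.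
have phiE x c : phi x c = c + oint (fun z => q z (phi z c)) x0 (cl x).
  by rewrite /phi; case: cid2 => f cf h; exact: h.
have phicl x c : phi (cl x) c = phi x c.
  by rewrite phiE [RHS]phiE [cl (cl x)]clamp_id//; apply: clamp_itv; lra.
have qq c c' z : `|q z (phi z c') - q z (phi z c)| <= L * `|phi z c' - phi z c|.
  exact: Lq.
have cdq c c' : continuous (fun z => q z (phi z c') - q z (phi z c)).
  by move=> z; apply: continuousB; exact: cqf.
have dE x c c' : phi x c' - phi x c =
   (c' - c) + oint (fun z => q z (phi z c') - q z (phi z c)) x0 (cl x).
  by rewrite ointB; [rewrite (phiE x c) (phiE x c'); ring|exact: cqf..].
(* The integral term contributes at most the fraction [r * L] of a uniform bound on the distance
   between the two trajectories. *)
have dbound x c c' K : (forall z, `|phi z c' - phi z c| <= K) ->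
    `|phi x c' - phi x c - (c' - c)| <= K / 4.
  move=> hK; have K0 : 0 <= K by apply: le_trans (hK 0).
  rewrite dE addrAC subrr add0r.
  apply: (@le_trans _ _ (L * K * `|cl x - x0|)).
    apply: oint_le => // z _.
    by rewrite (le_trans (qq _ _ _))// ler_wpM2l.
  apply: (@le_trans _ _ (L * K * r)).
    by rewrite ler_wpM2l ?mulr_ge0//; exact: clamp_dist.
  have -> : L * K * r = r * L * K by ring.
  by rewrite mulrC ler_wpM2l.
(* At a point of maximal distance d, [dbound] gives d <= |c' - c| + d / 4, and 4/3 <= 2. *)
have dle x c c' : `|phi x c' - phi x c| <= 2 * `|c' - c|.
  have ab : x0 - r <= x0 + r by lra.
  have cN : continuous (fun x => `|phi x c' - phi x c|).
    by move=> y; apply: cvg_norm; apply: cvgB; exact: cphi1.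
  have [z _ hz] := @EVT_max R _ _ _ ab (continuous_subspaceT cN).
  have hz' y : `|phi y c' - phi y c| <= `|phi z c' - phi z c|.
    by rewrite -(phicl y c) -(phicl y c'); apply: hz; rewrite in_itv /=; apply: clamp_itv.
  have h1 := dbound z _ _ _ hz'.
  have : `|phi z c' - phi z c| <= `|c' - c| + `|phi z c' - phi z c| / 4.
    rewrite -[X in `|X| <= _](subrK (c' - c)) (le_trans (ler_normD _ _))//.
    by rewrite addrC lerD2l.
  by have := hz' x; have := normr_ge0 (c' - c); lra.
(* By [dle] the bound 2 |c' - c| may be fed into [dbound]: the increment deviates from c' - c by at
   most half of it, which is the origin of the slope [2^-1]. *)
have dmono x c c' : c <= c' -> 2^-1 * (c' - c) <= phi x c' - phi x c.
  move=> cc; have := dbound x _ _ _ (fun z => dle z c c').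
  by rewrite ler_norml ger0_norm ?subr_ge0// => /andP[? ?]; lra.
have cphi : cont2 phi.
  move=> x c e e0; have e2 : 0 < e / 2 by rewrite divr_gt0.
  have /continuous_atP /(_ _ e2)[d d0 hd] := cphi1 c x.
  exists (Num.min d (e / 2 / 2)); first by rewrite lt_min d0 !divr_gt0.
  move=> x' c'; rewrite !lt_min => /andP[xd _] /andP[_ cd].
  have -> : phi x' c' - phi x c = (phi x' c' - phi x' c) + (phi x' c - phi x c) by ring.
  rewrite (le_lt_trans (ler_normD _ _))// (splitr e) ltrD ?hd//.
  by rewrite (le_lt_trans (dle _ _ _))// mulrC -ltr_pdivlMr.
(* The initial value comes first because [cont2_oint] integrates in the second variable. *)
have ck2 : cont2 (fun c z => k z (phi z c)).
  apply: (cont2_comp ck); last exact: cont2_swap.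
  exact: cont2_proj2.
pose I c x := oint (fun z => k z (phi z c)) x0 x.
have cI : cont2 I by exact: (cont2_oint _ ck2).
pose E x c := expR (I c (cl x)).
have cE : cont2 E.
  apply/cont2P => p; apply: (@continuous_comp _ _ _ (fun p : R * R => I p.2 (cl p.1)) expR).
    have /cont2P := cont2_comp cI (@cont2_proj2 R)
      (cont2_fst (@clamp_continuous R (x0 - r) (x0 + r))).
    exact.
  exact: continuous_expR.
have ck2c (c : R) : continuous (fun z => k z (phi z c)).
  exact: (cont2_section (x := c) ck2).
have Il (c z : R) : x0 - r <= z <= x0 + r -> `|I c z| <= 4^-1.
  move=> zr; apply: (@le_trans _ _ (L * `|z - x0|)).
    by apply: oint_le => [|w _]; [exact: ck2c|exact: kL].
  by rewrite (le_trans _ rL)// mulrC ler_wpM2r// ler_distl.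
have DI (c z : R) : is_derive z (1 : R) (I c) (k z (phi z c)).
  by apply: oint_derive; exact: ck2c.
exists phi, E; split=> //; first by move=> x c; exact: expR_gt0.
split.
(* Linearization in the initial value: the increment [del] of two trajectories satisfies del' = k
   del + o(c' - c), so multiplication by [expR (- I c z)] leaves a function [g] that is constant up
   to o(c' - c). *)
- move=> x c; apply/is_derive1P => e e0.
  pose C : R := expR 4^-1.
  have C0 : 0 < C by exact: expR_gt0.
  (* The factors are 2 from [dle], one [C] for each of the two exponentials, and [r] for the length
     of integration. *)
  pose e1 := e / (2 * C * C * r).
  have e10 : 0 < e1 by rewrite divr_gt0// !mulr_gt0.
  (* The modulus of continuity of [k] around the trajectory of [c] must be uniform in time. *)
  have [d d0 hd] := @cont2_tube _ (fun s z => k z (phi z c + s)) 0 (x0 - r) (x0 + r) e1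
    (cont2_comp ck (@cont2_proj2 R)
      (cont2_add (cont2_snd (cphi1 c)) (@cont2_proj1 R))) e10.
  exists (d / 2); first by rewrite divr_gt0.
  move=> c' cd.
  have rem z : x0 - r <= z <= x0 + r ->
      `|q z (phi z c') - q z (phi z c) - k z (phi z c) * (phi z c' - phi z c)|
        <= e1 * (2 * `|c' - c|).
    move=> zr; have [w wb ->] := @mean_value _ (q z) (k z) (phi z c) (phi z c')
      (fun x _ => Dq z x).
    rewrite -mulrBl normrM; apply: (ler_pM (normr_ge0 _) (normr_ge0 _) _ (dle _ _ _)).
    have := hd (w - phi z c) z; rewrite subr0 addr0 [_ + (w - _)]addrC subrK => hh.
    apply: ltW; apply: hh zr.
    rewrite (le_lt_trans (between_dist wb))// (le_lt_trans (dle _ _ _))//.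
    by rewrite mulrC -ltr_pdivlMr.
  pose del z := (c' - c) + oint (fun z => q z (phi z c') - q z (phi z c)) x0 z.
  have delE z : x0 - r <= z <= x0 + r -> del z = phi z c' - phi z c.
    by move=> zr; rewrite dE /del [cl z]clamp_id.
  have Ddel z : is_derive z (1 : R) del (q z (phi z c') - q z (phi z c)).
    rewrite -[X in is_derive _ _ _ X]add0r; apply: is_deriveD.
    exact: oint_derive.
  pose g z := del z * expR (- I c z).
  have Dg z : is_derive z (1 : R) g
     ((q z (phi z c') - q z (phi z c) - k z (phi z c) * del z) * expR (- I c z)).
    have De : is_derive z (1 : R) (fun z => expR (- I c z))
       (expR (- I c z) * - k z (phi z c)).
      apply: is_derive_expR_comp; exact: is_deriveN.
    by apply: (is_derive1_eq (is_derive1_mul (Ddel z) De)); ring.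
  have gb : `|g (cl x) - g x0| <= C * (e1 * (2 * `|c' - c|)) * `|cl x - x0|.
    apply: (mean_value_le (fun z _ => Dg z)) => z zb.
    have zr : x0 - r <= z <= x0 + r by exact: between_clamp r0' zb.
    rewrite normrM mulrC delE// ler_pM// ?rem// ger0_norm ?expR_ge0//.
    by have /expR_clamped_bounds /andP[] : `|- I c z| <= 4^-1 by rewrite normrN Il.
  have clr : x0 - r <= cl x <= x0 + r by apply: clamp_itv; lra.
  have -> : phi x c' - phi x c - E x c * (c' - c) = E x c * (g (cl x) - g x0).
    have -> : g x0 = c' - c by rewrite /g /del /I !ointxx oppr0 expR0 addr0 mulr1.
    have gE : E x c * g (cl x) = phi x c' - phi x c.
      by rewrite /g delE// !phicl /E mulrCA -expRD subrr expR0 mulr1.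
    by rewrite -gE; ring.
  rewrite normrM ger0_norm ?expR_ge0//.
  have EC : E x c <= C by have /expR_clamped_bounds /andP[] := Il c _ clr.
  have clx : `|cl x - x0| <= r by exact: clamp_dist.
  apply: (@le_trans _ _ (C * (C * (e1 * (2 * `|c' - c|)) * r))).
    rewrite ler_pM ?expR_ge0// (le_trans gb)// ler_wpM2l//.
    by rewrite mulr_ge0 ?(ltW C0)// mulr_ge0 ?(ltW e10)// mulr_ge0.
  have -> : C * (C * (e1 * (2 * `|c' - c|)) * r) = e1 * (2 * C * C * r) * `|c' - c| by ring.
  by rewrite divfK// gt_eqF// !mulr_gt0.
(* Inside the open interval the clamp is the identity near [x], so the integral equation can be
   differentiated. *)
- move=> x c xr.
  have D : is_derive x (1 : R) (fun x => c + oint (fun z => q z (phi z c)) x0 x)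
     (q x (phi x c)).
    rewrite -[X in is_derive _ _ _ X]add0r; apply: is_deriveD.
    by apply: oint_derive; exact: cqf.
  have d0 : 0 < r - `|x - x0| by rewrite subr_gt0.
  apply: (is_derive1_local d0 _ D) => y yx; rewrite (phiE y) /cl clamp_near//.
  have -> : y - x0 = (y - x) + (x - x0) by ring.
  by rewrite (le_lt_trans (ler_normD _ _))// -ltrBrDr.
- move=> x c xr.
  have D : is_derive x (1 : R) (fun x => expR (I c x))
     (expR (I c x) * k x (phi x c)).
    exact: is_derive_expR_comp.
  have d0 : 0 < r - `|x - x0| by rewrite subr_gt0.
  have -> : E x c = expR (I c x) by rewrite /E /cl clamp_near.
  apply: (is_derive1_local d0 _ D) => y yx; rewrite /E /cl clamp_near//.
  have -> : y - x0 = (y - x) + (x - x0) by ring.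
  by rewrite (le_lt_trans (ler_normD _ _))// -ltrBrDr.
Qed.

(** * Integrating factors of continuous fields *)

Lemma is_derive1_cst (R : realType) (c x : R) :
  is_derive x (1 : R) (fun=> c) 0.
Proof. exact: is_derive_cst. Qed.

(** Caratheodory's criterion: the slope function of [F] is that of [u] times [rho]. Mere continuity
    of [rho] at [x] makes room for factors that come from a mean value theorem. *)
Lemma is_derive1_factor (R : realType) (F u rho : R -> R) (x l : R) :
  is_derive x (1 : R) u l -> u x = 0 -> {for x, continuous rho} ->
  (forall y, F y - F x = rho y * u y) -> is_derive x (1 : R) F (rho x * l).
Proof.
move=> /is_derive1_caratheodory[g [gE cg gx]] ux crho FE.
apply/is_derive1_caratheodory; exists (fun y => rho y * g y); split.
- by move=> y; rewrite FE -mulrA -gE ux subr0.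
- exact: cvgM crho cg.
- by rewrite gx.
Qed.

Lemma is_derive1_inv (R : realType) (f : R -> R) (x l : R) :
  f x != 0 -> is_derive x (1 : R) f l ->
  is_derive x (1 : R) (fun z => (f z)^-1) (- (f x) ^- 2 * l).
Proof. exact: is_deriveV. Qed.

Lemma interval_between (R : realType) (I : set R) (a b z : R) :
  is_interval I -> I a -> I b -> between a b z -> I z.
Proof. by move=> iI Ia Ib /orP[]; [exact: iI Ia Ib _|exact: iI Ib Ia _]. Qed.

(* For V = (a,b): grad S = f (-b,a), and V f = - f h, the latter along integral
   curves of V run at any speed lam. *)
Definition integrating_factor (R : realType) (a b h S f : R -> R -> R)
    (x0 y0 rho : R) :=
  [/\ cont2 f, (forall x y, 0 < f x y),
    (forall x y, `|x - x0| < rho -> `|y - y0| < rho ->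
      is_derive x (1 : R) (S^~ y) (- (f x y * b x y)) /\
      is_derive y (1 : R) (S x) (f x y * a x y)) &
    forall (I : set R) (X Y lam : R -> R), open I -> is_interval I ->
      (forall t, I t -> [/\ `|X t - x0| < rho, `|Y t - y0| < rho,
         is_derive t (1 : R) X (lam t * a (X t) (Y t)) &
         is_derive t (1 : R) Y (lam t * b (X t) (Y t))]) ->
      forall t, I t -> is_derive t (1 : R) (fun z => f (X z) (Y z))
         (- (lam t * (f (X t) (Y t) * h (X t) (Y t))))].

(* The integral form of div (a,b) = h, meaningful for a and b merely continuous. *)
Definition flux_identity (R : realType) (a b h : R -> R -> R) (x0 y0 r : R) :=
  forall x1 x2 y1 y2, `|x1 - x0| < r -> `|x2 - x0| < r -> `|y1 - y0| < r ->
    `|y2 - y0| < r ->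
    oint (fun z => a x2 z - a x1 z) y1 y2 + oint (fun z => b z y2 - b z y1) x1 x2
    = oint (fun z => oint (h z) y1 y2) x1 x2.

(* With W_y = a and W_x = Q - b, where Q(x,y) is the integral of h(x,.) from y0
   to y, the curves y' = b/a become the solutions of w' = q(x,w) in the
   coordinates (x, W(x,y)). There q_w = h/a is continuous although b/a need not
   be Lipschitz. *)
Lemma integrating_factor_clamped (R : realType) (a b h : R -> R -> R)
    (x0 y0 r m M : R) :
  cont2 a -> cont2 b -> cont2 h -> 0 < m -> 0 < r ->
  (forall x y, m <= a x y) -> (forall x y, `|h x y| <= M) ->
  flux_identity a b h x0 y0 r ->
  exists rho, exists S f : R -> R -> R,
    0 < rho <= r /\ integrating_factor a b h S f x0 y0 rho.
Proof.
move=> ca cb ch m0 r0 am hM flux.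
have cax x : continuous (a x) by exact: cont2_section.
have cby y : continuous (b^~ y) by exact: cont2_sectionr.
have chx x : continuous (h x) by exact: cont2_section.
have M0 : 0 <= M by apply: le_trans (hM 0 0).
pose Q x y := oint (h x) y0 y.
have cQ : cont2 Q by exact: cont2_oint.
have cQy y : continuous (Q^~ y) by exact: cont2_sectionr.
(* The form a dy - b dx integrated horizontally at height [y0] and then vertically: the stream
   function of the field in the case of zero divergence. *)
pose W x y := oint (a x) y0 y - oint (b^~ y0) x0 x.
have DWy (x y : R) : is_derive y (1 : R) (W x) (a x y).
  rewrite -[a x y]subr0.
  exact: (is_derive_sub (@oint_derive R (a x) y0 y (cax x))
    (@is_derive1_cst R (oint (b^~ y0) x0 x) y)).
have cW : cont2 W.
  apply: cont2_sub; first exact: cont2_oint.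
  apply: cont2_fst => x; apply: is_derive1_continuous; exact: oint_derive.
(* The flux identity on the rectangle with corners [(x, y0)] and [(z, y)] expresses [W z y - W x y]
   as the integral of the continuous function Q - b. *)
have DWx (x y : R) : `|x - x0| < r -> `|y - y0| < r ->
    is_derive x (1 : R) (W^~ y) (Q x y - b x y).
  move=> xr yr.
  have cQb : continuous (fun z => Q z y - b z y).
    by move=> z; apply: cvgB; [exact: cQy|exact: cby].
  have D : is_derive x (1 : R) (fun z => W x y + oint (fun z => Q z y - b z y) x z)
      (Q x y - b x y).
    rewrite -[X in is_derive _ _ _ X]add0r; apply: is_deriveD.
    exact: oint_derive.
  have d0 : 0 < r - `|x - x0| by rewrite subr_gt0.
  apply: (is_derive1_local d0 _ D) => z zx.
  have zr : `|z - x0| < r.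
    have -> : z - x0 = (z - x) + (x - x0) by ring.
    by rewrite (le_lt_trans (ler_normD _ _))// -ltrBrDr.
  have y0r : `|y0 - y0| < r by rewrite subrr normr0.
  have := flux x z y0 y xr zr y0r yr.
  rewrite (@ointB _ (a z) (a x))// (@ointB _ (b^~ y) (b^~ y0))//.
  rewrite (@ointB _ (Q^~ y) (b^~ y))// /W -(oint_chasles (b^~ y0) x0 x z) /Q; lra.
have [|V [cV VW WV DV]] := @increasing_inverse R W m m0 cW.
  move=> x y y' yy'; have [c _ ->] := @mean_value _ (W x) (a x) y y' (fun z _ => DWy x z).
  by rewrite ler_wpM2r// subr_ge0.
(* As Q_y = h and [V], the inverse of [W x], has derivative 1/a, the right-hand side [q] has the
   continuous derivative [k] in [w]. *)
pose q x w := Q x (V x w).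
pose k x w := h x (V x w) / a x (V x w).
have a0 x y : 0 < a x y by exact: lt_le_trans (am x y).
have cq : cont2 q by apply: (cont2_comp cQ) => //; exact: cont2_proj1.
have ck : cont2 k.
  apply: cont2_mul; first by apply: (cont2_comp ch) => //; exact: cont2_proj1.
  apply: cont2_inv; last by move=> x y; rewrite gt_eqF.
  by apply: (cont2_comp ca) => //; exact: cont2_proj1.
have Dq (x w : R) : is_derive w (1 : R) (q x) (k x w).
  apply: (@is_derive1_comp_at _ (Q x) (V x)); first exact: oint_derive.
  by have := DV x (V x w) _ (DWy x (V x w)); rewrite WV.
pose L := M / m.
have L0 : 0 <= L by rewrite divr_ge0// ltW.
have kL x w : `|k x w| <= L.
  rewrite /k /L normrM ler_pM// normfV gtr0_norm// lef_pV2 ?posrE//.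
(* The radius at which the flow applies, [rho * L <= 4^-1]; adding 1 keeps the divisor positive. *)
pose rho := Num.min r (4^-1 / (L + 1)).
have L1 : 0 < L + 1 by rewrite ltr_wpDl.
have rho0 : 0 < rho by rewrite lt_min r0 divr_gt0// invr_gt0.
have rhor : rho <= r by rewrite ge_min lexx.
have rhoL : rho * L <= 4^-1.
  apply: (@le_trans _ _ (4^-1 / (L + 1) * L)).
    by rewrite ler_wpM2r// ge_min lexx orbT.
  by rewrite -mulrA ler_piMr// mulrC ler_pdivrMr// mul1r lerDl.
have [phi [E [cphi cE E0 mphi [Dphic Dphix DEx]]]] :=
  @ode_flow R q k x0 rho L cq ck rho0 L0 rhoL Dq kL.
have h2 : 0 < (2^-1 : R) by rewrite invr_gt0.
have [s [cs sphi phis Ds]] := @increasing_inverse R phi 2^-1 h2 cphi mphi.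
(* The label of the trajectory through [(x, W x y)], namely its value at [x0]. *)
pose S x y := s x (W x y).
have cS : cont2 S by apply: (cont2_comp cs) => //; exact: cont2_proj1.
have phiS x y : phi x (S x y) = W x y by rewrite /S phis.
(* Differentiation of phi(x, S) = W in [y] gives E S_y = a, so the integrating factor is the inverse
   of [E]. *)
pose f x y := (E x (S x y))^-1.
have cEi : cont2 (fun x c => (E x c)^-1).
  by apply: cont2_inv => // x y; rewrite gt_eqF.
have cf : cont2 f by apply: (cont2_comp cEi) => //; exact: cont2_proj1.
have f0 x y : 0 < f x y by rewrite invr_gt0.
have DS (x y : R) : `|x - x0| < rho -> `|y - y0| < rho ->
      is_derive x (1 : R) (S^~ y) (- (f x y * b x y)) /\
      is_derive y (1 : R) (S x) (f x y * a x y).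
  move=> xr yr; split; last first.
    have Dsx : is_derive (W x y) (1 : R) (s x) (f x y).
      by rewrite -phiS; apply: Ds; exact: Dphic.
    exact: (is_derive1_comp_at Dsx (DWy x y)).
  (* In [x] the same identity cannot be differentiated before [S] is known to be differentiable. The
     mean value theorem in the label writes [W x' y - phi x' c] as a factor [E x' c'] times the
     increment of [S], with [c'] squeezed between [c] and [S x' y]. *)
  pose c := S x y.
  have mv x' : exists c', between c (S x' y) c' /\
      phi x' (S x' y) - phi x' c = E x' c' * (S x' y - c).
    by have [c' ? ?] := @mean_value _ (phi x') (E x') c (S x' y) (fun z _ => Dphic x' z);
      exists c'.
  have [ch' chP] := choice mv.
  have chx' : ch' x = c.
    by have [/between_dist + _] := chP x; rewrite subrr normr0 normr_le0 subr_eq0 => /eqP.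
  (* Along the trajectory of [c] the slope [q] equals Q(x,y), which cancels the Q in W_x and leaves
     -b. *)
  have -> : - (f x y * b x y) = (E x (ch' x))^-1 * (Q x y - b x y - q x (phi x c)).
    by rewrite /c chx' /f phiS /q VW; ring.
  apply: (@is_derive1_factor _ _ (fun x' => W x' y - phi x' c) (fun x' => (E x' (ch' x'))^-1)).
  - apply: is_derive_sub; first by apply: DWx => //; exact: lt_le_trans rhor.
    exact: Dphix.
  - by rewrite /c phiS subrr.
  - apply/continuous_atP => e e0; rewrite chx'.
    have [d d0 hd] := cEi x c e e0.
    have /continuous_atP /(_ d d0)[d1 d10 hd1] := cont2_sectionr (x := x) (y := y) cS.
    exists (Num.min d d1); first by rewrite lt_min d0.
    move=> x'; rewrite lt_min => /andP[x1 x2]; apply: hd => //.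
    by rewrite (le_lt_trans (between_dist (chP x').1))// hd1.
  - by move=> x'; rewrite -phiS (chP x').2 mulrA mulVf ?mul1r// gt_eqF.
exists rho, S, f; split; first by rewrite rho0.
split=> //.
move=> I X Y lam oI iI HI t It.
pose c := S (X t) (Y t).
(* The gradient of [S] is orthogonal to the velocity (lam a, lam b). *)
have DSI (z : R) : I z -> is_derive z (1 : R) (fun z => S (X z) (Y z)) 0.
  move=> Iz; have [Xz Yz DX DY] := HI z Iz.
  pose d := Num.min (rho - `|X z - x0|) (rho - `|Y z - y0|).
  have d0 : 0 < d by rewrite lt_min !subr_gt0 Xz.
  apply: (is_derive1_eq (@chain_rule2 _ S (fun x y => - (f x y * b x y))
     (fun x y => f x y * a x y) X Y z _ _ d d0 _ _ DX DY)); last by ring.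
    move=> x y; rewrite /d !lt_min => /andP[xz _] /andP[_ yz]; apply: DS.
      have -> : x - x0 = (x - X z) + (X z - x0) by ring.
      by rewrite (le_lt_trans (ler_normD _ _))// -ltrBrDr.
    have -> : y - y0 = (y - Y z) + (Y z - y0) by ring.
    by rewrite (le_lt_trans (ler_normD _ _))// -ltrBrDr.
  move=> e e0.
  have [d1 d10 hd1] := cont2_mul cf cb (X z) (Y z) e0.
  have [d2 d20 hd2] := cont2_mul cf ca (X z) (Y z) e0.
  exists (Num.min d1 d2); first by rewrite lt_min d10.
  move=> x y; rewrite !lt_min => /andP[? ?] /andP[? ?]; split; last exact: hd2.
  by rewrite -opprD normrN; exact: hd1.
have Sc z : I z -> S (X z) (Y z) = c.
  move=> Iz; apply/eqP; rewrite -subr_eq0 -normr_le0 -(mul0r `|z - t|).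
  apply: (@mean_value_le _ (fun z => S (X z) (Y z)) (fun=> 0)) => [u ub|u _].
    by apply: DSI; exact: interval_between ub.
  by rewrite normr0.
have [Xt Yt DX DY] := HI t It.
have := oI; rewrite openE => /(_ t It) /nbhs_ballP[d /= d0 hd].
(* As [S] keeps the value [c], [f] along the curve is the inverse of [E] on one trajectory; there E'
   = E (h/a) X' with X' = lam a, and [a] cancels. *)
have fE z : `|z - t| < d -> (E (X z) c)^-1 = f (X z) (Y z).
  by move=> zt; rewrite /f Sc//; apply: hd; rewrite /ball /= distrC.
apply: (is_derive1_local d0 fE).
apply: (is_derive1_eq (is_derive1_inv _ (@is_derive1_comp_at _ (E^~ c) X _ _ _ (DEx _ _ Xt) DX))).
  by rewrite /= gt_eqF.
rewrite /f -/c /= /k /c phiS VW; have := E0 (X t) (S (X t) (Y t)); have := a0 (X t) (Y t).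
move: (E _ _) (a _ _) (h _ _) (lam t) => e' a' h' l' a'0 e'0.
by field; rewrite !gt_eqF.
Qed.

Lemma oint_cst (R : realType) (c a b : R) : oint (fun=> c) a b = c * (b - a).
Proof.
rewrite mulrBr; apply: (@oint_eq R (fun=> c) (fun z => c * z) a b).
  by move=> z; exact: cst_continuous.
move=> z _; apply: (is_derive1_eq (is_derive1_mul
  (is_derive1_cst c z) (is_derive_id z (1 : R)))); ring.
Qed.

(** Both sides vanish for [b = a] and have the same derivative in [b]; the tube lemma justifies
    differentiation under the integral sign. *)
Lemma oint_Fubini (R : realType) (h : R -> R -> R) (a b c d : R) : cont2 h ->
  oint (fun x => oint (h x) c d) a b = oint (fun y => oint (h^~ y) a b) c d.
Proof.
move=> ch.
have ch1 x : continuous (h x) by exact: cont2_section.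
have ch2 y : continuous (h^~ y) by exact: cont2_sectionr.
have cI : continuous (fun x => oint (h x) c d).
  exact: (cont2_sectionr (cont2_oint c ch)).
have cJ x : continuous (fun y => oint (h^~ y) a x).
  exact: (cont2_sectionr (cont2_oint a (cont2_swap ch))).
pose G x := oint (fun y => oint (h^~ y) a x) c d.
have -> : oint (fun y => oint (h^~ y) a b) c d = G b - G a.
  suff -> : G a = 0 by rewrite subr0.
  apply/eqP; rewrite -normr_le0 -(mul0r `|d - c|); apply: oint_le => // y _.
  by rewrite ointxx normr0.
apply: oint_eq => // x _; apply/is_derive1P => e e0.
pose K := `|d - c| + 1.
have K0 : 0 < K by rewrite ltr_wpDl.
have [dl dl0 hd] := @cont2_tube _ h x (Num.min c d) (Num.max c d) (e / K) ch
  (divr_gt0 e0 K0).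
exists dl => // x' xx'.
have ck y : continuous (fun z => h z y - h x y).
  by move=> z; apply: cvgB; [exact: ch2|exact: cvg_cst].
have E1 y : oint (h^~ y) a x' - oint (h^~ y) a x - (x' - x) * h x y =
    oint (fun z => h z y - h x y) x x'.
  rewrite (@ointB _ (h^~ y) (fun=> h x y))//; last exact: cst_continuous.
  by rewrite oint_cst -(oint_chasles (h^~ y) a x x'); ring.
have cl : continuous (fun y => (x' - x) * h x y).
  by move=> y; apply: cvgM; [exact: cvg_cst|exact: ch1].
have E : G x' - G x - oint (h x) c d * (x' - x) =
    oint (fun y => oint (fun z => h z y - h x y) x x') c d.
  rewrite /G -ointB// mulrC -ointZ// -ointB//; first by congr (oint _ _ _); apply/funext.
  by move=> y; apply: cvgB; exact: cJ.
rewrite E; apply: (@le_trans _ _ (e / K * `|x' - x| * `|d - c|)); last first.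
  have -> : e * `|x' - x| = e / K * `|x' - x| * K by field; rewrite gt_eqF.
  by rewrite ler_wpM2l ?lerDl// mulr_ge0// divr_ge0// ltW.
apply: oint_le.
  rewrite (_ : (fun _ => _) = (fun y => oint (h^~ y) a x' - oint (h^~ y) a x - (x' - x) * h x y)).
    by move=> y; apply: cvgB; [apply: cvgB; exact: cJ|exact: cl].
  by apply/funext.
move=> y yb; apply: oint_le => // z zb; apply/ltW/hd.
  by rewrite (le_lt_trans (between_dist zb)).
by rewrite ge_min le_max; case/orP: yb => /andP[-> ->]; rewrite ?orbT.
Qed.

(** Truncation supplies the global bounds: [a] is kept above half its value at the point and [h] is
    clamped around 0, which changes neither of them in a small square. *)
Lemma integrating_factor_pos (R : realType) (a b h : R -> R -> R) (x0 y0 r : R) :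
  cont2 a -> cont2 b -> cont2 h -> 0 < r -> 0 < a x0 y0 ->
  flux_identity a b h x0 y0 r ->
  exists rho, exists S f : R -> R -> R,
    0 < rho <= r /\ integrating_factor a b h S f x0 y0 rho.
Proof.
move=> ca cb ch r0 a0 flux.
pose m := a x0 y0 / 2.
have m0 : 0 < m by rewrite divr_gt0.
pose M := `|h x0 y0| + 1.
have M0 : 0 <= M by rewrite addr_ge0.
pose a1 x y := Num.max (a x y) m.
pose h1 x y := clamp (- M) M (h x y).
have ca1 : cont2 a1.
  apply/cont2P => p; apply: (@continuous_max _ _ (fun p : R * R => a p.1 p.2) (fun=> m)).
    by move/cont2P: ca; exact.
  exact: cst_continuous.
have ch1 : cont2 h1.
  apply/cont2P => p.
  apply: (@continuous_comp _ _ _ (fun p : R * R => h p.1 p.2) (clamp (- M) M)).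
    by move/cont2P: ch; exact.
  exact: clamp_continuous.
have [d1 d10 hd1] := ca x0 y0 m m0.
have [d2 d20 hd2] := ch x0 y0 1 ltr01.
pose r1 := Num.min r (Num.min d1 d2).
have r10 : 0 < r1 by rewrite !lt_min r0 d10.
have a1E x y : `|x - x0| < r1 -> `|y - y0| < r1 -> a1 x y = a x y.
  rewrite !lt_min => /and3P[_ x1 _] /and3P[_ y1 _].
  apply/max_idPl; have := hd1 x y x1 y1; rewrite ltr_norml /m => /andP[? ?]; lra.
have h1E x y : `|x - x0| < r1 -> `|y - y0| < r1 -> h1 x y = h x y.
  rewrite !lt_min => /and3P[_ _ x1] /and3P[_ _ y1].
  apply: clamp_id; rewrite -ler_norml -[h x y](subrK (h x0 y0)).
  by rewrite (le_trans (ler_normD _ _))// addrC /M lerD2l ltW// hd2.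
have am x y : m <= a1 x y by rewrite le_max lexx orbT.
have hM x y : `|h1 x y| <= M.
  by rewrite ler_norml; apply: clamp_itv; rewrite lerNl (le_trans _ M0)// oppr_le0.
have F1 : flux_identity a1 b h1 x0 y0 r1.
  move=> x1 x2 y1 y2 xr1 xr2 yr1 yr2.
  have rr (z : R) : `|z| < r1 -> `|z| < r by rewrite lt_min => /andP[].
  have := flux x1 x2 y1 y2 (rr _ xr1) (rr _ xr2) (rr _ yr1) (rr _ yr2).
  rewrite (@oint_congr _ (fun z => a1 x2 z - a1 x1 z) (fun z => a x2 z - a x1 z)).
  + move=> ->; apply: oint_congr.
    * exact: (cont2_sectionr (cont2_oint y1 ch)).
    * exact: (cont2_sectionr (cont2_oint y1 ch1)).
    move=> x xb; apply: oint_congr; [exact: cont2_section..|].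
    by move=> y yb; rewrite h1E//; [exact: between_ball xb|exact: between_ball yb].
  + by move=> y; apply: cvgB; exact: (cont2_section ca1).
  + by move=> y; apply: cvgB; exact: (cont2_section ca).
  + by move=> y yb; rewrite !a1E//; exact: between_ball yb.
have [rho [S [f [/andP[rho0 rhor] [cf f0 DS DC]]]]] :=
  integrating_factor_clamped ca1 cb ch1 m0 r10 am hM F1.
have r1r : r1 <= r by rewrite ge_min lexx.
have lr (z : R) : `|z| < rho -> `|z| < r1 by move=> zr; exact: lt_le_trans rhor.
exists rho, S, f; split; first by rewrite rho0 (le_trans rhor).
split=> //.
  by move=> x y xr yr; have [] := DS x y xr yr; rewrite a1E ?lr.
move=> I X Y lam oI iI HI t It.
have [Xt Yt _ _] := HI t It.
rewrite -h1E ?lr//; apply: (DC I X Y lam oI iI _ t It) => z Iz; have [Xz Yz DX DY] := HI z Iz.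
by split=> //; rewrite a1E ?lr.
Qed.

(** A curve of (a,b) at speed [lam] is a curve of (-a,-b) at speed [- lam]; arbitrary signs of [lam]
    are allowed for this purpose. *)
Lemma integrating_factorN (R : realType) (a b h S f : R -> R -> R) (x0 y0 rho : R) :
  integrating_factor (fun x y => - a x y) (fun x y => - b x y)
    (fun x y => - h x y) S f x0 y0 rho ->
  integrating_factor a b h (fun x y => - S x y) f x0 y0 rho.
Proof.
case=> cf f0 DS DC; split=> //.
  move=> x y xr yr; have [D1 D2] := DS x y xr yr; split.
    by apply: (is_derive1_eq (is_deriveN D1)); rewrite mulrN opprK.
  by apply: (is_derive1_eq (is_deriveN D2)); rewrite mulrN opprK.
move=> I X Y lam oI iI HI t It.
apply: (is_derive1_eq (DC I X Y (fun t => - lam t) oI iI _ t It)); last by ring.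
by move=> z Iz; have [? ? DX DY] := HI z Iz; rewrite !mulrNN.
Qed.

(** Reflection in the diagonal reverses rotation by a right angle, hence the sign in front of
    [S]. *)
Lemma integrating_factor_swap (R : realType) (a b h S f : R -> R -> R) (x0 y0 rho : R) :
  integrating_factor (fun x y => b y x) (fun x y => a y x)
    (fun x y => h y x) S f y0 x0 rho ->
  integrating_factor a b h (fun x y => - S y x) (fun x y => f y x) x0 y0 rho.
Proof.
case=> cf f0 DS DC; split=> //; first exact: cont2_swap.
  move=> x y xr yr; have [D1 D2] := DS y x yr xr; split.
    exact: is_deriveN D2.
  by apply: (is_derive1_eq (is_deriveN D1)); rewrite opprK.
move=> I X Y lam oI iI HI t It.
apply: (DC I Y X lam oI iI _ t It).
by move=> z Iz; have [? ? DX DY] := HI z Iz.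
Qed.

Lemma flux_identityN (R : realType) (a b h : R -> R -> R) (x0 y0 r : R) :
  cont2 a -> cont2 b -> cont2 h ->
  flux_identity a b h x0 y0 r ->
  flux_identity (fun x y => - a x y) (fun x y => - b x y) (fun x y => - h x y) x0 y0 r.
Proof.
move=> ca cb ch F x1 x2 y1 y2 x1r x2r y1r y2r.
have := F x1 x2 y1 y2 x1r x2r y1r y2r => {}F.
have cI : continuous (fun z => oint (h z) y1 y2).
  exact: (cont2_sectionr (cont2_oint y1 ch)).
have -> : (fun z => oint (fun y => - h z y) y1 y2) = (fun z => - oint (h z) y1 y2).
  by apply/funext => z; rewrite ointN//; exact: cont2_section.
rewrite ointN// -F opprD -ointN; last first.
  by move=> y; apply: cvgB; exact: (cont2_section ca).
rewrite -ointN; last by move=> y; apply: cvgB; exact: (cont2_sectionr cb).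
by congr (oint _ _ _ + oint _ _ _); apply/funext => z; ring.
Qed.

Lemma flux_identity_swap (R : realType) (a b h : R -> R -> R) (x0 y0 r : R) :
  cont2 h -> flux_identity a b h x0 y0 r ->
  flux_identity (fun x y => b y x) (fun x y => a y x) (fun x y => h y x) y0 x0 r.
Proof.
move=> ch F y1 y2 x1 x2 y1r y2r x1r x2r.
by rewrite addrC F// oint_Fubini.
Qed.

(** A nonzero component can be made the first one by reflection and positive by a change of sign. *)
Lemma integrating_factor_exists (R : realType) (a b h : R -> R -> R) (x0 y0 r : R) :
  cont2 a -> cont2 b -> cont2 h -> 0 < r -> (a x0 y0 != 0) || (b x0 y0 != 0) ->
  flux_identity a b h x0 y0 r ->
  exists rho, exists S f : R -> R -> R,
    0 < rho <= r /\ integrating_factor a b h S f x0 y0 rho.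
Proof.
have H1 a' b' h' x y : cont2 a' -> cont2 b' -> cont2 h' -> 0 < r -> a' x y != 0 ->
    flux_identity a' b' h' x y r ->
    exists rho, exists S f : R -> R -> R,
    0 < rho <= r /\ integrating_factor a' b' h' S f x y rho.
  move=> ca cb ch r0; rewrite neq_lt => /orP[a0|a0] F; last exact: integrating_factor_pos.
  have [| | | |rho [S [f [rhor IF]]]] :=
    integrating_factor_pos _ _ _ r0 _ (flux_identityN ca cb ch F).
  - exact: cont2_opp.
  - exact: cont2_opp.
  - exact: cont2_opp.
  - by rewrite oppr_gt0.
  by exists rho, (fun x y => - S x y), f; split=> //; exact: integrating_factorN.
move=> ca cb ch r0 /orP[a0|b0] F; first exact: H1.
have [| | |rho [S [f [rhor IF]]]] := H1 _ _ _ y0 x0 _ _ _ r0 b0 (flux_identity_swap ch F).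
- exact: cont2_swap.
- exact: cont2_swap.
- exact: cont2_swap.
by exists rho, (fun x y => - S y x), (fun x y => f y x); split=> //; exact: integrating_factor_swap.
Qed.

(** * Local inversion in the plane *)

Definition cont2_at (R : realType) (h : R -> R -> R) (x y : R) :=
  forall e, 0 < e -> exists2 d, 0 < d &
    forall x' y', `|x' - x| < d -> `|y' - y| < d -> `|h x' y' - h x y| < e.

Lemma cont2_atP (R : realType) (h : R -> R -> R) (x y : R) :
  cont2_at h x y <-> {for (x, y), continuous (fun p : R * R => h p.1 p.2)}.
Proof.
split=> [H|H e e0].
  apply/continuous2_atP => e e0; have [d d0 hd] := H e e0.
  by exists d => // -[x' y'] /=; apply: hd.
have /continuous2_atP /(_ e e0) [d d0 hd] := H.
by exists d => // x' y' ? ?; apply: (hd (x', y')).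
Qed.

Lemma is_derive1_extremum0 (R : realType) (g : R -> R) (x l d : R) : 0 < d ->
  is_derive x (1 : R) g l -> (forall y, `|y - x| < d -> g x <= g y) -> l = 0.
Proof.
move=> d0 /is_derive1P D H; apply/eqP; apply/negPn/negP => l0.
have l2 : 0 < `|l| / 2 by rewrite divr_gt0// normr_gt0.
have [d1 d10 h1] := D _ l2.
pose u := Num.min d d1 / 2.
have u0 : 0 < u by rewrite divr_gt0// lt_min d0.
have ud : u < d by rewrite /u ltr_pdivrMr// gt_min ltr_pMr// ltr1n.
have ud1 : u < d1 by rewrite /u ltr_pdivrMr// gt_min (ltr_pMr _ d10) ltr1n orbT.
(* A step against the sign of [l] lowers the linear part by [|l| * u], more than the error can make
   up for. *)
pose y := x - Num.sg l * u.
have yx : `|y - x| = u.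
  by rewrite /y addrAC subrr add0r normrN normrM normr_sg l0 mul1r gtr0_norm.
have := h1 y; rewrite yx => /(_ ud1); have := H y; rewrite yx => /(_ ud).
have -> : l * (y - x) = - (`|l| * u) by rewrite /y normrEsg; ring.
rewrite ler_norml => g1 /andP[_ g2].
have : 0 < `|l| * u by rewrite mulr_gt0// normr_gt0.
move: g1 g2; rewrite -mulrA; set a := `|l| * u => *.
have : a <= `|l| / 2 * u by lra.
by rewrite mulrAC -/a; lra.
Qed.

(* e1 and e2 are the columns of the inverse Jacobian matrix of (s,t). *)
Definition dual_frame (R : realType) (sx sy tx ty e1x e1y e2x e2y : R) :=
  [/\ sx * e1x + sy * e1y = 1, tx * e1x + ty * e1y = 0,
      sx * e2x + sy * e2y = 0 & tx * e2x + ty * e2y = 1] /\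
  [/\ e1x * sx + e2x * tx = 1, e1x * sy + e2x * ty = 0,
      e1y * sx + e2y * tx = 0 & e1y * sy + e2y * ty = 1].

Definition has_partials (R : realType) (s sx sy : R -> R -> R) (x y : R) :=
  is_derive x (1 : R) (s^~ y) (sx x y) /\ is_derive y (1 : R) (s x) (sy x y).

Section InverseFunction.
Variables (R : realType) (s t sx sy tx ty e1x e1y e2x e2y : R -> R -> R).
Variables (x0 y0 r : R).
Hypothesis r0 : 0 < r.
Let inbox x y := `|x - x0| < r /\ `|y - y0| < r.
Hypothesis Ds : forall x y, inbox x y -> has_partials s sx sy x y.
Hypothesis Dt : forall x y, inbox x y -> has_partials t tx ty x y.
Hypothesis C1 : forall x y, inbox x y ->
  [/\ cont2_at sx x y, cont2_at sy x y, cont2_at tx x y & cont2_at ty x y].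
Hypothesis frame : forall x y, inbox x y ->
  dual_frame (sx x y) (sy x y) (tx x y) (ty x y)
    (e1x x y) (e1y x y) (e2x x y) (e2y x y).

Lemma strict_derivative_at (f fx fy : R -> R -> R) x y :
  (forall x y, inbox x y -> has_partials f fx fy x y) -> inbox x y ->
  cont2_at fx x y -> cont2_at fy x y ->
  forall e, 0 < e -> exists2 d, 0 < d & forall x1 y1 x2 y2,
    `|x1 - x| < d -> `|y1 - y| < d -> `|x2 - x| < d -> `|y2 - y| < d ->
    `|f x2 y2 - f x1 y1 - fx x y * (x2 - x1) - fy x y * (y2 - y1)|
      <= e * (`|x2 - x1| + `|y2 - y1|).
Proof.
move=> Df [xr yr] cx cy.
pose d := Num.min (r - `|x - x0|) (r - `|y - y0|).
have d0 : 0 < d by rewrite lt_min !subr_gt0 xr.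
apply: (strict_derivative2 d0).
  move=> x' y'; rewrite !lt_min => /andP[xd _] /andP[_ yd]; apply: Df; split.
    have -> : x' - x0 = (x' - x) + (x - x0) by ring.
    by rewrite (le_lt_trans (ler_normD _ _))// -ltrBrDr.
  have -> : y' - y0 = (y' - y) + (y - y0) by ring.
  by rewrite (le_lt_trans (ler_normD _ _))// -ltrBrDr.
move=> e e0; have [d1 d10 h1] := cx e e0; have [d2 d20 h2] := cy e e0.
exists (Num.min d1 d2); first by rewrite lt_min d10.
by move=> x' y'; rewrite !lt_min => /andP[? ?] /andP[? ?]; split; [exact: h1|exact: h2].
Qed.

Let N1 (a b : R) := `|a| + `|b|.

(** Approximate inversion of the linear system: if (ds,dt) is the Jacobian applied to (a,b) up to
    [e], then the dual frame recovers (a,b) from it up to [C * e]. *)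
Let frame_bound x y : inbox x y -> exists2 C, 0 < C & forall a b ds dt e,
  `|ds - sx x y * a - sy x y * b| <= e -> `|dt - tx x y * a - ty x y * b| <= e ->
  `|a - e1x x y * ds - e2x x y * dt| <= C * e /\
  `|b - e1y x y * ds - e2y x y * dt| <= C * e /\
  N1 a b <= C * (N1 ds dt + e).
Proof.
move=> /frame [_ [f1 f2 f3 f4]].
set E1x := e1x x y in f1 f2 f3 f4 *; set E1y := e1y x y in f1 f2 f3 f4 *.
set E2x := e2x x y in f1 f2 f3 f4 *; set E2y := e2y x y in f1 f2 f3 f4 *.
set Sx := sx x y in f1 f2 f3 f4 *; set Sy := sy x y in f1 f2 f3 f4 *.
set Tx := tx x y in f1 f2 f3 f4 *; set Ty := ty x y in f1 f2 f3 f4 *.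
pose C := 2 * (`|E1x| + `|E2x| + `|E1y| + `|E2y|) + 1.
have n1 := normr_ge0 E1x; have n2 := normr_ge0 E2x.
have n3 := normr_ge0 E1y; have n4 := normr_ge0 E2y.
exists C; first by rewrite /C; lra.
move=> a b ds dt e hs ht.
have e0 : 0 <= e by exact: le_trans hs.
set u := ds - _ - _ in hs; set v := dt - _ - _ in ht.
have aE : a - E1x * ds - E2x * dt = - (E1x * u + E2x * v).
  have -> : a = (E1x * Sx + E2x * Tx) * a + (E1x * Sy + E2x * Ty) * b.
    by rewrite f1 f2; ring.
  by rewrite /u /v; ring.
have bE : b - E1y * ds - E2y * dt = - (E1y * u + E2y * v).
  have -> : b = (E1y * Sx + E2y * Tx) * a + (E1y * Sy + E2y * Ty) * b.
    by rewrite f3 f4; ring.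
  by rewrite /u /v; ring.
have ha : `|a - E1x * ds - E2x * dt| <= (`|E1x| + `|E2x|) * e.
  rewrite aE normrN (le_trans (ler_normD _ _))// !normrM mulrDl.
  by rewrite lerD// ler_wpM2l.
have hb : `|b - E1y * ds - E2y * dt| <= (`|E1y| + `|E2y|) * e.
  rewrite bE normrN (le_trans (ler_normD _ _))// !normrM mulrDl.
  by rewrite lerD// ler_wpM2l.
have le1 k : 0 <= k -> k <= C -> k * e <= C * e by move=> *; rewrite ler_wpM2r.
split; first by apply: le_trans ha _; apply: le1; rewrite /C; lra.
split; first by apply: le_trans hb _; apply: le1; rewrite /C; lra.
have ha' : `|a| <= (`|E1x| + `|E2x|) * (N1 ds dt + e).
  have -> : a = (a - E1x * ds - E2x * dt) + (E1x * ds + E2x * dt) by ring.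
  rewrite (le_trans (ler_normD _ _))// mulrDr addrC lerD//.
  rewrite (le_trans (ler_normD _ _))// !normrM /N1.
  have : 0 <= `|E1x| * `|dt| by rewrite mulr_ge0.
  by have : 0 <= `|E2x| * `|ds| by [rewrite mulr_ge0]; lra.
have hb' : `|b| <= (`|E1y| + `|E2y|) * (N1 ds dt + e).
  have -> : b = (b - E1y * ds - E2y * dt) + (E1y * ds + E2y * dt) by ring.
  rewrite (le_trans (ler_normD _ _))// mulrDr addrC lerD//.
  rewrite (le_trans (ler_normD _ _))// !normrM /N1.
  have : 0 <= `|E1y| * `|dt| by rewrite mulr_ge0.
  by have : 0 <= `|E2y| * `|ds| by [rewrite mulr_ge0]; lra.
rewrite {1}/N1 (le_trans (lerD ha' hb'))// -mulrDl ler_wpM2r ?addr_ge0//.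
by rewrite /C; lra.
Qed.

(** Strict differentiability with error [(2 * C)^-1] leaves half of the left-hand side to be
    absorbed. This gives injectivity and, for the inverse, the Lipschitz constant. *)
Let expanding : exists d C, [/\ 0 < d, d <= r, 0 < C & forall x1 y1 x2 y2,
  `|x1 - x0| < d -> `|y1 - y0| < d -> `|x2 - x0| < d -> `|y2 - y0| < d ->
  N1 (x2 - x1) (y2 - y1) <= C * N1 (s x2 y2 - s x1 y1) (t x2 y2 - t x1 y1)].
Proof.
have b0 : inbox x0 y0 by split; rewrite subrr normr0.
have [C C0 hC] := frame_bound b0.
have [c1 c2 c3 c4] := C1 b0.
have e0 : 0 < (2 * C)^-1 by rewrite invr_gt0 mulr_gt0.
have [d1 d10 h1] := strict_derivative_at Ds b0 c1 c2 e0.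
have [d2 d20 h2] := strict_derivative_at Dt b0 c3 c4 e0.
exists (Num.min r (Num.min d1 d2)), (2 * C); split.
- by rewrite !lt_min r0 d10.
- by rewrite ge_min lexx.
- by rewrite mulr_gt0.
move=> x1 y1 x2 y2; rewrite !lt_min => /and3P[_ a1 b1] /and3P[_ a2 b2].
move=> /and3P[_ a3 b3] /and3P[_ a4 b4].
have [_ [_]] := hC _ _ _ _ _ (h1 x1 y1 x2 y2 a1 a2 a3 a4) (h2 x1 y1 x2 y2 b1 b2 b3 b4).
rewrite -/(N1 _ _); set A := N1 (x2 - x1) _; set B := N1 (s _ _ - _) _ => h.
have : A <= C * B + A / 2.
  have : C * ((2 * C)^-1 * A) = A / 2 by field; rewrite gt_eqF.
  by move=> <-; rewrite -mulrDr.
by lra.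
Qed.

(** A preimage of (a,b) is found by minimizing the squared distance from (s,t) to (a,b) over a
    compact square. The expansion estimate keeps the minimizer off the boundary, and invertibility
    of the Jacobian turns the vanishing gradient into vanishing distance. The partial derivatives of
    the inverse are then read off from [frame_bound]. *)
Lemma local_inverse : exists d eta K, exists P Q : R -> R -> R,
  [/\ 0 < d <= r, 0 < eta, 0 < K &
  let zbox a b := `|a - s x0 y0| < eta /\ `|b - t x0 y0| < eta in
  [/\ (forall a b, zbox a b -> [/\ `|P a b - x0| < d, `|Q a b - y0| < d,
         s (P a b) (Q a b) = a & t (P a b) (Q a b) = b]),
      (forall x y, `|x - x0| < d -> `|y - y0| < d -> zbox (s x y) (t x y) ->
         P (s x y) (t x y) = x /\ Q (s x y) (t x y) = y),
      (forall a b a' b', zbox a b -> zbox a' b' ->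
         `|P a' b' - P a b| + `|Q a' b' - Q a b| <= K * (`|a' - a| + `|b' - b|)) &
      (forall a b, zbox a b ->
        [/\ is_derive a (1 : R) (P^~ b) (e1x (P a b) (Q a b)),
            is_derive b (1 : R) (P a) (e2x (P a b) (Q a b)),
            is_derive a (1 : R) (Q^~ b) (e1y (P a b) (Q a b)) &
            is_derive b (1 : R) (Q a) (e2y (P a b) (Q a b))])]].
Proof.
have [d [K [d0 dr K0 expd]]] := expanding.
pose s0 := s x0 y0; pose t0 := t x0 y0.
pose rho := d / 2.
have rho0 : 0 < rho by rewrite divr_gt0.
have rhod : rho < d by rewrite /rho ltr_pdivrMr// ltr_pMr// ltr1n.
pose m := rho / K.
have m0 : 0 < m by rewrite divr_gt0.
have mK : m * K = rho by rewrite /m divfK// gt_eqF.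
(* At the minimizer [s] and [t] are each within 3 eta of [s0] and [t0]; the sum 6 eta stays below
   [m], and expansion by [K] below [rho]. *)
pose eta := m / 8.
have eta0 : 0 < eta by rewrite divr_gt0.
have x00 : `|x0 - x0| < d by rewrite subrr normr0.
have y00 : `|y0 - y0| < d by rewrite subrr normr0.
have surj a b : `|a - s0| < eta -> `|b - t0| < eta ->
    exists p : R * R, [/\ `|p.1 - x0| < d, `|p.2 - y0| < d, s p.1 p.2 = a & t p.1 p.2 = b].
  move=> ha hb.
  pose G (x y : R) := (s x y - a) ^+ 2 + (t x y - b) ^+ 2.
  have DG x y : `|x - x0| < d -> `|y - y0| < d -> has_partials G
    (fun x y => 2 * ((s x y - a) * sx x y + (t x y - b) * tx x y))
    (fun x y => 2 * ((s x y - a) * sy x y + (t x y - b) * ty x y)) x y.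
    move=> xd yd; have bxy : inbox x y by split; exact: lt_le_trans dr.
    have [dsx dsy] := Ds bxy; have [dtx dty] := Dt bxy.
    have sub (f : R -> R) (z l c : R) : is_derive z (1 : R) f l ->
        is_derive z (1 : R) (fun z => f z - c) l.
      by move=> D; rewrite -[l]subr0; apply: (is_derive_sub D (is_derive1_cst c z)).
    split.
      apply: (is_derive1_eq (@is_deriveD _ _ _ (fun x => (s x y - a) * (s x y - a))
        (fun x => (t x y - b) * (t x y - b)) _ _ _ _
        (is_derive1_mul (sub _ _ _ a dsx) (sub _ _ _ a dsx))
        (is_derive1_mul (sub _ _ _ b dtx) (sub _ _ _ b dtx)))); ring.
    apply: (is_derive1_eq (@is_deriveD _ _ _ (fun y => (s x y - a) * (s x y - a))
        (fun y => (t x y - b) * (t x y - b)) _ _ _ _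
        (is_derive1_mul (sub _ _ _ a dsy) (sub _ _ _ a dsy))
        (is_derive1_mul (sub _ _ _ b dty) (sub _ _ _ b dty)))); ring.
  pose A := `[x0 - rho, x0 + rho]%classic `*` `[y0 - rho, y0 + rho]%classic.
  have cA : compact A by apply: compact_setX; exact: segment_compact.
  have inA (p : R * R) : A p <-> (`|p.1 - x0| <= rho /\ `|p.2 - y0| <= rho).
    by rewrite /A /= !in_itv /= !ler_distl.
  have inr (p : R * R) : A p -> `|p.1 - x0| < d /\ `|p.2 - y0| < d.
    by move=> /inA[? ?]; split; exact: le_lt_trans rhod.
  have contf f fx fy : (forall x y, inbox x y -> has_partials f fx fy x y) ->
     (forall x y, inbox x y -> cont2_at fx x y /\ cont2_at fy x y) ->
     forall p, A p -> {for p, continuous (fun p : R * R => f p.1 p.2)}.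
    move=> Df Cf [x y] /inr[/= xd yd].
    have bxy : inbox x y by split; exact: lt_le_trans dr.
    have [cx cy] := Cf _ _ bxy.
    have [dd dd0 hd] := strict_derivative_at Df bxy cx cy ltr01.
    apply/continuous2_atP => e e0 /=.
    pose M := `|fx x y| + `|fy x y| + 2.
    have M0 : 0 < M by rewrite ltr_wpDl// addr_ge0.
    exists (Num.min dd (e / M)); first by rewrite lt_min dd0 divr_gt0.
    move=> [x' y'] /=; rewrite !lt_min => /andP[x1 x2] /andP[y1 y2].
    have := hd x y x' y'; rewrite !subrr !normr0 => /(_ dd0 dd0 x1 y1).
    rewrite mul1r => h.
    have -> : f x' y' - f x y = (f x' y' - f x y - fx x y * (x' - x) - fy x y * (y' - y))
       + (fx x y * (x' - x) + fy x y * (y' - y)) by ring.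
    have q : `|fx x y * (x' - x) + fy x y * (y' - y)| <= `|fx x y| * (e / M) + `|fy x y| * (e / M).
      rewrite (le_trans (ler_normD _ _))// !normrM lerD// ler_wpM2l//; exact: ltW.
    rewrite (le_lt_trans (ler_normD _ _))//.
    have -> : e = e / M + e / M + (`|fx x y| * (e / M) + `|fy x y| * (e / M)).
      have E : e = e / M * M by rewrite divfK// gt_eqF.
      by move: E; move: (e / M) => v E; rewrite E /M; ring.
    by rewrite ltr_leD// (le_lt_trans h)// ltrD.
  have cG : {within A, continuous (fun p : R * R => G p.1 p.2)}.
    apply: continuous_in_subspaceT => p /set_mem Ap.
    have cs := @contf s sx sy Ds (fun x y bxy => let: And4 a b _ _ := C1 bxy in conj a b) p Ap.
    have ct := @contf t tx ty Dt (fun x y bxy => let: And4 _ _ a b := C1 bxy in conj a b) p Ap.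
    by apply: cvgD; apply: cvgM; apply: cvgB => //; exact: cvg_cst.
  have A0 : A !=set0 by exists (x0, y0); apply/inA; rewrite /= !subrr !normr0 ltW.
  have [[x y] /set_mem Axy hmin] := compact_EVT_min A0 cA cG.
  have [/= xd yd] := inr _ Axy.
  have Gmin x' y' : `|x' - x0| <= rho -> `|y' - y0| <= rho -> G x y <= G x' y'.
    by move=> ? ?; apply: (hmin (x', y')); apply/mem_set/inA.
  have G0 : G x0 y0 < 2 * eta ^+ 2.
    have sq (z : R) : `|z| < eta -> z ^+ 2 < eta ^+ 2.
      by move=> hz; rewrite -real_normK ?num_real// ltrXn2r ?normr_ge0.
    have h1 := sq _ ha; have h2 := sq _ hb.
    have E1 : (s0 - a) ^+ 2 = (a - s0) ^+ 2 by ring.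
    have E2 : (t0 - b) ^+ 2 = (b - t0) ^+ 2 by ring.
    by rewrite /G -/s0 -/t0 E1 E2; lra.
  (* The centre competes with a value below 2 eta^2, so at the minimizer each coordinate is within 2
     eta of its target, and the expansion estimate puts the minimizer inside the open square. *)
  have [xr yr] : `|x - x0| < rho /\ `|y - y0| < rho.
    suff far : N1 (x - x0) (y - y0) < rho.
      by split; apply: le_lt_trans far; rewrite /N1 ?lerDl ?lerDr.
    have := expd x0 y0 x y x00 y00 xd yd; rewrite -/s0 -/t0.
    have G1 : G x y < 2 * eta ^+ 2.
      by apply: le_lt_trans G0; apply: Gmin; rewrite subrr normr0 ltW.
    have sq (z : R) : z ^+ 2 < 2 * eta ^+ 2 -> `|z| < 2 * eta.
      move=> hz; rewrite ltNge; apply/negP => h.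
      have : (2 * eta) ^+ 2 <= `|z| ^+ 2.
        by rewrite lerXn2r// nnegrE// mulr_ge0// ltW.
      rewrite real_normK ?num_real//; have := sqr_ge0 eta; lra.
    have bs : `|s x y - a| < 2 * eta.
      by apply: sq; move: G1; rewrite /G; have := sqr_ge0 (t x y - b); lra.
    have bt : `|t x y - b| < 2 * eta.
      by apply: sq; move: G1; rewrite /G; have := sqr_ge0 (s x y - a); lra.
    have n1 : N1 (s x y - s0) (t x y - t0) < m.
      have -> : s x y - s0 = (s x y - a) + (a - s0) by ring.
      have -> : t x y - t0 = (t x y - b) + (b - t0) by ring.
      have := ler_normD (s x y - a) (a - s0); have := ler_normD (t x y - b) (b - t0).
      by rewrite /N1; have : m = 8 * eta by [rewrite /eta; field]; lra.
    move=> h; apply: (le_lt_trans h); rewrite -mK mulrC ltr_pM2r//.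
  have [DGx DGy] := DG x y xd yd.
  have [[f1 f2 f3 f4] _] := frame (conj (lt_le_trans xd dr) (lt_le_trans yd dr)).
  have dx0 : 0 < rho - `|x - x0| by rewrite subr_gt0.
  have dy0 : 0 < rho - `|y - y0| by rewrite subr_gt0.
  have Ex := is_derive1_extremum0 dx0 DGx.
  have Ey := is_derive1_extremum0 dy0 DGy.
  have {}Ex : (s x y - a) * sx x y + (t x y - b) * tx x y = 0.
    have := Ex; rewrite /= => /(_ _)/eqP; rewrite mulf_eq0 pnatr_eq0/= => H; apply/eqP/H.
    move=> z zx; apply: Gmin; last exact: ltW.
    have -> : z - x0 = (z - x) + (x - x0) by ring.
    by rewrite (le_trans (ler_normD _ _))// -lerBrDr ltW.
  have {}Ey : (s x y - a) * sy x y + (t x y - b) * ty x y = 0.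
    have := Ey; rewrite /= => /(_ _)/eqP; rewrite mulf_eq0 pnatr_eq0/= => H; apply/eqP/H.
    move=> z zx; apply: Gmin; first exact: ltW.
    have -> : z - y0 = (z - y) + (y - y0) by ring.
    by rewrite (le_trans (ler_normD _ _))// -lerBrDr ltW.
  (* The combinations of the two vanishing partial derivatives with the columns [e1] and [e2]
     isolate [s x y - a] and [t x y - b]. *)
  exists (x, y); split=> //=.
    apply/eqP; rewrite -subr_eq0; apply/eqP.
    have -> : s x y - a = ((s x y - a) * sx x y + (t x y - b) * tx x y) * e1x x y +
       ((s x y - a) * sy x y + (t x y - b) * ty x y) * e1y x y.
      rewrite -[LHS]mulr1 -f1 -[LHS]addr0 -(mulr0 (t x y - b)) -f2; ring.
    by rewrite Ex Ey; ring.
  apply/eqP; rewrite -subr_eq0; apply/eqP.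
  have -> : t x y - b = ((s x y - a) * sx x y + (t x y - b) * tx x y) * e2x x y +
       ((s x y - a) * sy x y + (t x y - b) * ty x y) * e2y x y.
    rewrite -[LHS]mulr1 -f4 -[LHS]addr0 -(mulr0 (s x y - a)) -f3; ring.
  by rewrite Ex Ey; ring.
pose Phi (z : R * R) := get [set p : R * R |
  [/\ `|p.1 - x0| < d, `|p.2 - y0| < d, s p.1 p.2 = z.1 & t p.1 p.2 = z.2]].
have PhiP a b : `|a - s0| < eta -> `|b - t0| < eta ->
  [/\ `|(Phi (a, b)).1 - x0| < d, `|(Phi (a, b)).2 - y0| < d,
    s (Phi (a, b)).1 (Phi (a, b)).2 = a & t (Phi (a, b)).1 (Phi (a, b)).2 = b].
  move=> ha hb; have [p hp] := surj a b ha hb.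
  exact: (@getI _ [set p : R * R | [/\ `|p.1 - x0| < d, `|p.2 - y0| < d,
    s p.1 p.2 = a & t p.1 p.2 = b]] p hp).
exists d, eta, K, (fun a b => (Phi (a, b)).1), (fun a b => (Phi (a, b)).2).
have lip a b a' b' : `|a - s0| < eta /\ `|b - t0| < eta ->
    `|a' - s0| < eta /\ `|b' - t0| < eta ->
   `|(Phi (a', b')).1 - (Phi (a, b)).1| + `|(Phi (a', b')).2 - (Phi (a, b)).2|
     <= K * (`|a' - a| + `|b' - b|).
  move=> [ha hb] [ha' hb'].
  have [p1 p2 ps pt] := PhiP a b ha hb; have [p1' p2' ps' pt'] := PhiP a' b' ha' hb'.
  by have := expd _ _ _ _ p1 p2 p1' p2'; rewrite ps pt ps' pt'.
split=> //; first by rewrite d0.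
split=> //.
- by move=> a b [ha hb]; exact: PhiP.
- move=> x y xd yd [hs ht].
  have [p1 p2 ps pt] := PhiP _ _ hs ht.
  have := expd _ _ _ _ xd yd p1 p2; rewrite ps pt !subrr /N1 !normr0 addr0 mulr0 => h.
  by split; apply/eqP; rewrite -subr_eq0 -normr_le0 (le_trans _ h)// ?lerDl ?lerDr.
move=> a b zab.
have [p1 p2 ps pt] := PhiP _ _ zab.1 zab.2.
set x := (Phi (a, b)).1 in p1 ps pt *; set y := (Phi (a, b)).2 in p2 ps pt *.
have bxy : inbox x y by split; exact: lt_le_trans dr.
have [C C0 hC] := frame_bound bxy.
have [c1 c2 c3 c4] := C1 bxy.
have key e : 0 < e -> exists2 dd, 0 < dd & forall a' b', `|a' - a| < dd -> `|b' - b| < dd ->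
   `|(Phi (a', b')).1 - x - e1x x y * (a' - a) - e2x x y * (b' - b)| <= e * (`|a' - a| + `|b' - b|) /\
   `|(Phi (a', b')).2 - y - e1y x y * (a' - a) - e2y x y * (b' - b)| <= e * (`|a' - a| + `|b' - b|).
  move=> e0; have e1 : 0 < e / (C * K) by rewrite divr_gt0// mulr_gt0.
  have [d1 d10 h1] := strict_derivative_at Ds bxy c1 c2 e1.
  have [d2 d20 h2] := strict_derivative_at Dt bxy c3 c4 e1.
  (* Division by [2 * K] keeps the preimages within [d1] and [d2] of [(x, y)], by the Lipschitz
     estimate. *)
  pose dd := Num.min (Num.min (eta - `|a - s0|) (eta - `|b - t0|)) (Num.min d1 d2 / (2 * K)).
  exists dd.
    by rewrite !lt_min !subr_gt0 zab.1 zab.2 divr_gt0 ?mulr_gt0// lt_min d10.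
  move=> a' b'; rewrite !lt_min => /andP[/andP[a1 _] a2] /andP[/andP[_ b1] b2].
  have zab' : `|a' - s0| < eta /\ `|b' - t0| < eta.
    split.
      have -> : a' - s0 = (a' - a) + (a - s0) by ring.
      by rewrite (le_lt_trans (ler_normD _ _))// -ltrBrDr.
    have -> : b' - t0 = (b' - b) + (b - t0) by ring.
    by rewrite (le_lt_trans (ler_normD _ _))// -ltrBrDr.
  have [p1' p2' ps' pt'] := PhiP _ _ zab'.1 zab'.2.
  have l := lip a b a' b' zab zab'.
  set x' := (Phi (a', b')).1 in p1' ps' pt' l *; set y' := (Phi (a', b')).2 in p2' ps' pt' l *.
  rewrite -/x -/y in l.
  set D := `|a' - a| + `|b' - b| in l *.
  have sm : K * D < Num.min d1 d2.
    move: a2 b2; rewrite !ltr_pdivlMr ?mulr_gt0// /D => a2 b2; lra.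
  have nx : N1 (x' - x) (y' - y) < d1 /\ N1 (x' - x) (y' - y) < d2.
    by move: (le_lt_trans l sm); rewrite lt_min => /andP.
  have xs : `|x' - x| <= N1 (x' - x) (y' - y) by rewrite /N1 lerDl.
  have ys : `|y' - y| <= N1 (x' - x) (y' - y) by rewrite /N1 lerDr.
  have g1 := h1 x y x' y'; have g2 := h2 x y x' y'.
  rewrite !subrr !normr0 ps ps' in g1; rewrite !subrr !normr0 pt pt' in g2.
  have {}g1 := g1 d10 d10 (le_lt_trans xs nx.1) (le_lt_trans ys nx.1).
  have {}g2 := g2 d20 d20 (le_lt_trans xs nx.2) (le_lt_trans ys nx.2).
  have bnd : e / (C * K) * (`|x' - x| + `|y' - y|) <= e / C * D.
    have -> : e / C * D = e / (C * K) * (K * D) by field; rewrite !gt_eqF.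
    by rewrite ler_wpM2l// ltW.
  have [q1 [q2 _]] := hC _ _ _ _ _ (le_trans g1 bnd) (le_trans g2 bnd).
  have -> : e * D = C * (e / C * D) by field; rewrite gt_eqF.
  by split.
have aa dd : 0 < dd -> `|a - a| < dd by rewrite subrr normr0.
have bb dd : 0 < dd -> `|b - b| < dd by rewrite subrr normr0.
split; apply/is_derive1P => e e0; have [dd dd0 hd] := key e e0;
  exists dd => // z zd.
- by have [+ _] := hd z b zd (bb _ dd0); rewrite subrr mulr0 subr0 normr0 addr0.
- by have [+ _] := hd a z (aa _ dd0) zd; rewrite subrr mulr0 subr0 normr0 add0r.
- by have [_] := hd z b zd (bb _ dd0); rewrite subrr mulr0 subr0 normr0 addr0.
- by have [_] := hd a z (aa _ dd0) zd; rewrite subrr mulr0 subr0 normr0 add0r.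
Qed.

End InverseFunction.
(** * From the weak equation to fluxes *)

Lemma oint_ge0 (R : realType) (f : R -> R) a b : continuous f -> a <= b ->
  (forall x, a <= x <= b -> 0 <= f x) -> 0 <= oint f a b.
Proof.
move=> cf ab f0; rewrite /oint.
have [c cab ->] := @mean_value _ (primitive f) f a b (fun x _ => primitiveP x cf).
rewrite mulr_ge0 ?subr_ge0// f0//.
by case/orP: cab => // /andP[h1 h2]; rewrite (le_trans ab h1) (le_trans h2 ab).
Qed.

Lemma oint_le_weight (R : realType) (f g : R -> R) a b : continuous f ->
  continuous g -> a <= b -> (forall x, a <= x <= b -> `|f x| <= g x) ->
  `|oint f a b| <= oint g a b.
Proof.
move=> cf cg ab fg; rewrite ler_norml -subr_ge0 opprK -[X in _ && X]subr_ge0.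
rewrite -ointD// -ointB//; apply/andP; split; apply: oint_ge0 => //.
- by move=> x; apply: cvgD; [exact: cf|exact: cg].
- by move=> x /fg; rewrite ler_norml => /andP[? ?]; lra.
- by move=> x; apply: cvgB; [exact: cg|exact: cf].
- by move=> x /fg; rewrite ler_norml => /andP[? ?]; lra.
Qed.

(** * Smooth test functions of one variable and the lemma of du Bois-Reymond *)

Fixpoint smooth_order (R : realType) (n : nat) (f : R -> R) : Prop :=
  match n with
  | 0 => continuous f
  | m.+1 => exists2 f' : R -> R, (forall x, is_derive x (1 : R) f (f' x)) &
              smooth_order m f'
  end.

Lemma smooth_order_continuous (R : realType) n (f : R -> R) :
  smooth_order n f -> continuous f.
Proof.
by case: n => // n [f' D _] x; exact: is_derive1_continuous (D x).
Qed.

Lemma smooth_orderW (R : realType) n (f : R -> R) :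
  smooth_order n.+1 f -> smooth_order n f.
Proof.
elim: n f => [|n IH] f; first exact: smooth_order_continuous.
by case=> f' D S; exists f' => //; exact: IH.
Qed.

Lemma smooth_orderD (R : realType) n (f g : R -> R) : smooth_order n f ->
  smooth_order n g -> smooth_order n (fun x => f x + g x).
Proof.
elim: n f g => [|n IH] f g.
  by move=> cf cg x; apply: cvgD; [exact: cf|exact: cg].
case=> f' Df Sf [g' Dg Sg]; exists (fun x => f' x + g' x); last exact: IH.
by move=> x; apply: is_deriveD.
Qed.

Lemma smooth_orderM (R : realType) n (f g : R -> R) : smooth_order n f ->
  smooth_order n g -> smooth_order n (fun x => f x * g x).
Proof.
elim: n f g => [|n IH] f g.
  by move=> cf cg x; apply: cvgM; [exact: cf|exact: cg].
move=> Sf Sg; have Sf' := smooth_orderW Sf; have Sg' := smooth_orderW Sg.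
case: Sf Sg => f' Df Sf [g' Dg Sg].
exists (fun x => f' x * g x + f x * g' x).
  by move=> x; exact: is_derive1_mul.
by apply: smooth_orderD; exact: IH.
Qed.

Lemma smooth_order_cst (R : realType) n (c : R) : smooth_order n (fun=> c).
Proof.
elim: n c => [|n IH] c; first by move=> x; exact: cst_continuous.
by exists (fun=> 0) => // x; exact: is_derive1_cst.
Qed.

Lemma smooth_order_affine (R : realType) n (f : R -> R) (k c : R) :
  smooth_order n f -> smooth_order n (fun x => f (k * x + c)).
Proof.
have D x : is_derive x (1 : R) (fun x => k * x + c) k.
  apply: (is_derive1_eq (@is_deriveD _ _ _ (fun x => k * x) (fun=> c) _ _ _ _
    (is_derive1_mul (is_derive1_cst k x) (is_derive_id x (1 : R)))
    (is_derive1_cst c x))); ring.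
elim: n f => [|n IH] f.
  move=> cf x; apply: (@continuous_comp _ _ _ (fun x => k * x + c) f).
    exact: is_derive1_continuous (D x).
  exact: cf.
case=> f' Df Sf; exists (fun x => f' (k * x + c) * k).
  by move=> x; exact: (is_derive1_comp_at (Df _) (D x)).
by apply: smooth_orderM; [exact: IH|exact: smooth_order_cst].
Qed.

(** The case [n = 0] is the classical smooth function exp(-1/x); the weights [x ^- n] close the
    family under differentiation up to linear combinations. *)
Definition flat (R : realType) (n : nat) (x : R) : R :=
  if 0 < x then x ^- n * expR (- x^-1) else 0.

(** The term of order [n.+2] of the exponential series of 1/x beats [x ^- n] by two powers, enough
    for a zero derivative at the origin. *)
Lemma flat_bound (R : realType) (n : nat) (x : R) :
  `|flat n x| <= (n.+2)`!%:R * x ^+ 2.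
Proof.
rewrite /flat; case: ifP => [x0|_]; last by rewrite normr0 mulr_ge0// sqr_ge0.
have xi : 0 < x^-1 by rewrite invr_gt0.
rewrite ger0_norm; last by rewrite mulr_ge0 ?expR_ge0// invr_ge0 exprn_ge0// ltW.
have h : x ^- n.+2 / (n.+2)`!%:R <= expR x^-1.
  apply: le_trans (expR_ge1Dxn n.+1 (ltW xi)).
  by rewrite exprVn lerDr.
have f0 : 0 < (n.+2)`!%:R :> R by rewrite ltr0n fact_gt0.
have xn m : 0 < x ^+ m by rewrite exprn_gt0.
rewrite expRN -ler_pdivlMl ?invr_gt0// invrK -[leLHS]mul1r.
rewrite ler_pdivrMr ?expR_gt0//.
have E : x ^+ n * ((n.+2)`!%:R * x ^+ 2) * (x ^- n.+2 / (n.+2)`!%:R) = 1 :> R.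
  rewrite (_ : x ^+ n.+2 = x ^+ n * x ^+ 2); last by rewrite -exprD addn2.
  by field; rewrite !gt_eqF.
rewrite -{1}E; apply: ler_wpM2l => //.
by apply: mulr_ge0; [exact: ltW|apply: mulr_ge0; exact: ltW].
Qed.

Lemma flat_derive (R : realType) (n : nat) (x : R) :
  is_derive x (1 : R) (flat n) (flat n.+2 x - n%:R * flat n.+1 x).
Proof.
case: (ltgtP x 0) => x0.
- have -> : flat n.+2 x - n%:R * flat n.+1 x = 0.
    by rewrite /flat ltNge (ltW x0) /= mulr0 subr0.
  have xx : 0 < - x by rewrite oppr_gt0.
  apply: (is_derive1_local xx _ (is_derive1_cst 0 x)) => y yx; rewrite /flat.
  suff -> : (0 < y) = false by [].
  apply/negbTE; rewrite -leNgt; move: yx; rewrite ltr_norml => /andP[_]; lra.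
- have D1 : is_derive x (1 : R) (fun y => (y ^+ n)^-1 * expR (- y^-1))
     (flat n.+2 x - n%:R * flat n.+1 x).
    have xn m : x ^+ m != 0 by rewrite expf_neq0// gt_eqF.
    have DX : is_derive x (1 : R) (fun y => y ^+ n) (n%:R * x ^+ n.-1).
      split; first exact: exprn_derivable.
      by rewrite exp_derive /GRing.scale /= mulr1.
    have Dn := is_derive1_inv (f := fun y => y ^+ n) (xn n) DX.
    have x1 : x != 0 by rewrite gt_eqF.
    have De := is_derive_expR_comp (is_deriveN (is_derive1_inv (f := fun y => y) x1
      (is_derive_id x (1 : R)))).
    apply: (is_derive1_eq (is_derive1_mul Dn De)).
    rewrite /flat x0 /=; move: x1.
    case: n {DX Dn De} xn => [|n] xn x1.
      by rewrite mul0r expr0 invr1; field.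
    rewrite !exprS; have := xn n.
    move: (x ^+ n) (expR _) => t ee t0.
    by field; rewrite ?x1 ?t0.
  apply: (is_derive1_local x0 _ D1) => y yx; rewrite /flat.
  suff -> : 0 < y by [].
  by move: yx; rewrite ltr_norml => /andP[+ _]; lra.
- rewrite x0; have -> : flat n.+2 (0 : R) - n%:R * flat n.+1 0 = 0.
    by rewrite /flat ltxx mulr0 subr0.
  apply/is_derive1P => e e0.
  have f0 : 0 < (n.+2)`!%:R :> R by rewrite ltr0n fact_gt0.
  exists (e / (n.+2)`!%:R); first by rewrite divr_gt0.
  move=> y; rewrite subr0 {2}/flat ltxx subr0 mul0r subr0 => ye.
  rewrite (le_trans (flat_bound _ _))// -[y ^+ 2]real_normK ?num_real// expr2 mulrA.
  by rewrite ler_wpM2r// mulrC -ler_pdivlMr// ltW.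
Qed.

Lemma flat_smooth (R : realType) n k : smooth_order n (@flat R k).
Proof.
elim: n k => [|n IH] k.
  by move=> x; exact: is_derive1_continuous (flat_derive k x).
exists (fun x => flat k.+2 x - k%:R * flat k.+1 x); first exact: flat_derive.
have -> : (fun x => flat k.+2 x - k%:R * flat k.+1 x) =
    (fun x : R => flat k.+2 x + - k%:R * flat k.+1 x).
  by apply/funext => x; rewrite mulNr.
by apply: smooth_orderD => //; apply: smooth_orderM => //; exact: smooth_order_cst.
Qed.

Definition bump (R : realType) (e x : R) : R := flat 0 (e + x) * flat 0 (e - x).

Lemma bump_smooth (R : realType) n (e : R) : smooth_order n (bump e).
Proof.
have -> : bump e = (fun x => flat 0 (1 * x + e) * flat 0 (-1 * x + e)).
  by apply/funext => x; rewrite /bump mul1r mulN1r addrC (addrC (- x)).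
by apply: smooth_orderM; apply: smooth_order_affine; exact: flat_smooth.
Qed.

Lemma bump_ge0 (R : realType) (e x : R) : 0 <= bump e x.
Proof.
by rewrite mulr_ge0// /flat; case: ifP => // _; rewrite expr0 invr1 mul1r expR_ge0.
Qed.

Lemma bump_gt0 (R : realType) (e x : R) : `|x| < e -> 0 < bump e x.
Proof.
rewrite ltr_norml => /andP[? ?]; rewrite /bump /flat !ifT; [|lra|lra].
by rewrite mulr_gt0// expr0 invr1 mul1r expR_gt0.
Qed.

Lemma bump_eq0 (R : realType) (e x : R) : e <= `|x| -> bump e x = 0.
Proof.
rewrite ler_normr /bump /flat => /orP[h|h].
  by rewrite [in X in _ * X]ifF ?mulr0//; apply/negbTE; rewrite -leNgt; lra.
by rewrite ifF ?mul0r//; apply/negbTE; rewrite -leNgt; lra.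
Qed.

(** Test functions on []l, r[] with their derivative; [c] and [d] keep the support away from the
    endpoints. *)
Definition test1 (R : realType) (l r : R) (beta beta' : R -> R) :=
  [/\ (forall n, smooth_order n beta),
      (forall x, is_derive x (1 : R) beta (beta' x)) &
      exists c d, [/\ l < c, d < r & forall x, (x <= c) || (d <= x) -> beta x = 0]].

Lemma smooth_order_derive (R : realType) (f f' : R -> R) :
  (forall n, smooth_order n f) -> (forall x, is_derive x (1 : R) f (f' x)) ->
  forall n, smooth_order n f'.
Proof.
move=> S D n; have [g Dg Sg] := S n.+1.
suff -> : f' = g by [].
apply/funext => x; have [_ <-] := D x; by have [_ <-] := Dg x.
Qed.

(** The kernel [k] is not normalized; its primitive [P] is a smooth step, and differences of
    translates of [P] are test functions. *)
Lemma smooth_kernel (R : realType) (e : R) : 0 < e -> exists k P : R -> R,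
  [/\ (forall n, smooth_order n k), (forall n, smooth_order n P),
      (forall x, is_derive x (1 : R) P (k x)), (forall x, 0 <= k x) &
   [/\ (forall x, e <= `|x| -> k x = 0), (forall x, x <= - e -> P x = P (- e)),
      (forall x, e <= x -> P x = P e) & P (- e) < P e]].
Proof.
move=> e0; pose k := bump e; pose P := primitive k; exists k, P.
have Sk n : smooth_order n k by exact: bump_smooth.
have DP x : is_derive x (1 : R) P (k x).
  by apply: primitiveP; exact: (smooth_order_continuous (Sk 0)).
have h0 : 0 < e / 2 by rewrite divr_gt0.
have he : e = e / 2 + e / 2 by field.
move: (e / 2) h0 he => h h0 he.
split=> //; last split.
- case=> [|n]; first by move=> x; exact: is_derive1_continuous (DP x).
  by exists k.
- by move=> x; exact: bump_ge0.
- by move=> x; exact: bump_eq0.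
- move=> x xe; apply/eqP; rewrite -subr_eq0; apply/eqP.
  have [c + ->] := @mean_value _ P k (- e) x (fun x _ => DP x).
  move=> cb; rewrite /k bump_eq0 ?mul0r// ler_normr; apply/orP; right.
  by case/orP: cb => /andP[? ?]; lra.
- move=> x xe; apply/eqP; rewrite -subr_eq0; apply/eqP.
  have [c + ->] := @mean_value _ P k e x (fun x _ => DP x).
  move=> cb; rewrite /k bump_eq0 ?mul0r// ler_normr; apply/orP; left.
  by case/orP: cb => /andP[? ?]; lra.
(* The mean value on [[-h, h]] is positive, whereas on the whole interval it might a priori be
   attained at an endpoint, where [k] vanishes. *)
have [c + h1] := @mean_value _ P k (- h) h (fun x _ => DP x).
have [c1 _ h2] := @mean_value _ P k h e (fun x _ => DP x).
have [c2 _ h3] := @mean_value _ P k (- e) (- h) (fun x _ => DP x).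
move=> cb; have kc : 0 < k c.
  by apply: bump_gt0; rewrite ltr_norml; case/orP: cb => /andP[? ?]; apply/andP; split; lra.
have g1 : 0 < P h - P (- h) by rewrite h1 mulr_gt0//; lra.
have g2 : 0 <= P e - P h by rewrite h2 mulr_ge0 ?bump_ge0//; lra.
have g3 : 0 <= P (- h) - P (- e) by rewrite h3 mulr_ge0 ?bump_ge0//; lra.
by clear -g1 g2 g3; lra.
Qed.

(** With a primitive [I] of [C], the function [Bt] = B - I satisfies the equation without the term
    in [C]. Testing with a smoothed indicator of the interval between [y1] and [y2] equates the
    averages of [Bt] near these two points, and the averages are close to the values. *)
Lemma du_bois_reymond (R : realType) (B C : R -> R) (l r : R) :
  continuous B -> continuous C ->
  (forall beta beta', test1 l r beta beta' ->
    oint (fun y => beta' y * B y + beta y * C y) l r = 0) ->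
  forall y1 y2, l < y1 < r -> l < y2 < r -> B y2 - B y1 = oint C y1 y2.
Proof.
move=> cB cC H y1 y2 /andP[ly1 y1r] /andP[ly2 y2r].
pose I y := oint C l y.
have DI y : is_derive y (1 : R) I (C y) by exact: oint_derive.
have cI : continuous I by move=> y; exact: is_derive1_continuous (DI y).
pose Bt y := B y - I y.
have cBt : continuous Bt by move=> y; apply: cvgB; [exact: cB|exact: cI].
suff : Bt y1 = Bt y2.
  by rewrite /Bt -(oint_chasles C y1 l y2) (ointC C y1) -/(I _) -/(I _); lra.
apply/eqP; rewrite -subr_eq0 -normr_le0; apply/ler_addgt0Pl => del' del0'.
rewrite addr0; pose del := del' / 2.
have del0 : 0 < del by rewrite divr_gt0.
have /continuous_atP /(_ _ del0)[d1 d10 hd1] := cBt y1.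
have /continuous_atP /(_ _ del0)[d2 d20 hd2] := cBt y2.
have [e [e0 ed1 ed2] [el1 er1 el2 er2]] : exists2 e, [/\ 0 < e, e < d1 & e < d2] &
    [/\ e < y1 - l, e < r - y1, e < y2 - l & e < r - y2].
  pose m := Num.min (Num.min d1 d2)
    (Num.min (Num.min (y1 - l) (r - y1)) (Num.min (y2 - l) (r - y2))).
  have m0 : 0 < m by rewrite !lt_min d10 d20 !subr_gt0 ly1 y1r ly2 y2r.
  have : m / 2 < m by rewrite ltr_pdivrMr// ltr_pMr// ltr1n.
  rewrite {2}/m !lt_min => /andP[/andP[? ?] /andP[/andP[? ?] /andP[? ?]]].
  by exists (m / 2); split=> //; rewrite divr_gt0.
have [k [P [Sk SP DP k0 [kout Plo Phi c00]]]] := smooth_kernel e0.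
have ck : continuous k := smooth_order_continuous (Sk 0).
pose c0 := P e - P (- e).
have {}c00 : 0 < c0 by rewrite subr_gt0.
have shift (f : R -> R) (z y l' : R) : is_derive (y - z) (1 : R) f l' ->
    is_derive y (1 : R) (fun y => f (y - z)) l'.
  move=> Df; have D1 : is_derive y (1 : R) (fun y => y - z) 1.
    apply: (is_derive1_eq (is_derive_sub (is_derive_id y (1 : R)) (is_derive1_cst z y))).
    by rewrite subr0.
  by have := is_derive1_comp_at (g := fun y => y - z) Df D1; rewrite mulr1.
(* The steps at [y1] and [y2] cancel outside a compact interval, and the derivative is the
   difference of the two kernels. *)
pose beta x := P (x - y1) - P (x - y2).
pose beta' x := k (x - y1) - k (x - y2).
have Db x : is_derive x (1 : R) beta (beta' x).
  by apply: is_derive_sub; apply: shift; exact: DP.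
have ckz z : continuous (fun x => k (x - z)).
  by move=> x; apply: (@continuous_comp _ _ _ (fun x => x - z) k);
    [apply: cvgB; [exact: cvg_id|exact: cvg_cst]|exact: ck].
have cb' : continuous beta' by move=> x; apply: cvgB; exact: ckz.
have cb : continuous beta by move=> x; exact: is_derive1_continuous (Db x).
have b0 x : (x <= Num.min y1 y2 - e) || (Num.max y1 y2 + e <= x) -> beta x = 0.
  rewrite /beta; case/orP => h.
    have : x + e <= Num.min y1 y2 by rewrite -lerBrDr.
    by rewrite le_min => /andP[h1 h2]; rewrite !Plo ?subrr//; rewrite lerBlDr addrC lerBrDr.
  have : Num.max y1 y2 <= x - e by rewrite lerBrDr.
  by rewrite ge_max => /andP[h1 h2]; rewrite !Phi ?subrr//; rewrite lerBrDr addrC -lerBrDr.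
have lm : l < Num.min y1 y2 - e.
  by rewrite ltrBrDr lt_min -!ltrBrDl el1 el2.
have mr : Num.max y1 y2 + e < r.
  by rewrite -ltrBrDr gt_max; apply/andP; split; rewrite ltrBrDr -ltrBrDl.
have T : test1 l r beta beta'.
  split=> //; last by exists (Num.min y1 y2 - e), (Num.max y1 y2 + e).
  move=> n; rewrite (_ : beta = fun x => P (1 * x + - y1) + -1 * P (1 * x + - y2)).
    apply: smooth_orderD; first exact: smooth_order_affine.
    by apply: smooth_orderM; [exact: smooth_order_cst|exact: smooth_order_affine].
  by apply/funext => x; rewrite !mul1r mulN1r.
have bl : beta l = 0 by apply: b0; apply/orP; left; exact: ltW.
have br : beta r = 0 by apply: b0; apply/orP; right; exact: ltW.
have cbB : continuous (fun y => beta' y * B y + beta y * C y).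
  by move=> x; apply: cvgD; apply: cvgM; [exact: cb'|exact: cB|exact: cb|exact: cC].
have cbI : continuous (fun y => beta' y * I y + beta y * C y).
  by move=> x; apply: cvgD; apply: cvgM; [exact: cb'|exact: cI|exact: cb|exact: cC].
(* The integrand is the derivative of [beta * I], and [beta] vanishes at both ends. *)
have e1 : oint (fun y => beta' y * I y + beta y * C y) l r = 0.
  have D x : between l r x -> is_derive x (1 : R) (fun y => beta y * I y)
      (beta' x * I x + beta x * C x) by move=> _; exact: is_derive1_mul.
  by rewrite (oint_eq cbI D) bl br !mul0r subrr.
have cKB z : continuous (fun y => k (y - z) * Bt y).
  by move=> x; apply: cvgM; [exact: ckz|exact: cBt].
have e2 : oint (fun y => k (y - y1) * Bt y) l r = oint (fun y => k (y - y2) * Bt y) l r.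
  apply/eqP; rewrite -subr_eq0 -ointB// -[X in _ == X](subrr 0) -{1}(H _ _ T) -e1 -ointB//.
  by apply/eqP; congr (oint _ _ _); apply/funext => y; rewrite /beta' /Bt; ring.
have lr : l <= r by exact: ltW (lt_trans ly1 y1r).
(* [c0] is the mass of the kernel, and on its support [Bt] differs from [Bt z] by less than
   [del]. *)
have key z : e < z - l -> e < r - z -> (forall y, `|y - z| < e -> `|Bt y - Bt z| < del) ->
    `|oint (fun y => k (y - z) * Bt y) l r - c0 * Bt z| <= del * c0.
  move=> lz zr hz.
  have kz : oint (fun y => k (y - z)) l r = c0.
    have D y : between l r y -> is_derive y (1 : R) (fun y => P (y - z)) (k (y - z)).
      by move=> _; apply: shift; exact: DP.
    have -> : c0 = P (r - z) - P (l - z).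
      have -> : P (r - z) = P e by apply: Phi; exact: ltW.
      by have -> : P (l - z) = P (- e) by apply: Plo; rewrite lerNr opprB ltW.
    exact: oint_eq (ckz z) D.
  have cBz : continuous (fun y => Bt z * k (y - z)).
    by move=> y; apply: cvgM; [exact: cvg_cst|exact: ckz].
  have cdz : continuous (fun y => del * k (y - z)).
    by move=> y; apply: cvgM; [exact: cvg_cst|exact: ckz].
  rewrite -kz [_ * Bt z]mulrC -!ointZ// -ointB//.
  apply: oint_le_weight => //.
    by move=> y; apply: cvgB; [exact: cKB|exact: cBz].
  move=> y _; rewrite [Bt z * _]mulrC -mulrBr normrM mulrC (ger0_norm (k0 _)).
  case: (ltP `|y - z| e) => yz; first by rewrite ler_wpM2r// ltW// hz.
  by rewrite kout// !mulr0.
have h1 := key _ el1 er1 (fun y yy => hd1 y (lt_trans yy ed1)).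
have h2 := key _ el2 er2 (fun y yy => hd2 y (lt_trans yy ed2)).
rewrite e2 in h1; rewrite -(ler_pM2l c00) -{1}(gtr0_norm c00) -normrM.
set J := oint _ l r in h1 h2.
have -> : c0 * (Bt y1 - Bt y2) = (J - c0 * Bt y2) - (J - c0 * Bt y1) by ring.
rewrite (le_trans (ler_normB _ _))// (le_trans (lerD h2 h1))// /del.
by rewrite le_eqVlt; apply/orP; left; apply/eqP; field.
Qed.

(** * Integrals over boxes for the product measure *)

(** An open set is the countable union of the squares with rational centre and half-width that it
    contains, and these are measurable rectangles. *)
Lemma measurable_open2 (R : realType) (A : set (R * R)) : open A ->
  measurable A.
Proof.
move=> oA.
pose box (q1 q2 q3 : rat) : set (R * R) :=
  `](ratr q1 - ratr q3 : R), (ratr q1 + ratr q3)[%classic `*`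
  `](ratr q2 - ratr q3 : R), (ratr q2 + ratr q3)[%classic.
pose F q1 q2 q3 := if `[< box q1 q2 q3 `<=` A >] then box q1 q2 q3 else set0.
have -> : A = \bigcup_q1 \bigcup_q2 \bigcup_q3 F q1 q2 q3.
  apply/seteqP; split=> [[x y] Axy|p [q1 _ [q2 _ [q3 _]]]]; last first.
    by rewrite /F; case: ifPn => // /asboolP; apply.
  have := oA; rewrite openE => /(_ _ Axy) /nbhs_ballP[d /= d0 hd].
  (* With half-width below [d / 2], a square that contains [(x, y)] stays within distance [d] of
     it. *)
  have [q3 ] : exists q, ratr q \in `](0 : R), d / 2[ by apply: rat_in_itvoo; rewrite divr_gt0.
  rewrite in_itv /= => /andP[q30 q3d].
  have [q1] : exists q, ratr q \in `]x - ratr q3, x + ratr q3[.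
    by apply: rat_in_itvoo; lra.
  have [q2] : exists q, ratr q \in `]y - ratr q3, y + ratr q3[.
    by apply: rat_in_itvoo; lra.
  rewrite !in_itv /= => /andP[y1 y2] /andP[x1 x2].
  exists q1 => //; exists q2 => //; exists q3 => //.
  rewrite /F ifT; first by split; rewrite /= in_itv /=; apply/andP; split; lra.
  apply/asboolP => -[x' y'] [/=]; rewrite !in_itv /= => /andP[? ?] /andP[? ?].
  apply: hd; split; rewrite /ball /= ltr_norml; apply/andP; split; lra.
apply: bigcupT_measurable_rat => q1; apply: bigcupT_measurable_rat => q2.
apply: bigcupT_measurable_rat => q3; rewrite /F; case: ifPn => // _.
by apply: measurableX; exact: measurable_itv.
Qed.

Lemma continuous_measurable2 (R : realType) (g : R * R -> R) : continuous g ->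
  measurable_fun setT g.
Proof.
move=> cg; apply: (measurability _ (measurable_realfun.RGenOpens.measurableE R)).
move=> _ [_ [a [b ->] <-]]; rewrite setTI; apply: measurable_open2.
by move/continuousP: cg; apply; exact: interval_open.
Qed.

Lemma oint_integral (R : realType) (f : R -> R) a b : continuous f -> a <= b ->
  (\int[@lebesgue_measure R]_(x in `[a, b]) (f x)%:E = (oint f a b)%:E)%E.
Proof.
move=> cf; rewrite le_eqVlt => /predU1P[->|ab].
  by rewrite set_itv1 integral_set1 ointxx.
rewrite /oint EFinB; apply: continuous_FTC2 => //.
- exact: continuous_subspaceT.
- have cP : continuous (primitive f) by move=> x; exact: is_derive1_continuous (primitiveP x cf).
  split.
  + by move=> x _; have [] := primitiveP x cf.
  + exact: cvg_at_right_filter (cP a).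
  + exact: cvg_at_left_filter (cP b).
- by move=> x _; rewrite derive1E; have [_] := primitiveP x cf.
Qed.

(** Bridge from the product measure in the weak equation to iterated [oint]: continuity on a compact
    box gives integrability, and the indicator of the box factors. *)
Lemma box_integral (R : realType) (g : R -> R -> R) (a b c d : R) : cont2 g ->
  a <= b -> c <= d ->
  \int[(@lebesgue_measure R \x @lebesgue_measure R)%E]_(p in `[a, b] `*` `[c, d])
     g p.1 p.2 = oint (fun x => oint (g x) c d) a b.
Proof.
move=> cg ab cd.
have cI : continuous (fun x => oint (g x) c d).
  exact: (cont2_sectionr (cont2_oint c cg)).
pose Bx : set (R * R) := `[a, b]%classic `*` `[c, d]%classic.
have mB : measurable Bx by apply: measurableX; exact: measurable_itv.
have mg : measurable_fun setT (fun p : R * R => g p.1 p.2).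
  by apply: continuous_measurable2; exact/cont2P.
have ig : (@lebesgue_measure R \x @lebesgue_measure R)%E.-integrable Bx
    (EFin \o (fun p : R * R => g p.1 p.2)).
  apply: measurable_bounded_integrable => //.
  - have : ((@lebesgue_measure R \x @lebesgue_measure R)%E Bx < +oo)%E.
      have lf (u v : R) : exists k : R, @lebesgue_measure R `[u, v]%classic = k%:E.
        rewrite lebesgue_measure_itv /=; case: ifP => _; last by exists 0.
        by exists (v - u); rewrite EFinB.
      have [k1 h1] := lf a b; have [k2 h2] := lf c d.
      apply: (@le_lt_trans _ _ (k1 * k2)%:E); last exact: ltry.
      rewrite le_eqVlt; apply/orP; left; apply/eqP.
      rewrite product_measure1E; [|exact: measurable_itv..].
      by rewrite EFinM; congr (_ * _)%E; [exact: h1|exact: h2].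
    exact.
  - exact: measurable_funTS.
  - have cB : compact Bx by apply: compact_setX; exact: segment_compact.
    have cgB : {within Bx, continuous (fun p : R * R => g p.1 p.2)}.
      by apply: continuous_subspaceT; exact/cont2P.
    have /compact_bounded [M [Mr hM]] := continuous_compact cgB cB.
    exists M; split=> // N MN p Bp; apply: (hM N MN); by exists p.
rewrite /Rintegral integral_mkcond.
rewrite restrict_EFin -integral12_prod_meas1; last first.
  rewrite -restrict_EFin; by apply/integrable_restrict => //=; rewrite setTI.
rewrite /fubini_F.
under eq_integral => x _.
  rewrite (_ : (\int[lebesgue_measure]_y _)%E =
    ((fun x => (oint (g x) c d)%:E) \_ `[a, b]%classic) x); last first.
    rewrite patchE; case: ifPn => xab.
      rewrite -oint_integral//; last exact: cont2_section.
      rewrite [RHS]integral_mkcond; apply: eq_integral => y _ /=.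
      by rewrite /= !patchE /Bx in_setX /= xab /=; case: ifP.
    apply: integral0_eq => y _; rewrite /= patchE ifF//.
    by rewrite /Bx in_setX /= (negbTE xab).
  over.
by rewrite -integral_mkcond oint_integral.
Qed.

Lemma is_derive_pdx (R : realType) (h : R * R -> R) (x y l : R) :
  is_derive (x, y) ((1 : R), (0 : R)) h l <->
  is_derive x (1 : R) (fun z => h (z, y)) l.
Proof.
pose F1 (k : R) := k^-1 *: ((h \o shift (x, y)) (k *: ((1 : R), (0 : R))) - h (x, y)).
pose F2 (k : R) := k^-1 *: (((fun z => h (z, y)) \o shift x) (k *: (1 : R)) - h (x, y)).
have E : F1 = F2.
  apply/funext => k; congr (_ *: (h _ - _)).
  rewrite (_ : shift _ _ = (k *: (1 : R) + x, k *: (0 : R) + y))//.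
  by rewrite [k *: 0]scaler0 add0r.
split=> -[D1 D2]; split.
- by have : cvg (F1 @ 0^') := D1; rewrite E.
- by rewrite -D2; exact: (f_equal (fun F => lim (F @ 0^')) (esym E)).
- by have : cvg (F2 @ 0^') := D1; rewrite -E.
- by rewrite -D2; exact: (f_equal (fun F => lim (F @ 0^')) E).
Qed.

Lemma is_derive_pdy (R : realType) (h : R * R -> R) (x y l : R) :
  is_derive (x, y) ((0 : R), (1 : R)) h l <->
  is_derive y (1 : R) (fun z => h (x, z)) l.
Proof.
pose F1 (k : R) := k^-1 *: ((h \o shift (x, y)) (k *: ((0 : R), (1 : R))) - h (x, y)).
pose F2 (k : R) := k^-1 *: (((fun z => h (x, z)) \o shift y) (k *: (1 : R)) - h (x, y)).
have E : F1 = F2.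
  apply/funext => k; congr (_ *: (h _ - _)).
  rewrite (_ : shift _ _ = (k *: (0 : R) + x, k *: (1 : R) + y))//.
  by rewrite [k *: 0]scaler0 add0r.
split=> -[D1 D2]; split.
- by have : cvg (F1 @ 0^') := D1; rewrite E.
- by rewrite -D2; exact: (f_equal (fun F => lim (F @ 0^')) (esym E)).
- by have : cvg (F2 @ 0^') := D1; rewrite -E.
- by rewrite -D2; exact: (f_equal (fun F => lim (F @ 0^')) E).
Qed.

Lemma C0onP (R : realType) (A : set (R * R)) (h : R * R -> R) : open A ->
  C0on A h <-> forall p, A p -> {for p, continuous h}.
Proof.
move=> oA; rewrite /C0on continuous_open_subspace//.
by split=> H p; [move=> Ap; apply: H; exact/mem_set|move=> /set_mem; exact: H].
Qed.

(** * Product test functions and the two flux identities *)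

Lemma tensor_partials (R : realType) (f f' g g' : R -> R) :
  (forall x, is_derive x (1 : R) f (f' x)) ->
  (forall x, is_derive x (1 : R) g (g' x)) ->
  forall p : R * R,
    is_derive p ((1 : R), (0 : R)) (fun q => f q.1 * g q.2) (f' p.1 * g p.2) /\
    is_derive p ((0 : R), (1 : R)) (fun q => f q.1 * g q.2) (f p.1 * g' p.2).
Proof.
move=> Df Dg [x y]; split.
  apply/is_derive_pdx => /=.
  apply: (is_derive1_eq (is_derive1_mul (Df x) (is_derive1_cst (g y) x))); ring.
apply/is_derive_pdy => /=.
apply: (is_derive1_eq (is_derive1_mul (is_derive1_cst (f x) y) (Dg y))); ring.
Qed.

(** Induction on the order: a partial derivative of a product of smooth functions of one variable
    each is again such a product. *)
Lemma tensor_smooth (R : realType) (f g : R -> R) :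
  (forall n, smooth_order n f) -> (forall n, smooth_order n g) ->
  forall n, Cnon n setT (fun p : R * R => f p.1 * g p.2).
Proof.
have C0 f' g' : (forall n, smooth_order n f') -> (forall n, smooth_order n g') ->
    C0on setT (fun p : R * R => f' p.1 * g' p.2).
  move=> Sf Sg; apply/C0onP => [|p _]; first exact: openT.
  have /cont2P := cont2_mul (cont2_fst (Sf 0)) (cont2_snd (Sg 0)); exact.
move=> Sf Sg n; elim: n f g Sf Sg => [|n IH] f g Sf Sg; first exact: C0.
have [f' Df _] := Sf 1; have [g' Dg _] := Sg 1.
have Sf' := smooth_order_derive Sf Df; have Sg' := smooth_order_derive Sg Dg.
have D := tensor_partials Df Dg.
have Ex : pdx (fun p : R * R => f p.1 * g p.2) = fun p => f' p.1 * g p.2.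
  by apply/funext => p; have [[_ Dx] _] := D p; exact: Dx.
have Ey : pdy (fun p : R * R => f p.1 * g p.2) = fun p => f p.1 * g' p.2.
  by apply/funext => p; have [_ [_ Dy]] := D p; exact: Dy.
split.
- exact: C0.
- move=> p _; have [[Dx _] [Dy _]] := D p.
  by split; [exact: Dx|exact: Dy].
- by rewrite Ex; exact: IH.
- by rewrite Ey; exact: IH.
Qed.

Lemma test_function_tensor (R : realType) (A : set (R * R)) (a b c d : R)
    (f f' g g' : R -> R) :
  test1 a b f f' -> test1 c d g g' -> `[a, b] `*` `[c, d] `<=` A ->
  test_function A (fun p => f p.1 * g p.2).
Proof.
move=> [Sf _ [a' [b' [aa bb f0]]]] [Sg _ [c' [d' [cc dd g0]]]] BA.
have sub : closure [set p : R * R | f p.1 * g p.2 != 0] `<=` `[a, b] `*` `[c, d].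
  have cl : closed (`[a, b]%classic `*` `[c, d]%classic : set (R * R)).
    apply: compact_closed; first exact: norm_hausdorff.
    by apply: compact_setX; exact: segment_compact.
  rewrite [X in _ `<=` X](closure_id _).1//; apply: closure_subset => -[x y] /=.
  rewrite mulf_eq0 negb_or => /andP[fx gy]; split; rewrite /= in_itv /=.
    apply/andP; split; rewrite leNgt; apply/negP => h; move: fx.
      by rewrite f0 ?eqxx// (ltW (lt_trans h aa)).
    by rewrite f0 ?eqxx// (ltW (lt_trans bb h)) orbT.
  apply/andP; split; rewrite leNgt; apply/negP => h; move: gy.
    by rewrite g0 ?eqxx// (ltW (lt_trans h cc)).
  by rewrite g0 ?eqxx// (ltW (lt_trans dd h)) orbT.
split; first exact: tensor_smooth.
  apply: (subclosed_compact _ _ sub); first exact: closed_closure.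
  by apply: compact_setX; exact: segment_compact.
exact: subset_trans BA.
Qed.

(** The gap between support and endpoints makes [f] vanish near [x], not only at [x]. *)
Lemma test1_derive_out (R : realType) (a b : R) (f f' : R -> R) : test1 a b f f' ->
  forall x, ~~ (a <= x <= b) -> f x = 0 /\ f' x = 0.
Proof.
move=> [_ D [c [d [ac db f0]]]] x; rewrite negb_and -!ltNge => /orP[h|h].
  have xc : 0 < c - x by rewrite subr_gt0 (lt_trans h ac).
  split; first by rewrite f0// ltW// -subr_gt0.
  have := is_derive1_local xc (_ : forall y, `|y - x| < c - x -> f y = 0) (D x).
  move=> D0; have [//|_ <-] := D0; last by have [_ ->] := is_derive1_cst (0 : R) x.
  by move=> y; rewrite ltr_norml => /andP[_ hy]; rewrite f0// ltW//; lra.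
have xd : 0 < x - d by rewrite subr_gt0 (lt_trans db h).
split; first by rewrite f0// orbC ltW// -subr_gt0.
have := is_derive1_local xd (_ : forall y, `|y - x| < x - d -> f y = 0) (D x).
move=> D0; have [//|_ <-] := D0; last by have [_ ->] := is_derive1_cst (0 : R) x.
by move=> y; rewrite ltr_norml => /andP[hy _]; rewrite f0// orbC ltW//; lra.
Qed.

Lemma Rintegral_box (R : realType) (A : set (R * R)) (G : R * R -> R)
    (g : R -> R -> R) (a b c d : R) : cont2 g -> a <= b -> c <= d ->
  `[a, b] `*` `[c, d] `<=` A ->
  (forall x y, a <= x <= b -> c <= y <= d -> G (x, y) = g x y) ->
  (forall x y, A (x, y) -> ~~ ((a <= x <= b) && (c <= y <= d)) -> G (x, y) = 0) ->
  \int[(@lebesgue_measure R \x @lebesgue_measure R)%E]_(p in A) G p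
   = oint (fun x => oint (g x) c d) a b.
Proof.
move=> cg ab cd BA Gg G0; rewrite -box_integral// Rintegral_mkcond [RHS]Rintegral_mkcond.
congr (Rintegral _ _ _); apply/funext => -[x y]; rewrite !patchE.
have inB : ((x, y) \in `[a, b]%classic `*` `[c, d]%classic) = ((a <= x <= b) && (c <= y <= d)).
  by rewrite in_setX /= !mem_setE !in_itv.
rewrite inB; case: (boolP (_ && _)) => [h|h]; last by case: ifPn => // /set_mem Axy; exact: G0.
have /andP[hx hy] := h; rewrite ifT ?Gg//.
by apply/mem_set/BA/set_mem; rewrite inB.
Qed.

(** Tests of the form f(x) g(y) separate the variables, and du Bois-Reymond is used twice: in [y]
    with [f] fixed, then in [x] with [y1] and [y2] fixed. *)
Lemma weak_divergence_flux (R : realType) (A : set (R * R)) (V : R * R -> R * R)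
    (H : R * R -> R) (a b h : R -> R -> R) (x0 y0 r : R) :
  cont2 a -> cont2 b -> cont2 h -> 0 < r ->
  `[x0 - r, x0 + r] `*` `[y0 - r, y0 + r] `<=` A ->
  (forall x y, x0 - r <= x <= x0 + r -> y0 - r <= y <= y0 + r ->
     V (x, y) = (a x y, b x y) /\ H (x, y) = h x y) ->
  (forall phi, test_function A phi ->
      \int[(@lebesgue_measure R \x @lebesgue_measure R)%E]_(p in A)
        dotp (V p) (grad phi p)
      + \int[(@lebesgue_measure R \x @lebesgue_measure R)%E]_(p in A)
        (H p * phi p) = 0) ->
  flux_identity a b h x0 y0 r.
Proof.
move=> ca cb ch r0 BA VE weak.
pose xl := x0 - r; pose xr := x0 + r; pose yl := y0 - r; pose yr := y0 + r.
have xlr : xl <= xr by rewrite /xl /xr; lra.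
have ylr : yl <= yr by rewrite /yl /yr; lra.
have W f f' g g' : test1 xl xr f f' -> test1 yl yr g g' ->
   oint (fun x => oint (fun y => f' x * (a x y * g y) + f x * (b x y * g' y) +
       f x * (h x y * g y)) yl yr) xl xr = 0.
  move=> Tf Tg; have [Sf Df _] := Tf; have [Sg Dg _] := Tg.
  have cf := Sf 0; have cg := Sg 0.
  have cf' := smooth_order_derive Sf Df 0; have cg' := smooth_order_derive Sg Dg 0.
  have c1 : cont2 (fun x y => f' x * (a x y * g y) + f x * (b x y * g' y)).
    by apply: cont2_add; apply: cont2_mul; [exact: cont2_fst|
      apply: cont2_mul => //; exact: cont2_snd|exact: cont2_fst|
      apply: cont2_mul => //; exact: cont2_snd].
  have c2 : cont2 (fun x y => f x * (h x y * g y)).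
    by apply: cont2_mul; [exact: cont2_fst|apply: cont2_mul => //; exact: cont2_snd].
  have := weak _ (test_function_tensor Tf Tg BA).
  have gradE p : grad (fun q => f q.1 * g q.2) p = (f' p.1 * g p.2, f p.1 * g' p.2).
    by rewrite /grad /pdx /pdy; have [[_ ->] [_ ->]] := tensor_partials Df Dg p.
  have out x y : ~~ ((xl <= x <= xr) && (yl <= y <= yr)) ->
     (f x = 0 /\ f' x = 0) \/ (g y = 0 /\ g' y = 0).
    rewrite negb_and => /orP[hx|hy].
      by left; exact: test1_derive_out hx.
    by right; exact: test1_derive_out hy.
  rewrite (Rintegral_box c1 xlr ylr BA); first last.
  - move=> x y _ /out; rewrite gradE /dotp /=.
    by case=> -[-> ->]; rewrite ?mul0r ?mulr0 ?mul0r ?mulr0 addr0.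
  - move=> x y hx hy; rewrite gradE /dotp /=; have [-> _] := VE x y hx hy.
    by rewrite /=; ring.
  rewrite (Rintegral_box c2 xlr ylr BA); first last.
  - by move=> x y _ /out /= [[-> _]|[-> _]]; rewrite ?mul0r ?mulr0 ?mulr0.
  - by move=> x y hx hy /=; have [_ ->] := VE x y hx hy; ring.
  have s1 : continuous (fun x => oint (fun y => f' x * (a x y * g y) + f x * (b x y * g' y)) yl yr).
    exact: (cont2_sectionr (cont2_oint yl c1)).
  have s2 : continuous (fun x => oint (fun y => f x * (h x y * g y)) yl yr).
    exact: (cont2_sectionr (cont2_oint yl c2)).
  rewrite -ointD// => <-; congr (oint _ _ _); apply/funext => x.
  by rewrite ointD//; [exact: (cont2_section (x := x) c1)|exact: (cont2_section (x := x) c2)].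
have S1 f f' : test1 xl xr f f' -> forall y1 y2, yl < y1 < yr -> yl < y2 < yr ->
    oint (fun x => f' x * oint (a x) y1 y2 +
      f x * (oint (h x) y1 y2 - (b x y2 - b x y1))) xl xr = 0.
  move=> Tf y1 y2 hy1 hy2; have [Sf Df _] := Tf.
  have cf := Sf 0; have cf' := smooth_order_derive Sf Df 0.
  have cbf : cont2 (fun x y => f x * b x y) by apply: cont2_mul => //; exact: cont2_fst.
  have caf : cont2 (fun x y => f' x * a x y) by apply: cont2_mul => //; exact: cont2_fst.
  have chf : cont2 (fun x y => f x * h x y) by apply: cont2_mul => //; exact: cont2_fst.
  have cc := cont2_add caf chf.
  (* For fixed [f], the weak equation says in [y] that the derivative of [B1] is [C1], tested
     against [g]. *)
  pose B1 y := oint (fun x => f x * b x y) xl xr.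
  pose C1 y := oint (fun x => f' x * a x y + f x * h x y) xl xr.
  have cB1 : continuous B1.
    exact: (cont2_sectionr (cont2_oint xl (cont2_swap cbf))).
  have cC1 : continuous C1.
    exact: (cont2_sectionr (cont2_oint xl (cont2_swap cc))).
  have := @du_bois_reymond R B1 C1 yl yr cB1 cC1 _ y1 y2 hy1 hy2.
  have E1 : B1 y2 - B1 y1 = oint (fun x => f x * (b x y2 - b x y1)) xl xr.
    rewrite /B1 -ointB; [|exact: (cont2_sectionr cbf)..].
    by congr (oint _ _ _); apply/funext => x; ring.
  have E2 : oint C1 y1 y2 = oint (fun x => f' x * oint (a x) y1 y2 + f x * oint (h x) y1 y2) xl xr.
    rewrite /C1 -(oint_Fubini _ _ _ _ cc); congr (oint _ _ _); apply/funext => x.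
    rewrite ointD; [|exact: (cont2_section (x := x) caf)|exact: (cont2_section (x := x) chf)].
    by rewrite !ointZ//; exact: cont2_section.
  have cA : continuous (fun x => f' x * oint (a x) y1 y2 + f x * oint (h x) y1 y2).
    move=> x; apply: cvgD; apply: cvgM; [exact: cf'| |exact: cf|].
      exact: (cont2_sectionr (cont2_oint y1 ca)).
    exact: (cont2_sectionr (cont2_oint y1 ch)).
  have cBB : continuous (fun x => f x * (b x y2 - b x y1)).
    by move=> x; apply: cvgM; [exact: cf|apply: cvgB; exact: cont2_sectionr].
  move=> key.
  have {}key : B1 y2 - B1 y1 = oint C1 y1 y2.
    apply: key => g g' Tg; have [Sg Dg _] := Tg.
    have cg := Sg 0; have cg' := smooth_order_derive Sg Dg 0.
    rewrite -(W _ _ _ _ Tf Tg) oint_Fubini; last first.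
      by apply: cont2_add; [apply: cont2_add|]; apply: cont2_mul; [exact: cont2_fst|
        apply: cont2_mul => //; exact: cont2_snd|exact: cont2_fst|
        apply: cont2_mul => //; exact: cont2_snd|exact: cont2_fst|
        apply: cont2_mul => //; exact: cont2_snd].
    congr (oint _ _ _); apply/funext => y.
    rewrite /B1 /C1 -(@ointZ _ (fun x => f x * b x y)); last exact: (cont2_sectionr cbf).
    rewrite -(@ointZ _ (fun x => f' x * a x y + f x * h x y)); last exact: (cont2_sectionr cc).
    rewrite -ointD.
    - by congr (oint _ _ _); apply/funext => x; ring.
    - by move=> x; apply: cvgM; [exact: cvg_cst|exact: (cont2_sectionr cbf)].
    - by move=> x; apply: cvgM; [exact: cvg_cst|exact: (cont2_sectionr cc)].
  rewrite -[RHS](subrr (B1 y2 - B1 y1)) {1}key E1 E2 -ointB//.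
  by congr (oint _ _ _); apply/funext => x; ring.
have inx x : `|x - x0| < r -> xl < x < xr by rewrite ltr_distl.
have iny y : `|y - y0| < r -> yl < y < yr by rewrite ltr_distl.
move=> x1 x2 y1 y2 /inx hx1 /inx hx2 /iny hy1 /iny hy2.
have cA : continuous (fun x => oint (a x) y1 y2).
  exact: (cont2_sectionr (cont2_oint y1 ca)).
have cH : continuous (fun x => oint (h x) y1 y2).
  exact: (cont2_sectionr (cont2_oint y1 ch)).
have cB : continuous (fun x => b x y2 - b x y1).
  by move=> x; apply: cvgB; exact: cont2_sectionr.
(* Now in [x]: the flux of [a] through a vertical side has as derivative the integral of [h] minus
   the difference of [b] on the horizontal sides. *)
have := du_bois_reymond cA (_ : continuous (fun x => oint (h x) y1 y2 - (b x y2 - b x y1)))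
  (fun f f' T => S1 f f' T y1 y2 hy1 hy2) hx1 hx2.
rewrite (@ointB _ (fun x => oint (h x) y1 y2))// => E.
rewrite (@ointB _ (a x2) (a x1)); [|exact: cont2_section..].
rewrite E ?subrK//.
by move=> x; apply: cvgB; [exact: cH|exact: cB].
Qed.

(** The flux of the rotated field is the circulation of grad u + F. The part from [u] cancels as a
    sum of increments around the rectangle, with no second derivatives of [u]; the part from [F] is
    Green's formula. *)
Lemma curl_flux (R : realType) (u ux uy F1 F2 F1y F2x : R -> R -> R) (x0 y0 r : R) :
  cont2 ux -> cont2 uy -> cont2 F1 -> cont2 F2 -> cont2 F1y -> cont2 F2x ->
  (forall x y, `|x - x0| < r -> `|y - y0| < r -> [/\ has_partials u ux uy x y,
     is_derive y (1 : R) (F1 x) (F1y x y) & is_derive x (1 : R) (F2^~ y) (F2x x y)]) ->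
  flux_identity (fun x y => uy x y + F2 x y) (fun x y => - (ux x y + F1 x y))
    (fun x y => F2x x y - F1y x y) x0 y0 r.
Proof.
move=> cux cuy cF1 cF2 cF1y cF2x D x1 x2 y1 y2 hx1 hx2 hy1 hy2.
have cx (f : R -> R -> R) x : cont2 f -> continuous (f x) by move=> cf; exact: (cont2_section cf).
have cy (f : R -> R -> R) y : cont2 f -> continuous (f^~ y).
  by move=> cf; exact: (cont2_sectionr cf).
have cI f : cont2 f -> continuous (fun z => oint (f z) y1 y2).
  by move=> cf; exact: (cont2_sectionr (cont2_oint y1 cf)).
have cJ f : cont2 f -> continuous (fun z => oint (f^~ z) x1 x2).
  by move=> cf; exact: (cont2_sectionr (cont2_oint x1 (cont2_swap cf))).
have U1 x : `|x - x0| < r -> oint (uy x) y1 y2 = u x y2 - u x y1.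
  move=> hx; have Dy y : between y1 y2 y -> is_derive y (1 : R) (u x) (uy x y).
    by move=> hy; have [[]] := D x y hx (between_ball hy1 hy2 hy).
  exact: oint_eq (cx _ x cuy) Dy.
have U2 y : `|y - y0| < r -> oint (ux^~ y) x1 x2 = u x2 y - u x1 y.
  move=> hy; have Dx x : between x1 x2 x -> is_derive x (1 : R) (u^~ y) (ux x y).
    by move=> hx; have [[]] := D x y (between_ball hx1 hx2 hx) hy.
  exact: oint_eq (cy _ y cux) Dx.
have V2 y : between y1 y2 y -> F2 x2 y - F2 x1 y = oint (F2x^~ y) x1 x2.
  move=> /(between_ball hy1 hy2) hy.
  have Dx x : between x1 x2 x -> is_derive x (1 : R) (F2^~ y) (F2x x y).
    by move=> hx; have [] := D x y (between_ball hx1 hx2 hx) hy.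
  by rewrite (oint_eq (cy _ y cF2x) Dx).
have V1 x : between x1 x2 x -> F1 x y2 - F1 x y1 = oint (F1y x) y1 y2.
  move=> /(between_ball hx1 hx2) hx.
  have Dy y : between y1 y2 y -> is_derive y (1 : R) (F1 x) (F1y x y).
    by move=> hy; have [] := D x y hx (between_ball hy1 hy2 hy).
  by rewrite (oint_eq (cx _ x cF1y) Dy).
have -> : (fun z => uy x2 z + F2 x2 z - (uy x1 z + F2 x1 z)) =
    (fun z => (uy x2 z - uy x1 z) + (F2 x2 z - F2 x1 z)).
  by apply/funext => z; ring.
have -> : (fun z => - (ux z y2 + F1 z y2) - - (ux z y1 + F1 z y1)) =
    (fun z => (ux z y1 - ux z y2) - (F1 z y2 - F1 z y1)).
  by apply/funext => z; ring.
have -> : (fun z => oint (fun y => F2x z y - F1y z y) y1 y2) =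
    (fun z => oint (F2x z) y1 y2 - oint (F1y z) y1 y2).
  by apply/funext => z; rewrite ointB//; exact: cx.
have cd1 (f : R -> R -> R) a b : cont2 f -> continuous (fun z => f a z - f b z).
  by move=> cf z; apply: cvgB; exact: (cont2_section cf).
have cd2 (f : R -> R -> R) a b : cont2 f -> continuous (fun z => f z a - f z b).
  by move=> cf z; apply: cvgB; exact: (cont2_sectionr cf).
rewrite (ointD _ _ (cd1 uy x2 x1 cuy) (cd1 F2 x2 x1 cF2)).
rewrite (ointB _ _ (cd2 ux y1 y2 cux) (cd2 F1 y2 y1 cF1)).
rewrite (ointB _ _ (cI _ cF2x) (cI _ cF1y)).
rewrite (ointB _ _ (cx _ x2 cuy) (cx _ x1 cuy)) (ointB _ _ (cy _ y1 cux) (cy _ y2 cux)).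
rewrite !U1// !U2// (oint_congr (cd1 F2 x2 x1 cF2) (cJ _ cF2x) V2).
rewrite (oint_congr (cd2 F1 y2 y1 cF1) (cI _ cF1y) V1) -(oint_Fubini _ _ _ _ cF2x).
ring.
Qed.

(** * The orthogonal chart *)

(** Composition with the retraction onto a closed square: a function continuous on the square
    becomes jointly continuous on the plane, and takes no new values. *)
Definition clamp_ext (R : realType) (x0 y0 r : R) (g : R * R -> R) (x y : R) : R :=
  g (clamp (x0 - r) (x0 + r) x, clamp (y0 - r) (y0 + r) y).

Lemma clamp_ext_cont2 (R : realType) (x0 y0 r : R) (g : R * R -> R) : 0 <= r ->
  (forall x y, `|x - x0| <= r -> `|y - y0| <= r -> {for (x, y), continuous g}) ->
  cont2 (clamp_ext x0 y0 r g).
Proof.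
move=> r0 cg; apply/cont2P => p.
apply: (@continuous_comp _ _ _ (fun p : R * R =>
  (clamp (x0 - r) (x0 + r) p.1, clamp (y0 - r) (y0 + r) p.2)) g).
  have c1 : clamp (x0 - r) (x0 + r) q.1 @[q --> p] --> clamp (x0 - r) (x0 + r) p.1.
    by apply: (@continuous_comp _ _ _ fst); [exact: cvg_fst|exact: clamp_continuous].
  have c2 : clamp (y0 - r) (y0 + r) q.2 @[q --> p] --> clamp (y0 - r) (y0 + r) p.2.
    by apply: (@continuous_comp _ _ _ snd); [exact: cvg_snd|exact: clamp_continuous].
  exact: cvg_pair c1 c2.
by apply: cg; exact: clamp_dist.
Qed.

Lemma clamp_extE (R : realType) (x0 y0 r : R) (g : R * R -> R) (x y : R) :
  `|x - x0| < r -> `|y - y0| < r -> clamp_ext x0 y0 r g x y = g (x, y).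
Proof. by move=> hx hy; rewrite /clamp_ext !clamp_near. Qed.

Lemma clamp_ext_derive1 (R : realType) (x0 y0 r l : R) (g : R * R -> R) (x y : R) :
  `|x - x0| < r -> `|y - y0| < r -> is_derive x (1 : R) (fun z => g (z, y)) l ->
  is_derive x (1 : R) ((clamp_ext x0 y0 r g)^~ y) l.
Proof.
move=> hx hy; have d0 : 0 < r - `|x - x0| by rewrite subr_gt0.
apply: (is_derive1_local d0) => z zx; rewrite clamp_extE//.
have -> : z - x0 = (z - x) + (x - x0) by ring.
by rewrite (le_lt_trans (ler_normD _ _))// -ltrBrDr.
Qed.

Lemma clamp_ext_derive2 (R : realType) (x0 y0 r l : R) (g : R * R -> R) (x y : R) :
  `|x - x0| < r -> `|y - y0| < r -> is_derive y (1 : R) (fun z => g (x, z)) l ->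
  is_derive y (1 : R) (clamp_ext x0 y0 r g x) l.
Proof.
move=> hx hy; have d0 : 0 < r - `|y - y0| by rewrite subr_gt0.
apply: (is_derive1_local d0) => z zx; rewrite clamp_extE//.
have -> : z - y0 = (z - y) + (y - y0) by ring.
by rewrite (le_lt_trans (ler_normD _ _))// -ltrBrDr.
Qed.

Lemma C1on_partials (R : realType) (A : set (R * R)) (h : R * R -> R) : open A ->
  C1on A h -> forall x y, A (x, y) ->
  [/\ {for (x, y), continuous h},
      is_derive x (1 : R) (fun z => h (z, y)) (pdx h (x, y)),
      is_derive y (1 : R) (fun z => h (x, z)) (pdy h (x, y)),
      {for (x, y), continuous (pdx h)} & {for (x, y), continuous (pdy h)}].
Proof.
move=> oA [/(C0onP _ oA) ch dh /(C0onP _ oA) cx /(C0onP _ oA) cy] x y Axy.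
have [dx dy] := dh _ Axy; split; [exact: ch| | |exact: cx|exact: cy].
- by apply/is_derive_pdx; exact: derivableP.
- by apply/is_derive_pdy; exact: derivableP.
Qed.

Lemma open_box (R : realType) (A : set (R * R)) (x y : R) : open A -> A (x, y) ->
  exists2 d, 0 < d & forall x' y', `|x' - x| < d -> `|y' - y| < d -> A (x', y').
Proof.
move=> oA Axy; have := oA; rewrite openE => /(_ _ Axy) /nbhs_ballP[d /= d0 hd].
by exists d => // x' y' hx hy; apply: hd; split; rewrite /ball /= distrC.
Qed.

(** Continuity of [h] itself comes from the strict derivative with error 1, a local Lipschitz
    bound. *)
Lemma C1on_intro (R : realType) (A : set (R * R)) (h hx hy : R -> R -> R) : open A ->
  (forall x y, A (x, y) -> has_partials h hx hy x y) ->
  (forall x y, A (x, y) -> cont2_at hx x y /\ cont2_at hy x y) ->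
  C1on A (fun p => h p.1 p.2).
Proof.
move=> oA D C.
have Ex p : A p -> is_derive p ((1 : R), (0 : R)) (fun p => h p.1 p.2) (hx p.1 p.2).
  by case: p => x y /D[? _]; apply/is_derive_pdx.
have Ey p : A p -> is_derive p ((0 : R), (1 : R)) (fun p => h p.1 p.2) (hy p.1 p.2).
  by case: p => x y /D[_ ?]; apply/is_derive_pdy.
have cont g g' : (forall p, A p -> g p = g' p) -> C0on A g -> C0on A g'.
  move=> gg; rewrite /C0on; apply: subspace_eq_continuous.
  by move=> p /set_mem Ap; exact: gg.
split.
- apply/(C0onP _ oA) => -[x y] Axy; apply/cont2_atP => e e0.
  have [r r0 hr] := open_box oA Axy.
  have [cx cy] := C x y Axy.
  have [||d d0 hd] := @strict_derivative2 _ h hx hy x y r r0 _ _ 1 ltr01.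
  + by move=> x' y' hx' hy'; apply: D; exact: hr.
  + move=> e1 e10; have [d1 d10 h1] := cx _ e10; have [d2 d20 h2] := cy _ e10.
    exists (Num.min d1 d2); first by rewrite lt_min d10.
    by move=> x' y'; rewrite !lt_min => /andP[? ?] /andP[? ?]; split; [exact: h1|exact: h2].
  pose M := `|hx x y| + `|hy x y| + 2.
  have M0 : 0 < M by rewrite ltr_wpDl// addr_ge0.
  exists (Num.min d (e / M)); first by rewrite lt_min d0 divr_gt0.
  move=> x' y'; rewrite !lt_min => /andP[x1 x2] /andP[y1 y2].
  have := hd x y x' y'; rewrite !subrr !normr0 => /(_ d0 d0 x1 y1); rewrite mul1r => q1.
  have -> : h x' y' - h x y = (h x' y' - h x y - hx x y * (x' - x) - hy x y * (y' - y))
     + (hx x y * (x' - x) + hy x y * (y' - y)) by ring.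
  have q2 : `|hx x y * (x' - x) + hy x y * (y' - y)| <= `|hx x y| * (e / M) + `|hy x y| * (e / M).
    by rewrite (le_trans (ler_normD _ _))// !normrM lerD// ler_wpM2l//; exact: ltW.
  rewrite (le_lt_trans (ler_normD _ _))//.
  have -> : e = e / M + e / M + (`|hx x y| * (e / M) + `|hy x y| * (e / M)).
    have E : e = e / M * M by rewrite divfK// gt_eqF.
    by move: E; move: (e / M) => v E; rewrite E /M; ring.
  by rewrite ltr_leD// (le_lt_trans q1)// ltrD.
- move=> p Ap; have [Dx _] := Ex p Ap; have [Dy _] := Ey p Ap.
  by split; [exact: Dx|exact: Dy].
- apply: (cont (fun p => hx p.1 p.2)).
    by move=> p Ap; have [_ E] := Ex p Ap; exact: esym E.
  by apply/(C0onP _ oA) => -[x y] Axy; apply/cont2_atP; have [cx _] := C x y Axy; exact: cx.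
- apply: (cont (fun p => hy p.1 p.2)).
    by move=> p Ap; have [_ E] := Ey p Ap; exact: esym E.
  by apply/(C0onP _ oA) => -[x y] Axy; apply/cont2_atP; have [_ cy] := C x y Axy; exact: cy.
Qed.

(** The pullback of the metric uses the Frechet differential, which continuous partial derivatives
    provide. *)
Lemma partials_is_diff (R : realType) (h hx hy : R -> R -> R) (x y r : R) : 0 < r ->
  (forall x' y', `|x' - x| < r -> `|y' - y| < r -> has_partials h hx hy x' y') ->
  cont2_at hx x y -> cont2_at hy x y ->
  is_diff (x, y) (fun p : R * R => h p.1 p.2) (fun v => hx x y * v.1 + hy x y * v.2).
Proof.
move=> r0 D cx cy.
pose df (v : R * R) := hx x y * v.1 + hy x y * v.2.
have dflin : linear df.
  move=> k [v1 v2] [w1 w2]; rewrite /df /= /GRing.scale /=; ring.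
pose L : {linear (R * R)%type -> R} :=
  HB.pack df (GRing.isLinear.Build R (R * R)%type R _ df dflin).
have cL : continuous L.
  move=> v; apply: cvgD; apply: cvgM; [exact: cvg_cst|exact: cvg_fst|exact: cvg_cst|exact: cvg_snd].
have E : (fun p : R * R => h p.1 p.2) \o shift (x, y) = cst (h x y) + L +o_ (0 : R * R) id.
  apply/eqaddoP => e e0.
  (* Half, because both coordinates of [v] are bounded by its sup norm. *)
  have e2 : 0 < e / 2 by rewrite divr_gt0.
  have [|d d0 hd] := @strict_derivative2 _ h hx hy x y r r0 D _ (e / 2) e2.
    move=> e1 e10; have [d1 d10 h1] := cx _ e10; have [d2 d20 h2] := cy _ e10.
    exists (Num.min d1 d2); first by rewrite lt_min d10.
    by move=> x' y'; rewrite !lt_min => /andP[? ?] /andP[? ?]; split; [exact: h1|exact: h2].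
  have nb : nbhs (0 : R * R) (ball (0 : R * R) d) by exact: nbhsx_ballx.
  apply: filterS nb => v [/=]; rewrite /ball /= !sub0r !normrN => vd1 vd2.
  have v1 : `|v.1| <= `|v| by rewrite prod_normE /= le_max lexx.
  have v2 : `|v.2| <= `|v| by rewrite prod_normE /= le_max lexx orbT.
  have := hd x y (v.1 + x) (v.2 + y); rewrite !subrr !normr0 !addrK.
  move=> /(_ d0 d0 vd1 vd2) q.
  have -> : ((fun p : R * R => h p.1 p.2) \o shift (x, y) - (cst (h x y) + L)) v =
     h (v.1 + x) (v.2 + y) - h x y - hx x y * v.1 - hy x y * v.2.
    by rewrite !fctE /= /df; ring.
  apply: (le_trans q); have -> : e * `|v| = e / 2 * (`|v| + `|v|) by field.
  by rewrite ler_wpM2l ?lerD// ltW.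
have dE := diff_unique cL E.
split; last exact: dE.
by apply/diff_locallyP; rewrite dE; split.
Qed.

Lemma is_derive_pairP (R : realType) (gam : R -> R * R) (x : R) (v : R * R) :
  is_derive x (1 : R) gam v <->
  is_derive x (1 : R) (fun z => (gam z).1) v.1 /\
  is_derive x (1 : R) (fun z => (gam z).2) v.2.
Proof.
pose F k := k^-1 *: ((gam \o shift x) (k *: (1 : R)) - gam x).
pose F1 k := k^-1 *: (((fun z => (gam z).1) \o shift x) (k *: (1 : R)) - (gam x).1).
pose F2 k := k^-1 *: (((fun z => (gam z).2) \o shift x) (k *: (1 : R)) - (gam x).2).
have EF : F = fun k => (F1 k, F2 k).
  by apply/funext => k; rewrite /F /F1 /F2 /=; case: (gam _) (gam x) => [? ?] [? ?].
split=> [[D1 D2]|[[D1 E1] [D2 E2]]].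
  have cF : F @ 0^' --> v by rewrite -D2; exact: D1.
  have c1 : F1 @ 0^' --> v.1.
    have -> : F1 = fst \o F by apply/funext => k; rewrite EF.
    by apply: cvg_comp cF _; exact: cvg_fst.
  have c2 : F2 @ 0^' --> v.2.
    have -> : F2 = snd \o F by apply/funext => k; rewrite EF.
    by apply: cvg_comp cF _; exact: cvg_snd.
  split; split.
  - by apply/cvg_ex; exists v.1.
  - exact: (cvg_lim (@norm_hausdorff _ _) c1).
  - by apply/cvg_ex; exists v.2.
  - exact: (cvg_lim (@norm_hausdorff _ _) c2).
have c1 : F1 @ 0^' --> v.1 by rewrite -E1; exact: D1.
have c2 : F2 @ 0^' --> v.2 by rewrite -E2; exact: D2.
have cF : F @ 0^' --> v.
  by rewrite EF [v]surjective_pairing; exact: cvg_pair c1 c2.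
split; first by apply/cvg_ex; exists v.
exact: (cvg_lim (@norm_hausdorff _ _) cF).
Qed.

(** * Level curves at unit speed and the chart *)

(** Separation of variables: the time needed to reach [y] is the integral of 1/phi, and [sig] is its
    inverse. The upper bound on [phi] bounds the slope of this time from below, so solutions exist
    for all time and reach every value. *)
Lemma autonomous_ode (R : realType) (phi : R -> R) (M s0 : R) : continuous phi ->
  (forall x, 0 < phi x) -> (forall x, phi x <= M) ->
  exists sig : R -> R, [/\ (forall t, is_derive t (1 : R) sig (phi (sig t))),
    sig 0 = s0 & forall y, exists t, sig t = y].
Proof.
move=> cphi phi0 phiM.
have M0 : 0 < M by exact: lt_le_trans (phi0 0) (phiM 0).
have cw : continuous (fun x => (phi x)^-1).
  by move=> x; apply: cvgV; [rewrite gt_eqF|exact: cphi].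
(* The variable [x] is a dummy that brings [G] into the form of [increasing_inverse]. *)
pose G (x y : R) := oint (fun x => (phi x)^-1) s0 y.
have DG x y : is_derive y (1 : R) (G x) (phi y)^-1 by exact: oint_derive.
have cG : cont2 G.
  by apply: cont2_snd => y; exact: is_derive1_continuous (DG 0 y).
have Mi : 0 < M^-1 by rewrite invr_gt0.
have [|J [_ JG GJ DJ]] := increasing_inverse Mi cG.
  move=> x y y' yy'.
  have [c _ ->] := @mean_value _ (G x) (fun y => (phi y)^-1) y y' (fun z _ => DG x z).
  by rewrite ler_wpM2r ?subr_ge0// lef_pV2 ?posrE.
exists (J 0); split.
- move=> t; have := DJ 0 (J 0 t) _ (DG 0 (J 0 t)); by rewrite GJ invrK.
- by rewrite -(JG 0 s0) /G ointxx.
- by move=> y; exists (G 0 y).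
Qed.

(* (p,q) parametrizes the curve by its level, at speed w / phi; gam has speed w,
   hence is parametrized by arc length when w is a unit field. *)
Lemma level_curve (R : realType) (p q : R -> R) (w1 w2 phi : R -> R -> R)
    (s0 eta K a0 : R) : 0 < eta -> 0 < K -> cont2 phi -> (forall x y, 0 < phi x y) ->
  (forall a a', `|a - s0| <= eta -> `|a' - s0| <= eta ->
     `|p a' - p a| + `|q a' - q a| <= K * `|a' - a|) ->
  (forall a, `|a - s0| < eta ->
     is_derive a (1 : R) p (w1 (p a) (q a) / phi (p a) (q a)) /\
     is_derive a (1 : R) q (w2 (p a) (q a) / phi (p a) (q a))) ->
  `|a0 - s0| < eta ->
  exists (I : set R) (gam : R -> R * R),
    [/\ open I, is_interval I, I 0, gam 0 = (p a0, q a0) &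
    [/\ (forall z, I z -> exists2 a, `|a - s0| < eta & gam z = (p a, q a)),
        (forall z, I z -> is_derive z (1 : R) gam
           (w1 (gam z).1 (gam z).2, w2 (gam z).1 (gam z).2)) &
        (forall a, `|a - s0| < eta -> exists2 z, I z & gam z = (p a, q a))]].
Proof.
move=> eta0 K0 cphi phi0 lip D ha0.
have eta0' := ltW eta0.
pose cl := clamp (s0 - eta) (s0 + eta).
have cld a : `|cl a - s0| <= eta by exact: clamp_dist.
have cli a : `|a - s0| < eta -> cl a = a by exact: clamp_near.
have ccl (h : R -> R) : (forall a a', `|a - s0| <= eta -> `|a' - s0| <= eta ->
    `|h a' - h a| <= K * `|a' - a|) -> continuous (fun a => h (cl a)).
  move=> hl a; apply/continuous_atP => e e0.
  have /continuous_atP /(_ (e / K))[|d d0 hd] := @clamp_continuous R (s0 - eta) (s0 + eta) a.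
    by rewrite divr_gt0.
  exists d => // b bd; rewrite (le_lt_trans (hl _ _ (cld a) (cld b)))//.
  by rewrite mulrC -ltr_pdivlMr// hd.
have cp : continuous (fun a => p (cl a)).
  by apply: ccl => a a' h h'; apply: le_trans (lip a a' h h'); rewrite lerDl.
have cq : continuous (fun a => q (cl a)).
  by apply: ccl => a a' h h'; apply: le_trans (lip a a' h h'); rewrite lerDr.
(* The speed of the parameter along the curve, clamped so as to be bounded and defined on the whole
   line. *)
pose ph a := phi (p (cl a)) (q (cl a)).
have cph : continuous ph by exact: (continuous_comp2 cphi cp cq).
have [M hM] : exists M, forall a, ph a <= M.
  have ab : s0 - eta <= s0 + eta by lra.
  have [z _ hz] := EVT_max ab (continuous_subspaceT cph).
  exists (ph z) => a; have -> : ph a = ph (cl a).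
    by rewrite /ph [cl (cl a)]clamp_id//; apply: clamp_itv.
  by apply: hz; rewrite in_itv /=; exact: clamp_itv.
have [sig [Dsig sig0 surj]] := autonomous_ode a0 cph (fun a => phi0 _ _) hM.
have csig : continuous sig by move=> z; exact: is_derive1_continuous (Dsig z).
have mono z z' : z <= z' -> sig z <= sig z'.
  move=> zz; have [c _ e] := @mean_value _ sig (fun t => ph (sig t)) z z' (fun t _ => Dsig t).
  by rewrite -subr_ge0 e mulr_ge0 ?subr_ge0// ltW// phi0.
(* The times at which the parameter lies in the open interval; monotonicity of [sig] makes this an
   interval. *)
pose I : set R := [set z | `|sig z - s0| < eta].
pose gam z := (p (sig z), q (sig z)).
exists I, gam; split.
- rewrite openE => z Iz; apply/nbhs_ballP.
  have e0 : 0 < eta - `|sig z - s0| by rewrite subr_gt0.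
  have /continuous_atP /(_ _ e0)[d d0 hd] := csig z.
  exists d => //= z' zz'; rewrite /I /=.
  have -> : sig z' - s0 = (sig z' - sig z) + (sig z - s0) by ring.
  by rewrite (le_lt_trans (ler_normD _ _))// -ltrBrDr hd// distrC.
- move=> z1 z2 Iz1 Iz2 z /andP[h1 h2]; move: Iz1 Iz2; rewrite /I /= !ltr_distl.
  move=> /andP[a1 _] /andP[_ b2]; rewrite (lt_le_trans a1 (mono _ _ h1)).
  exact: le_lt_trans (mono _ _ h2) b2.
- by rewrite /I /= sig0.
- by rewrite /gam sig0.
split.
- by move=> z Iz; exists (sig z).
- move=> z Iz; have [Dp Dq] := D _ Iz.
  have E : ph (sig z) = phi (p (sig z)) (q (sig z)) by rewrite /ph cli.
  apply/is_derive_pairP; split.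
    apply: (is_derive1_eq (is_derive1_comp_at Dp (Dsig z))).
    by rewrite E divfK// gt_eqF.
  apply: (is_derive1_eq (is_derive1_comp_at Dq (Dsig z))).
  by rewrite E divfK// gt_eqF.
- by move=> a ha; have [z zE] := surj a; exists z; rewrite /I /gam /= zE.
Qed.

Lemma enorm_gt0 (R : realType) (v : R * R) : v <> 0 -> 0 < enorm v.
Proof.
move=> v0; rewrite sqrtr_gt0 lt_def addr_ge0 ?sqr_ge0// andbT.
apply/eqP => h; apply: v0.
have h1 : v.1 * v.1 = 0.
  by apply/eqP; rewrite eq_le -[X in _ <= X]h /dotp lerDl !sqr_ge0.
have h2 : v.2 * v.2 = 0 by move: h; rewrite /dotp h1 add0r.
move/eqP: h1; rewrite mulf_eq0 orbb => /eqP h1.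
move/eqP: h2; rewrite mulf_eq0 orbb => /eqP h2.
by rewrite [v]surjective_pairing h1 h2.
Qed.

Lemma dotp_vnormal (R : realType) (u : R * R -> R) (F : R * R -> R * R) (p : R * R) :
  0 < vlength u F p -> dotp (vnormal u F p) (vnormal u F p) = 1.
Proof.
move=> D0; have E : dotp (vfield u F p) (vfield u F p) = vlength u F p ^+ 2.
  by rewrite /vlength /enorm sqr_sqrtr// /dotp addr_ge0 ?sqr_ge0.
move: D0 E; rewrite /vnormal; move: (vlength u F p) => l; move: (vfield u F p) => v l0 E.
have -> : dotp (l^-1 *: v) (l^-1 *: v) = l^-1 ^+ 2 * dotp v v.
  by rewrite /dotp /= /GRing.scale /=; ring.
by rewrite E exprVn mulVf// expf_neq0// gt_eqF.
Qed.

Lemma level_set_curve (R : realType) (O : set (R * R)) (h : R * R -> R) (p q : R -> R)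
    (w1 w2 phi : R -> R -> R) (c s0 eta K a0 : R) :
  0 < eta -> 0 < K -> cont2 phi -> (forall x y, 0 < phi x y) ->
  (forall a a', `|a - s0| <= eta -> `|a' - s0| <= eta ->
     `|p a' - p a| + `|q a' - q a| <= K * `|a' - a|) ->
  (forall a, `|a - s0| < eta ->
     is_derive a (1 : R) p (w1 (p a) (q a) / phi (p a) (q a)) /\
     is_derive a (1 : R) q (w2 (p a) (q a) / phi (p a) (q a))) ->
  (forall a, `|a - s0| < eta -> O (p a, q a) /\ h (p a, q a) = c) ->
  (forall z, O z -> h z = c -> exists2 a, `|a - s0| < eta & z = (p a, q a)) ->
  `|a0 - s0| < eta ->
  exists (I : set R) (gam : R -> R * R),
    [/\ integral_curve (fun z => (w1 z.1 z.2, w2 z.1 z.2)) O I gam,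
        I 0, gam 0 = (p a0, q a0) & [set z | O z /\ h z = c] = gam @` I].
Proof.
move=> eta0 K0 cphi phi0 lip D hO hc ha0.
have [I [gam [oI iI I0 gam0 [mem Dg surj]]]] := level_curve eta0 K0 cphi phi0 lip D ha0.
have gO z : I z -> O (gam z) /\ h (gam z) = c by move=> /mem[a ha ->]; exact: hO.
exists I, gam; split=> //.
  split=> //; first by exists 0.
  by move=> z Iz; split; [exact: (gO z Iz).1|exact: Dg].
apply/seteqP; split=> [z [Oz /(hc _ Oz)[a /surj[y Iy yE] ->]]|_ [z Iz <-]].
  by exists y.
exact: gO.
Qed.

Lemma integral_curve_eq (R : realType) (V W : R * R -> R * R) (O : set (R * R))
    (I : set R) (gam : R -> R * R) : (forall p, O p -> V p = W p) ->
  integral_curve V O I gam -> integral_curve W O I gam.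
Proof.
move=> VW [oI iI I0 D]; split=> // x /D[Ox Dx]; split=> //.
by rewrite -VW.
Qed.

Lemma has_partials_grad (R : realType) (s sx sy : R -> R -> R) (p : R * R) :
  has_partials s sx sy p.1 p.2 ->
  grad (fun p => s p.1 p.2) p = (sx p.1 p.2, sy p.1 p.2).
Proof.
case: p => x y [Dx Dy]; rewrite /grad /pdx /pdy.
have [_ ->] := (is_derive_pdx (fun p => s p.1 p.2) x y (sx x y)).2 Dx.
by have [_ ->] := (is_derive_pdy (fun p => s p.1 p.2) x y (sy x y)).2 Dy.
Qed.

(** The columns of the inverse Jacobian are N^perp / f and N / g, so the coordinate lines of the
    inverse chart run along N^perp and N at speeds 1/f and 1/g. Here [g] stands for the full length
    of grad t, which is g D in the application. *)
Lemma orthogonal_chart (R : realType) (s t n1 n2 f g : R -> R -> R) (x0 y0 rho : R) :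
  0 < rho -> cont2 n1 -> cont2 n2 -> cont2 f -> cont2 g ->
  (forall x y, n1 x y * n1 x y + n2 x y * n2 x y = 1) ->
  (forall x y, 0 < f x y) -> (forall x y, 0 < g x y) ->
  (forall x y, `|x - x0| < rho /\ `|y - y0| < rho -> has_partials s
     (fun x y => f x y * n2 x y) (fun x y => - (f x y * n1 x y)) x y) ->
  (forall x y, `|x - x0| < rho /\ `|y - y0| < rho -> has_partials t
     (fun x y => g x y * n1 x y) (fun x y => g x y * n2 x y) x y) ->
  let Psi (p : R * R) := (s p.1 p.2, t p.1 p.2) in
  exists (O : set (R * R)) (Phi : R * R -> R * R),
  [/\ O (x0, y0), forall p, O p -> `|p.1 - x0| < rho /\ `|p.2 - y0| < rho,
      C1_diffeo O (Psi @` O) Psi Phi,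
      forall p, O p -> is_diff p Psi (fun v =>
        (f p.1 p.2 * n2 p.1 p.2 * v.1 + - (f p.1 p.2 * n1 p.1 p.2) * v.2,
         g p.1 p.2 * n1 p.1 p.2 * v.1 + g p.1 p.2 * n2 p.1 p.2 * v.2)) &
      forall p, O p ->
        (exists I gam, [/\ integral_curve (fun p => (n2 p.1 p.2, - n1 p.1 p.2)) O I gam,
           I 0, gam 0 = p & [set q | O q /\ (Psi q).2 = (Psi p).2] = gam @` I]) /\
        (exists I gam, [/\ integral_curve (fun p => (n1 p.1 p.2, n2 p.1 p.2)) O I gam,
           I 0, gam 0 = p & [set q | O q /\ (Psi q).1 = (Psi p).1] = gam @` I])].
Proof.
move=> rho0 cn1 cn2 cf cg nn f0 g0 Ds Dt Psi.
pose sx x y := f x y * n2 x y; pose sy x y := - (f x y * n1 x y).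
pose tx x y := g x y * n1 x y; pose ty x y := g x y * n2 x y.
have csx : cont2 sx by exact: cont2_mul.
have csy : cont2 sy by apply: cont2_opp; exact: cont2_mul.
have ctx : cont2 tx by exact: cont2_mul.
have cty : cont2 ty by exact: cont2_mul.
have frame x y : `|x - x0| < rho /\ `|y - y0| < rho -> dual_frame (sx x y) (sy x y)
   (tx x y) (ty x y) (n2 x y / f x y) (- n1 x y / f x y)
   (n1 x y / g x y) (n2 x y / g x y).
  move=> _; have := nn x y; have := f0 x y; have := g0 x y.
  rewrite /sx /sy /tx /ty => g0' f0' nn'.
  have : g x y != 0 by rewrite gt_eqF.
  have : f x y != 0 by rewrite gt_eqF.
  move: nn'; move: (n1 x y) (n2 x y) (f x y) (g x y) => a b f' g' nn' fn gn.
  (* Identities that hold only modulo n1^2 + n2^2 = 1 become rational ones once this factor is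
     inserted. *)
  have hh (z w : R) : w = z * (a * a + b * b) -> w = z by rewrite nn' mulr1.
  by split; split; first [by field; rewrite ?fn ?gn|
    apply: hh; by field; rewrite ?fn ?gn].
have C1st x y : `|x - x0| < rho /\ `|y - y0| < rho ->
   [/\ cont2_at sx x y, cont2_at sy x y, cont2_at tx x y & cont2_at ty x y].
  by move=> _; split; [exact: csx|exact: csy|exact: ctx|exact: cty].
have [d [eta1 [K [P [Q [/andP[d0 drho] eta10 K0 [PQ QP lip DPQ]]]]]]] :=
  local_inverse rho0 Ds Dt C1st frame.
(* Halved so that the inverse is Lipschitz on closed coordinate segments, as [level_curve]
   requires. *)
pose eta := eta1 / 2.
have eta0 : 0 < eta by rewrite divr_gt0.
have etal : eta < eta1 by rewrite /eta ltr_pdivrMr// ltr_pMr// ltr1n.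
set s0 := s x0 y0 in PQ QP lip DPQ *; set t0 := t x0 y0 in PQ QP lip DPQ *.
(* The preimage of an open square, mapped onto all of it: each level set in [O] is then the image of
   a full segment, hence a single curve. *)
pose O : set (R * R) := [set p | [/\ `|p.1 - x0| < d, `|p.2 - y0| < d,
  `|s p.1 p.2 - s0| < eta & `|t p.1 p.2 - t0| < eta]].
have box_rho x y : `|x - x0| < d -> `|y - y0| < d -> `|x - x0| < rho /\ `|y - y0| < rho.
  by move=> hx hy; split; exact: lt_le_trans drho.
have Obox p : O p -> `|p.1 - x0| < rho /\ `|p.2 - y0| < rho.
  by case=> hx hy _ _; exact: box_rho.
have sep h hx hy : (forall x y, `|x - x0| < rho /\ `|y - y0| < rho -> has_partials h hx hy x y) ->
    cont2 hx -> cont2 hy -> forall p, `|p.1 - x0| < d -> `|p.2 - y0| < d ->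
    is_diff p (fun p : R * R => h p.1 p.2) (fun v => hx p.1 p.2 * v.1 + hy p.1 p.2 * v.2).
  move=> Dh chx chy [x y] /= xd yd.
  have [xr yr] := box_rho x y xd yd.
  pose e := Num.min (rho - `|x - x0|) (rho - `|y - y0|).
  have e0 : 0 < e by rewrite lt_min !subr_gt0 xr.
  apply: (partials_is_diff e0 _ (chx x y) (chy x y)) => x' y'.
  rewrite !lt_min => /andP[h1 _] /andP[_ h2]; apply: Dh; split.
    have -> : x' - x0 = (x' - x) + (x - x0) by ring.
    by rewrite (le_lt_trans (ler_normD _ _))// -ltrBrDr.
  have -> : y' - y0 = (y' - y) + (y - y0) by ring.
  by rewrite (le_lt_trans (ler_normD _ _))// -ltrBrDr.
have diffs := sep s sx sy Ds csx csy.
have difft := sep t tx ty Dt ctx cty.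
have oO : open O.
  rewrite openE => p Op; have [xd yd se te] := Op.
  have cs : {for p, continuous (fun p : R * R => s p.1 p.2)}.
    by apply: differentiable_continuous; have [] := diffs p xd yd.
  have ct : {for p, continuous (fun p : R * R => t p.1 p.2)}.
    by apply: differentiable_continuous; have [] := difft p xd yd.
  have e1 : 0 < eta - `|s p.1 p.2 - s0| by rewrite subr_gt0.
  have e2 : 0 < eta - `|t p.1 p.2 - t0| by rewrite subr_gt0.
  have /continuous2_atP /(_ _ e1)[d1 d10 hd1] := cs.
  have /continuous2_atP /(_ _ e2)[d2 d20 hd2] := ct.
  apply/nbhs_ballP.
  pose e := Num.min (Num.min d1 d2) (Num.min (d - `|p.1 - x0|) (d - `|p.2 - y0|)).
  exists e; first by rewrite /e /= !lt_min d10 d20 !subr_gt0 xd.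
  move=> q [] /=; rewrite /ball /= !(distrC _ (q.1), distrC _ (q.2)).
  rewrite !lt_min => /andP[/andP[a1 a2] /andP[a3 _]] /andP[/andP[b1 b2] /andP[_ b3]].
  split.
  - have -> : q.1 - x0 = (q.1 - p.1) + (p.1 - x0) by ring.
    by rewrite (le_lt_trans (ler_normD _ _))// -ltrBrDr.
  - have -> : q.2 - y0 = (q.2 - p.2) + (p.2 - y0) by ring.
    by rewrite (le_lt_trans (ler_normD _ _))// -ltrBrDr.
  - have -> : s q.1 q.2 - s0 = (s q.1 q.2 - s p.1 p.2) + (s p.1 p.2 - s0) by ring.
    by rewrite (le_lt_trans (ler_normD _ _))// -ltrBrDr hd1.
  - have -> : t q.1 q.2 - t0 = (t q.1 q.2 - t p.1 p.2) + (t p.1 p.2 - t0) by ring.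
    by rewrite (le_lt_trans (ler_normD _ _))// -ltrBrDr hd2.
have C1s : C1on O (fun p => s p.1 p.2).
  apply: (C1on_intro oO (hx := sx) (hy := sy)).
    by move=> x y /Obox; exact: Ds.
  by move=> x y _; split; [exact: csx|exact: csy].
have C1t : C1on O (fun p => t p.1 p.2).
  apply: (C1on_intro oO (hx := tx) (hy := ty)).
    by move=> x y /Obox; exact: Dt.
  by move=> x y _; split; [exact: ctx|exact: cty].
have zb a b : `|a - s0| <= eta -> `|b - t0| <= eta -> `|a - s0| < eta1 /\ `|b - t0| < eta1.
  by move=> ha hb'; split; exact: le_lt_trans etal.
have inO a b : `|a - s0| < eta -> `|b - t0| < eta -> O (P a b, Q a b).
  move=> ha hb'; have [h1 h2 h3 h4] := PQ a b (zb a b (ltW ha) (ltW hb')).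
  by split; rewrite /= ?h3 ?h4.
have PhiPsi p : O p -> (P (s p.1 p.2) (t p.1 p.2), Q (s p.1 p.2) (t p.1 p.2)) = p.
  case: p => x y [/= hx hy hs ht].
  by have [-> ->] := QP x y hx hy (zb _ _ (ltW hs) (ltW ht)).
pose Phi (q : R * R) := (P q.1 q.2, Q q.1 q.2).
have Phi_Psi p : O p -> Phi (Psi p) = p by exact: PhiPsi.
exists O, Phi; split=> //; first by split; rewrite /= subrr normr0.
- have PsiB : Psi @` O = ball (s0, t0) eta.
    apply/seteqP; split=> [_ [p [_ _ hs ht] <-]|[a b] [/= ha hb']].
      by split; rewrite /ball /= distrC.
    rewrite /ball /= distrC in ha; rewrite /ball /= distrC in hb'.
    exists (P a b, Q a b); first exact: inO.
    by have [_ _ + +] := PQ a b (zb a b (ltW ha) (ltW hb')); rewrite /Psi /= => -> ->.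
  have oB : open (ball (s0, t0) eta) by exact: ball_open.
  have inB a b : ball (s0, t0) eta (a, b) -> `|a - s0| < eta1 /\ `|b - t0| < eta1.
    by case; rewrite /ball /= !(distrC s0, distrC t0) => ha hb'; apply: zb; exact: ltW.
  have cPQ a b : ball (s0, t0) eta (a, b) -> cont2_at P a b /\ cont2_at Q a b.
    move=> Bab; have zab := inB a b Bab.
    have [dl dl0 hdl] := open_box oB Bab.
    have key e : 0 < e -> exists2 d', 0 < d' & forall a' b', `|a' - a| < d' -> `|b' - b| < d' ->
        `|P a' b' - P a b| + `|Q a' b' - Q a b| < e.
      move=> e0; exists (Num.min dl (e / (K + K))).
        by rewrite lt_min dl0 divr_gt0// addr_gt0.
      move=> a' b'; rewrite !lt_min => /andP[a1 a2] /andP[b1 b2].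
      apply: le_lt_trans (lip a b a' b' zab (inB _ _ (hdl _ _ a1 b1))) _.
      move: a2 b2; rewrite !ltr_pdivlMr ?addr_gt0// => a2 b2; lra.
    split=> e /key[d' d'0 h]; exists d' => // a' b' ha hb'.
      by apply: le_lt_trans (h a' b' ha hb'); rewrite lerDl.
    by apply: le_lt_trans (h a' b' ha hb'); rewrite lerDr.
  have comp_at l a b : cont2 l -> ball (s0, t0) eta (a, b) ->
      cont2_at (fun a b => l (P a b) (Q a b)) a b.
    move=> cl' Bab; have [cP cQ] := cPQ a b Bab => e e0.
    have [d1 d10 hd1] := cl' (P a b) (Q a b) e e0.
    have [d2 d20 hd2] := cP _ d10; have [d3 d30 hd3] := cQ _ d10.
    exists (Num.min d2 d3); first by rewrite lt_min d20.
    by move=> a' b'; rewrite !lt_min => /andP[? ?] /andP[? ?]; apply: hd1; [exact: hd2|exact: hd3].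
  have cfi : cont2 (fun x y => (f x y)^-1) by apply: cont2_inv => // x y; rewrite gt_eqF.
  have cgi : cont2 (fun x y => (g x y)^-1) by apply: cont2_inv => // x y; rewrite gt_eqF.
  rewrite PsiB; split; first by split.
  split; [by split| |by []].
  split.
    apply: (C1on_intro oB (hx := fun a b => n2 (P a b) (Q a b) / f (P a b) (Q a b))
      (hy := fun a b => n1 (P a b) (Q a b) / g (P a b) (Q a b))).
      by move=> a b /inB zab; have [? ? _ _] := DPQ a b zab; split.
    move=> a b Bab; split.
      exact: (comp_at (fun x y => n2 x y / f x y) a b (cont2_mul cn2 cfi) Bab).
    exact: (comp_at (fun x y => n1 x y / g x y) a b (cont2_mul cn1 cgi) Bab).
  apply: (C1on_intro oB (hx := fun a b => - n1 (P a b) (Q a b) / f (P a b) (Q a b))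
      (hy := fun a b => n2 (P a b) (Q a b) / g (P a b) (Q a b))).
    by move=> a b /inB zab; have [_ _ ? ?] := DPQ a b zab; split.
  move=> a b Bab; split.
    exact: (comp_at (fun x y => - n1 x y / f x y) a b (cont2_mul (cont2_opp cn1) cfi) Bab).
  exact: (comp_at (fun x y => n2 x y / g x y) a b (cont2_mul cn2 cgi) Bab).
- by move=> p [xd yd _ _]; exact: is_diff_pair (diffs p xd yd) (difft p xd yd).
move=> p Op; have [_ _ hs ht] := Op; split.
- have [|||||I [gam [ic I0 g0' im]]] := @level_set_curve R O (fun z => (Psi z).2)
    (P^~ (Psi p).2) (Q^~ (Psi p).2) n2 (fun x y => - n1 x y) f (Psi p).2 s0 eta K
    (Psi p).1 eta0 K0 cf f0.
  + move=> a a' ha ha'; have := lip a _ a' _ (zb _ _ ha (ltW ht)) (zb _ _ ha' (ltW ht)).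
    by rewrite subrr normr0 addr0.
  + by move=> a ha; have [? _ ? _] := DPQ a _ (zb _ _ (ltW ha) (ltW ht)).
  + move=> a ha; split; first exact: inO.
    by have [_ _ _ ?] := PQ a _ (zb _ _ (ltW ha) (ltW ht)).
  + move=> z Oz <-; exists (Psi z).1; first by have [] := Oz.
    by rewrite -[LHS]Phi_Psi.
  + by [].
  by exists I, gam; split=> //; rewrite g0'; exact: Phi_Psi.
- have [|||||I [gam [ic I0 g0' im]]] := @level_set_curve R O (fun z => (Psi z).1)
    (P (Psi p).1) (Q (Psi p).1) n1 n2 g (Psi p).1 t0 eta K (Psi p).2 eta0 K0 cg g0.
  + move=> b b' hb hb'; have := lip _ b _ b' (zb _ _ (ltW hs) hb) (zb _ _ (ltW hs) hb').
    by rewrite subrr normr0 add0r.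
  + by move=> b hb; have [_ ? _ ?] := DPQ _ b (zb _ _ (ltW hs) (ltW hb)).
  + move=> b hb; split; first exact: inO.
    by have [_ _ ? _] := PQ _ b (zb _ _ (ltW hs) (ltW hb)).
  + move=> z Oz <-; exists (Psi z).2; first by have [] := Oz.
    by rewrite -[LHS]Phi_Psi.
  + by [].
  by exists I, gam; split=> //; rewrite g0'; exact: Phi_Psi.
Qed.

Theorem theoremC (R : realType) (Omega : set (R * R)) (F : R * R -> R * R)
    (H u : R * R -> R)
    (hOmega : plane_domain Omega)
    (hF : C1map_on Omega F)
    (hH : C0on Omega H)
    (hu : C1on Omega u)
    (hns : forall p, Omega p -> grad u p + F p <> 0)
    (hweak : forall phi, test_function Omega phi ->
      \int[(@lebesgue_measure R \x @lebesgue_measure R)%E]_(p in Omega)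
        dotp (vnormal u F p) (grad phi p)
      + \int[(@lebesgue_measure R \x @lebesgue_measure R)%E]_(p in Omega)
        (H p * phi p) = 0) :
  let N := vnormal u F in
  let Nperp := fun p => perp (N p) in
  let D := vlength u F in
  forall p0, Omega p0 ->
  exists (Omega' : set (R * R)) (s t f g : R * R -> R),
    [/\ open Omega', Omega' p0 & Omega' `<=` Omega] /\
    [/\ C1on Omega' s, C1on Omega' t,
        forall c, [set p | Omega' p /\ t p = c] !=set0 ->
          is_integral_curve_in Nperp Omega' [set p | Omega' p /\ t p = c]
      & forall c, [set p | Omega' p /\ s p = c] !=set0 ->
          is_integral_curve_in N Omega' [set p | Omega' p /\ s p = c]] /\
    [/\ C0on Omega' f, C0on Omega' g,
        forall p, Omega' p -> 0 < f p /\ 0 < g p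
      & forall p, Omega' p ->
          grad s p = f p *: Nperp p /\ grad t p = (g p * D p) *: N p] /\
    (exists Nf Nperpg : R * R -> R,
      [/\ C0on Omega' Nf, C0on Omega' Nperpg,
          forall p, Omega' p -> is_curve_derive N Omega' f p (Nf p)
            /\ is_curve_derive Nperp Omega' g p (Nperpg p)
        & forall p, Omega' p -> Nf p + f p * H p = 0
            /\ Nperpg p + rot2 F p * g p / D p = 0]) /\
    (exists (Omega'' : set (R * R)) (Phi : R * R -> R * R),
      let Psi := fun p => (s p, t p) in
      [/\ Omega'' p0, Omega'' `<=` Omega',
          C1_diffeo Omega'' (Psi @` Omega'') Psi Phi
        & forall p, Omega'' p -> forall v w,
            pullback Psi
              (diag_metric (fun q => 1 / f (Phi q) ^+ 2)
                 (fun q => 1 / (g (Phi q) ^+ 2 * D (Phi q) ^+ 2))) p v w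
            = euclidean_metric p v w]).
Proof.
move=> N Nperp D [x0 y0] Op0.
have [oO _ _] := hOmega.
have [hF1 hF2] := hF.
pose G p := vfield u F p.
have GE p : G p = (pdx u p + (F p).1, pdy u p + (F p).2) by [].
have NE p : N p = ((D p)^-1 * (G p).1, (D p)^-1 * (G p).2) by [].
have G0 p : Omega p -> 0 < D p by move=> /hns Gp; exact: enorm_gt0.
have NN p : Omega p -> (N p).1 * (N p).1 + (N p).2 * (N p).2 = 1.
  by move=> Op; exact: (dotp_vnormal (G0 p Op)).
have GN p : Omega p -> (G p).1 = D p * (N p).1 /\ (G p).2 = D p * (N p).2.
  by move=> /G0 Dp; rewrite NE /= !mulrA mulfV ?gt_eqF// !mul1r.
have cG1 p : Omega p -> {for p, continuous (fun p => (G p).1)}.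
  case: p => x y Op; have [_ _ _ cu _] := C1on_partials oO hu Op.
  have [cF _ _ _ _] := C1on_partials oO hF1 Op.
  exact: cvgD cu cF.
have cG2 p : Omega p -> {for p, continuous (fun p => (G p).2)}.
  case: p => x y Op; have [_ _ _ _ cu] := C1on_partials oO hu Op.
  have [cF _ _ _ _] := C1on_partials oO hF2 Op.
  exact: cvgD cu cF.
have cD p : Omega p -> {for p, continuous D}.
  move=> Op; apply: (@continuous_comp _ _ _ (fun p => dotp (G p) (G p)) Num.sqrt).
    by apply: cvgD; apply: cvgM; [exact: cG1|exact: cG1|exact: cG2|exact: cG2].
  exact: sqrt_continuous.
have cDi p : Omega p -> {for p, continuous (fun p => (D p)^-1)}.
  by move=> Op; apply: cvgV; [rewrite gt_eqF// G0|exact: cD].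
have cN1 p : Omega p -> {for p, continuous (fun p => (N p).1)}.
  by move=> Op; apply: cvgM; [exact: cDi|exact: cG1].
have cN2 p : Omega p -> {for p, continuous (fun p => (N p).2)}.
  by move=> Op; apply: cvgM; [exact: cDi|exact: cG2].
have cH p : Omega p -> {for p, continuous H} by move/(C0onP _ oO): hH; exact.
have crot p : Omega p -> {for p, continuous (rot2 F)}.
  case: p => x y Op; have [_ _ _ c2 _] := C1on_partials oO hF2 Op.
  have [_ _ _ _ c1] := C1on_partials oO hF1 Op.
  exact: cvgB c2 c1.
have [r1 r10 hr1] := open_box oO Op0.
(* The closed square of radius [r], where clamped points lie, must be contained in Omega. *)
pose r := r1 / 2.
have r0 : 0 < r by rewrite divr_gt0.
have rr1 : r < r1 by rewrite /r ltr_pdivrMr// ltr_pMr// ltr1n.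
have r0' := ltW r0.
have hb x y : `|x - x0| <= r -> `|y - y0| <= r -> Omega (x, y).
  by move=> hx hy; apply: hr1; exact: le_lt_trans rr1.
pose E := clamp_ext x0 y0 r.
have cE g : (forall p, Omega p -> {for p, continuous g}) -> cont2 (E g).
  by move=> cg; apply: clamp_ext_cont2 => // x y hx hy; apply: cg; exact: hb.
have EE g x y : `|x - x0| < r -> `|y - y0| < r -> E g x y = g (x, y).
  exact: clamp_extE.
(* Values of the extensions are values at points of Omega, so the pointwise identities for N, D and
   the field hold on the whole plane. *)
pose cl x y := (clamp (x0 - r) (x0 + r) x, clamp (y0 - r) (y0 + r) y).
have clO x y : Omega (cl x y) by apply: hb; exact: clamp_dist.
pose n1 := E (fun p => (N p).1); pose n2 := E (fun p => (N p).2).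
pose g1 := E (fun p => (G p).1); pose g2 := E (fun p => (G p).2).
pose hH' := E H; pose k := E (rot2 F); pose dd := E D.
have cn1 : cont2 n1 by exact: cE. have cn2 : cont2 n2 by exact: cE.
have cg1 : cont2 g1 by exact: cE. have cg2 : cont2 g2 by exact: cE.
have chH : cont2 hH' by exact: cE. have ck : cont2 k by exact: cE.
have cdd : cont2 dd by exact: cE.
have dd0 x y : 0 < dd x y by exact: (G0 _ (clO x y)).
have nn x y : n1 x y * n1 x y + n2 x y * n2 x y = 1 by exact: (NN (cl x y)).
have gn1 x y : g1 x y = dd x y * n1 x y by exact: (GN _ (clO x y)).1.
have gn2 x y : g2 x y = dd x y * n2 x y by exact: (GN _ (clO x y)).2.
have flux1 : flux_identity n1 n2 hH' x0 y0 r.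
  apply: (weak_divergence_flux (V := N) (H := H) cn1 cn2 chH r0 _ _ hweak).
    by move=> [x y] [/=]; rewrite !in_itv /= -!ler_distl; exact: hb.
  by move=> x y hx hy; rewrite /n1 /n2 /hH' /E /clamp_ext !clamp_id//.
(* The pair (g2, -g1) is D N^perp. *)
have flux2 : flux_identity g2 (fun x y => - g1 x y) k x0 y0 r.
  apply: (@curl_flux R (fun x y => u (x, y)) (E (pdx u)) (E (pdy u))
    (E (fun p => (F p).1)) (E (fun p => (F p).2))
    (E (pdy (fun p => (F p).1))) (E (pdx (fun p => (F p).2)))).
  - by apply: cE => -[x y] /(C1on_partials oO hu)[].
  - by apply: cE => -[x y] /(C1on_partials oO hu)[].
  - by apply: cE => -[x y] /(C1on_partials oO hF1)[].
  - by apply: cE => -[x y] /(C1on_partials oO hF2)[].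
  - by apply: cE => -[x y] /(C1on_partials oO hF1)[].
  - by apply: cE => -[x y] /(C1on_partials oO hF2)[].
  move=> x y hx hy; have Oxy := hb x y (ltW hx) (ltW hy).
  have [_ ux uy _ _] := C1on_partials oO hu Oxy.
  have [_ _ f1y _ _] := C1on_partials oO hF1 Oxy.
  have [_ f2x _ _ _] := C1on_partials oO hF2 Oxy.
  rewrite /has_partials !EE//; split; first by split.
    exact: clamp_ext_derive2.
  exact: clamp_ext_derive1.
have n00 : (n1 x0 y0 != 0) || (n2 x0 y0 != 0).
  rewrite -negb_and; apply/negP => /andP[/eqP a0 /eqP b0].
  by have := nn x0 y0; rewrite a0 b0 !mulr0 addr0 => /esym/eqP; rewrite oner_eq0.
have [rho1 [S1 [f [/andP[rho10 rho1r] [cf f0 DS1 DC1]]]]] :=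
  integrating_factor_exists cn1 cn2 chH r0 n00 flux1.
have cNg1 : cont2 (fun x y => - g1 x y) by exact: cont2_opp.
have g00 : (g2 x0 y0 != 0) || (- g1 x0 y0 != 0).
  case/orP: n00 => h; apply/orP; [right; rewrite oppr_eq0 gn1|left; rewrite gn2];
    by rewrite mulf_neq0// gt_eqF.
have [rho2 [t [g [/andP[rho20 rho2r] [cg g0 DT DC2]]]]] :=
  integrating_factor_exists cg2 cNg1 ck r0 g00 flux2.
pose rho := Num.min rho1 rho2.
have rho0 : 0 < rho by rewrite lt_min rho10.
have lr1 (z : R) : `|z| < rho -> `|z| < rho1 by rewrite lt_min => /andP[].
have lr2 (z : R) : `|z| < rho -> `|z| < rho2 by rewrite lt_min => /andP[].
have lr (z : R) : `|z| < rho -> `|z| < r by move=> /lr1 h; exact: lt_le_trans rho1r.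
(* For N the integrating factor gives grad S1 = f (-n2, n1), which is - f N^perp. *)
pose s x y := - S1 x y.
pose sx x y := f x y * n2 x y; pose sy x y := - (f x y * n1 x y).
(* The second gradient is g (g1, g2) = g D N, so the chart is built with [gd] in the role of its
   [g]. *)
pose gd x y := g x y * dd x y.
pose tx x y := gd x y * n1 x y; pose ty x y := gd x y * n2 x y.
have Ds x y : `|x - x0| < rho /\ `|y - y0| < rho -> has_partials s sx sy x y.
  move=> [hx hy]; have [D1 D2] := DS1 x y (lr1 _ hx) (lr1 _ hy); split.
    by apply: (is_derive1_eq (is_deriveN D1)); rewrite opprK.
  exact: is_deriveN D2.
have Dt x y : `|x - x0| < rho /\ `|y - y0| < rho -> has_partials t tx ty x y.
  move=> [hx hy]; have [D1 D2] := DT x y (lr2 _ hx) (lr2 _ hy); split.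
    by apply: (is_derive1_eq D1); rewrite /tx gn1 /gd; ring.
  by apply: (is_derive1_eq D2); rewrite /ty gn2 /gd mulrA.
have cgd : cont2 gd by exact: cont2_mul.
have gd0 x y : 0 < gd x y by rewrite mulr_gt0.
have [U [Phi [Up0 Ubox diffeo dPsi curves]]] :=
  orthogonal_chart rho0 cn1 cn2 cf cgd nn f0 gd0 Ds Dt.
have [[oU _ _] [[C1s C1t] _ PhiPsi]] := diffeo.
have Ur p : U p -> `|p.1 - x0| < r /\ `|p.2 - y0| < r.
  by move=> /Ubox[hx hy]; split; exact: lr.
have UO : U `<=` Omega by move=> [x y] /Ur[hx hy]; apply: hb; exact: ltW.
have EU h p : U p -> E h p.1 p.2 = h p.
  by case: p => x y /Ur[hx hy]; rewrite EE.
have C0U h : (forall p, Omega p -> {for p, continuous h}) -> C0on U h.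
  by move=> ch; apply/(C0onP _ oU) => p /UO; exact: ch.
have C0cont2 h : cont2 h -> C0on U (fun p => h p.1 p.2).
  by move=> /cont2P ch; apply/(C0onP _ oU) => p _; exact: ch.
have NpE p : U p -> (n2 p.1 p.2, - n1 p.1 p.2) = Nperp p.
  by move=> Op; rewrite /n1 /n2 !EU.
have NE' p : U p -> (n1 p.1 p.2, n2 p.1 p.2) = N p.
  by move=> Op; rewrite /n1 /n2 !EU// -surjective_pairing.
have DE p : U p -> D p = dd p.1 p.2 by move=> Op; rewrite -(EU D _ Op).
have curveT p : U p -> exists I gam, [/\ integral_curve Nperp U I gam, I 0, gam 0 = p &
    [set q | U q /\ t q.1 q.2 = t p.1 p.2] = gam @` I].
  move=> /curves[[I [gam [ic I0 g0' im]]] _]; exists I, gam; split=> //.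
  exact: integral_curve_eq NpE ic.
have curveS p : U p -> exists I gam, [/\ integral_curve N U I gam, I 0, gam 0 = p &
    [set q | U q /\ s q.1 q.2 = s p.1 p.2] = gam @` I].
  move=> /curves[_ [I [gam [ic I0 g0' im]]]]; exists I, gam; split=> //.
  exact: integral_curve_eq NE' ic.
have curve_comp V I gam z : integral_curve V U I gam -> I z ->
    [/\ U (gam z), is_derive z (1 : R) (fun y => (gam y).1) (V (gam z)).1 &
      is_derive z (1 : R) (fun y => (gam y).2) (V (gam z)).2].
  by case=> _ _ _ hI /hI[? /is_derive_pairP[]].
exists U, (fun p => s p.1 p.2), (fun p => t p.1 p.2), (fun p => f p.1 p.2),
  (fun p => g p.1 p.2).
split; first by split.
split.
  split=> //.
    by move=> c [p [Op <-]]; have [I [gam [ic _ _ im]]] := curveT p Op; exists I, gam.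
  by move=> c [p [Op <-]]; have [I [gam [ic _ _ im]]] := curveS p Op; exists I, gam.
split.
  split; [exact: C0cont2|exact: C0cont2|by []|].
  move=> p Op; rewrite (has_partials_grad (Ds _ _ (Ubox _ Op))).
  rewrite (has_partials_grad (Dt _ _ (Ubox _ Op))) -NpE// -NE'// DE//.
  have pE (l a b : R) : l *: (a, b) = (l * a, l * b) by [].
  by rewrite !pE mulrN.
split.
  exists (fun p => - (f p.1 p.2 * H p)), (fun p => - (rot2 F p * g p.1 p.2 / D p)).
  have ccf := (cont2P f).1 cf; have ccg := (cont2P g).1 cg.
  split.
  - apply: C0U => p Op; apply: cvgN; apply: cvgM; [exact: ccf|exact: cH].
  - apply: C0U => p Op; apply: cvgN; apply: cvgM; last exact: cDi.
    by apply: cvgM; [exact: crot|exact: ccg].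
  - move=> p Op; split; split.
    + by have [I [gam [ic I0 g0' _]]] := curveS p Op; exists I, gam.
    (* Seed curves are integral curves of the field N itself, hence speed 1. *)
    + move=> I gam ic I0 gam0; have [oI iI _ _] := ic.
      apply: (is_derive1_eq (DC1 I (fun z => (gam z).1) (fun z => (gam z).2)
        (fun=> 1) oI iI _ 0 I0)).
        move=> z Iz; have [Oz Dx Dy] := curve_comp _ _ _ _ ic Iz.
        have [hx hy] := Ubox _ Oz; rewrite -NE' in Dx Dy => //.
        by rewrite !mul1r; split=> //; exact: lr1.
      by rewrite gam0 mul1r /hH' EU.
    + by have [I [gam [ic I0 g0' _]]] := curveT p Op; exists I, gam.
    (* Characteristic curves follow D N^perp at speed 1/D, which divides the curl by D. *)
    + move=> I gam ic I0 gam0; have [oI iI _ _] := ic.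
      apply: (is_derive1_eq (DC2 I (fun z => (gam z).1) (fun z => (gam z).2)
        (fun z => (dd (gam z).1 (gam z).2)^-1) oI iI _ 0 I0)).
        move=> z Iz; have [Oz Dx Dy] := curve_comp _ _ _ _ ic Iz.
        have [hx hy] := Ubox _ Oz; rewrite -NpE in Dx Dy => //.
        have dz : dd (gam z).1 (gam z).2 != 0 by rewrite gt_eqF.
        split; [exact: lr2|exact: lr2| |].
          by apply: (is_derive1_eq Dx); rewrite gn2 mulKf.
        by apply: (is_derive1_eq Dy); rewrite gn1 mulrN mulKf.
      by rewrite gam0 /k /dd !EU//; ring.
  - move=> p Op; split; first by rewrite addNr.
    by rewrite addNr.
(* The neighbourhood [U] is already the domain of the chart and serves as Omega'' too. *)
exists U, Phi => /=; split=> // p Op v w; have [_ dE] := dPsi p Op.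
rewrite /pullback /diag_metric /euclidean_metric /dotp dE /= PhiPsi// DE// /gd.
have := nn p.1 p.2; have := f0 p.1 p.2; have := g0 p.1 p.2; have := dd0 p.1 p.2.
move: (n1 _ _) (n2 _ _) (f _ _) (g _ _) (dd _ _) => a b f' g' d' d'0 g'0 f'0 nn'.
(* After division by the lengths, what remains is the sum of products of the components along N^perp
   and N, that is |N|^2 times the Euclidean product. *)
transitivity ((a * a + b * b) * (v.1 * w.1 + v.2 * w.2)); last by rewrite nn' mul1r.
by field; rewrite !gt_eqF.
Qed.
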